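(* Let $\tilde a_n\in\mathbb R$, $\tilde b_n>0$ $(n\ge0)$ be Jacobi parameters that are $\gamma$-tempered, where $(\gamma_n)_{n=0}^\infty$ is a sequence of positive numbers tending to infinity with $\lim_{n\to\infty}(\sqrt{\gamma_{n+1}}-\sqrt{\gamma_n})=0$. Let $a_n\in\mathbb R$, $b_n>0$ be Jacobi parameters of the form $$b_n=\tilde b_n(1+\tilde\chi_n),\qquad a_n=\tilde a_n(1+\tilde\mu_n),$$ where $\tilde\chi_n,\tilde\mu_n$ are such that $$\sum_{n=0}^\infty\sqrt{\gamma_n}\,(|\tilde\chi_n|+|\tilde\mu_n|)<\infty.$$ Assume that the limit (which exists) $$\tau_0=\frac14\lim_{n\to\infty}\gamma_n\frac{\tilde a_n^2-4\tilde b_{n-1}\tilde b_n}{\tilde b_n^2}$$ is negative. Further assume $\sum_{n=0}^\infty\frac{\sqrt{\gamma_n}}{b_n}<\infty$, and that $(b_n)$ and $(\gamma_n)$ are regularly varying sequences with indices in $(0,2)$. Then the Jacobi matrix $\mathscr J$ with parameters $a_n,b_n$ is in limit circle case and its Nevanlinna matrix $W$ satisfies, for sufficiently large $r$, $$\max_{|z|=r}\log\|W(z)\|\asymp r\sum_{n=h(r)}^\infty\frac{\sqrt{\gamma_n}}{b_n},$$ where $h(r)=\max\{n\in\mathbb N\cup\{0\}:\ \frac{b_n}{\gamma_n}<r\}$.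
   Context: **$\gamma$-tempered.** Let $(\gamma_n)_{n\ge0}$ be positive, $\gamma_n\to\infty$, $\sqrt{\gamma_{n+1}}-\sqrt{\gamma_n}\to0$. Jacobi parameters $\tilde a_n\in\mathbb R,\tilde b_n>0$ are called $\gamma$-tempered if $\lim\tilde b_n=\infty$, $\lim\tilde b_{n-1}/\tilde b_n=1$, $\lim\tilde a_n/\tilde b_n=\mu$ for some $\mu\in\{-2,2\}$, and all of the following sequences ($n\ge1$) are of bounded variation: $$\sqrt{\gamma_n}\Big(\tfrac{\tilde b_{n-1}}{\tilde b_n}-1\Big),\quad \sqrt{\gamma_n}\Big(\tfrac{\tilde a_n}{\tilde b_n}-\mu\Big),\quad \tfrac{\gamma_n}{\tilde b_n},\quad \sqrt{\gamma_n}-\sqrt{\gamma_{n-1}},\quad \tfrac1{\sqrt{\gamma_n}},\quad \gamma_n\Big(1-\tfrac{\tilde b_{n-1}}{\tilde b_n}+\operatorname{sgn}(\mu)\big(\tfrac{\tilde a_n}{\tilde b_n}-\mu\big)\Big).$$ A sequence $(x_n)$ is of bounded variation if $\sum_n|x_{n+1}-x_n|<\infty$. **Regular variation.** A sequence $(c_n)$ of positive numbers is regularly varying with index $\alpha\in\mathbb R$ if $\lim_{n\to\infty}c_{\lfloor\lambda n\rfloor}/c_n=\lambda^\alpha$ for all $\lambda>0$. **Jacobi matrix.** $\mathscr J$ is the tridiagonal matrix with diagonal $(a_n)_{n\ge0}$ and off-diagonal $(b_n)_{n\ge0}$. Its minimal operator is the closure in $\ell^2(\mathbb N_0)$ of $u\mapsto\mathscr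 Ju$ on finitely supported sequences. $\mathscr J$ is in limit circle case if the minimal operator is not self-adjoint (equivalently, for every $z\in\mathbb C$ all solutions of $b_nu_{n+1}+a_nu_n+b_{n-1}u_{n-1}=zu_n$, $n\ge1$, are in $\ell^2$; equivalently, the associated Hamburger moment problem is indeterminate). **Nevanlinna matrix.** Let $p_n,q_n$ be the orthogonal polynomials of first and second kind: both solve $b_nu_{n+1}(z)+a_nu_n(z)+b_{n-1}u_{n-1}(z)=zu_n(z)$, $n\ge1$, with $p_0=1$, $p_1(z)=(z-a_0)/b_0$, $q_0=0$, $q_1=1/b_0$. In limit circle case the Nevanlinna matrix is the entire matrix function $W=\begin{pmatrix} A & C \\ B & D \end{pmatrix}$ with $A(z)=z\sum_k q_k(0)q_k(z)$, $B(z)=-1+z\sum_k q_k(0)p_k(z)$, $C(z)=1+z\sum_k p_k(0)q_k(z)$, $D(z)=z\sum_k p_k(0)p_k(z)$. **Comparison.** $f\asymp g$ for sufficiently large $r$ means that there are $c,C,r_0>0$ with $cg(r)\le f(r)\le Cg(r)$ for all $r\ge r_0$. *)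

(* Defs.v *)
From Stdlib Require Import Reals ZArith ClassicalEpsilon.
From Coquelicot Require Import Coquelicot.
Open Scope R_scope.

Definition bounded_variation (x : nat -> R) : Prop :=
  ex_series (fun n => Rabs (x (S n) - x n)).

(* The sequences that start at index 1 are shifted: index [S n], [n : nat]. *)
Definition tempered (gamma a b : nat -> R) : Prop :=
  is_lim_seq b p_infty /\
  is_lim_seq (fun n => b n / b (S n)) 1 /\
  exists mu : R,
    (mu = -2 \/ mu = 2) /\
    is_lim_seq (fun n => a n / b n) mu /\
    bounded_variation (fun n => sqrt (gamma (S n)) * (b n / b (S n) - 1)) /\
    bounded_variation (fun n => sqrt (gamma (S n)) * (a (S n) / b (S n) - mu)) /\
    bounded_variation (fun n => gamma (S n) / b (S n)) /\
    bounded_variation (fun n => sqrt (gamma (S n)) - sqrt (gamma n)) /\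
    bounded_variation (fun n => 1 / sqrt (gamma (S n))) /\
    bounded_variation
      (fun n => gamma (S n) *
         (1 - b n / b (S n) + sign mu * (a (S n) / b (S n) - mu))).

Definition tau_seq (gamma a b : nat -> R) (n : nat) : R :=
  gamma (S n) * (((a (S n)) ^ 2 - 4 * b n * b (S n)) / (b (S n)) ^ 2).

Definition tau0 (gamma a b : nat -> R) : R :=
  1 / 4 * real (Lim_seq (tau_seq gamma a b)).

Definition regularly_varying (c : nat -> R) (alpha : R) : Prop :=
  forall lambda : R, 0 < lambda ->
    is_lim_seq (fun n => c (Z.to_nat (Zfloor (lambda * INR n))) / c n)
      (Rpower lambda alpha).

(* Coquelicot's [Series] is real-valued. *)
Definition CSeries (f : nat -> C) : C :=
  (Series (fun n => Re (f n)), Series (fun n => Im (f n))).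

Definition l2 (u : nat -> C) : Prop := ex_series (fun n => (Cmod (u n)) ^ 2).

Definition l2norm (u : nat -> C) : R := sqrt (Series (fun n => (Cmod (u n)) ^ 2)).

Definition l2inner (u v : nat -> C) : C :=
  CSeries (fun n => Cmult (u n) (Cconj (v n))).

Definition finitely_supported (u : nat -> C) : Prop :=
  exists N : nat, forall n : nat, (N <= n)%nat -> u n = RtoC 0.

Definition jacobi_apply (a b : nat -> R) (u : nat -> C) (n : nat) : C :=
  match n with
  | O => (a O * u O + b O * u 1%nat)%C
  | S m => (b m * u m + a n * u n + b n * u (S n))%C
  end.

(* A (possibly unbounded) operator in l2 is given by its graph. *)
Definition l2graph : Type := (nat -> C) -> (nat -> C) -> Prop.

(* The closure, in l2 x l2, of the graph of [jacobi_apply a b] on the finitely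
   supported sequences. *)
Definition minimal_operator (a b : nat -> R) : l2graph :=
  fun u v =>
    l2 u /\ l2 v /\
    forall eps : R, 0 < eps ->
      exists x : nat -> C,
        finitely_supported x /\
        l2norm (fun n => Cminus (u n) (x n)) < eps /\
        l2norm (fun n => Cminus (v n) (jacobi_apply a b x n)) < eps.

Definition adjoint (T : l2graph) : l2graph :=
  fun u v =>
    l2 u /\ l2 v /\
    forall x y : nat -> C, T x y -> l2inner y u = l2inner x v.

Definition self_adjoint (T : l2graph) : Prop :=
  forall u v : nat -> C, T u v <-> adjoint T u v.

Definition limit_circle (a b : nat -> R) : Prop :=
  ~ self_adjoint (minimal_operator a b).

Fixpoint jacobi_solution (a b : nat -> R) (u0 u1 z : C) (n : nat) : C :=
  match n with
  | O => u0
  | S m =>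
      match m with
      | O => u1
      | S k =>
          (((z - a m) * jacobi_solution a b u0 u1 z m
            - b k * jacobi_solution a b u0 u1 z k) / b m)%C
      end
  end.

Definition poly_p (a b : nat -> R) (n : nat) (z : C) : C :=
  jacobi_solution a b (RtoC 1) ((z - a O) / b O)%C z n.

Definition poly_q (a b : nat -> R) (n : nat) (z : C) : C :=
  jacobi_solution a b (RtoC 0) (1 / b O)%C z n.

Definition nev_A (a b : nat -> R) (z : C) : C :=
  (z * CSeries (fun k => poly_q a b k 0 * poly_q a b k z))%C.
Definition nev_B (a b : nat -> R) (z : C) : C :=
  (-1 + z * CSeries (fun k => poly_q a b k 0 * poly_p a b k z))%C.
Definition nev_C (a b : nat -> R) (z : C) : C :=
  (1 + z * CSeries (fun k => poly_p a b k 0 * poly_q a b k z))%C.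
Definition nev_D (a b : nat -> R) (z : C) : C :=
  (z * CSeries (fun k => poly_p a b k 0 * poly_p a b k z))%C.

(* A 2x2 matrix is the pair of its rows. *)
Definition cmat2 : Type := ((C * C) * (C * C))%type.

Definition nevanlinna (a b : nat -> R) (z : C) : cmat2 :=
  ((nev_A a b z, nev_C a b z),
   (nev_B a b z, nev_D a b z)).

Definition euclid2 (x y : C) : R := sqrt ((Cmod x) ^ 2 + (Cmod y) ^ 2).

(* The operator norm induced by the Euclidean norm of C^2. *)
Definition mat_norm (M : cmat2) : R :=
  let '((m11, m12), (m21, m22)) := M in
  real (Lub_Rbar (fun t => exists x y : C,
    euclid2 x y = 1 /\
    t = euclid2 (m11 * x + m12 * y)%C (m21 * x + m22 * y)%C)).

(* For a continuous non-vanishing [W] the supremum over the circle is attained. *)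
Definition max_log_norm (W : C -> cmat2) (r : R) : R :=
  real (Lub_Rbar (fun t => exists z : C, Cmod z = r /\ t = ln (mat_norm (W z)))).

Definition is_max_nat (P : nat -> Prop) (n : nat) : Prop :=
  P n /\ forall m : nat, P m -> (m <= n)%nat.

(* Unspecified when there is no maximum. *)
Definition max_nat (P : nat -> Prop) : nat :=
  epsilon (inhabits O) (is_max_nat P).

Definition h_index (gamma b : nat -> R) (r : R) : nat :=
  max_nat (fun n => b n / gamma n < r).

Definition tail_sum (x : nat -> R) (N : nat) : R := Series (fun k => x (N + k)%nat).

Definition asymp_infty (f g : R -> R) : Prop :=
  exists c C r0 : R, 0 < c /\ 0 < C /\ 0 < r0 /\
    forall r : R, r0 <= r -> c * g r <= f r <= C * g r.

(* Main.v *)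
From Stdlib Require Import Reals Lra Lia Psatz ZArith.
From Stdlib Require Import ClassicalEpsilon Classical FunctionalExtensionality.
From Coquelicot Require Import Coquelicot.
Require Import Defs.

(** Let [p], [q] be the solutions at [0].  By variation of constants the
    coefficients of a solution at [z] with respect to [p], [q] follow a discrete
    canonical system, and the entries of [W z] are, up to sign, the limits of
    these coefficients ([nevanlinna_lim]).  So both claims depend only on the
    vectors [(p n, q n)] and on the difference equation that they satisfy.

    Size of [p], [q].  After a change of sign the diagonal is close to [-2 b n],
    solutions at [0] vary slowly, and [tau0 < 0] says that the transfer matrices
    are elliptic.  An elliptic matrix preserves a definite quadratic form up to its
    determinant; after scaling by [sqrt (gamma n)] the coefficients of these forms
    have bounded variation, so the form is an energy conserved up to constants
    ([energy_bounded]).  This gives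
    [u (n+1) ^ 2 + gamma (n+1) * (u (n+1) - u n) ^ 2 <= K * rate (n+1)] for every
    solution at [0], where [rate n = sqrt (gamma n) / b n].  The rates are summable,
    so [p] and [q] are square summable and lie in the domain of the adjoint, which
    is not symmetric on them ([limit_circle_of_l2]).

    Upper bound.  Beyond [h = h r] a step of the canonical system at [z] with
    [|z| = r] costs a factor at most [1 + C * r * rate n] ([canonical_tail]).  Below
    [h], where [r] exceeds a constant times [b n / gamma n], the solution and its
    quasi-derivative are measured on the scale [sqrt (r * b n)] and a step costs
    [1 + C * sqrt (r / b n)] up to summable terms ([canonical_head_step]).

    Lower bound, at [z = i r].  The imaginary part of [conj alpha * beta], for the
    two coefficients of a solution, increases by [r] times the squared modulus of
    the solution.  This may be small compared with the squared norm of the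
    coefficients near zeros of the solution; there a virial form, the
    discrete version of [gamma * u * u'], increases instead.  A suitable
    combination of the two grows by a factor [1 + c * r * rate n] in each step beyond
    [h] ([canonical_growth], [growth_lower]).

    Comparison.  Regular variation bounds the sum of [sqrt (r / b n)] over [n <= h]
    by a constant times [h * sqrt (r / b h)], and [r * h * rate h] by a constant
    times [r] times the tail of the rates.  Since [b h / gamma h < r], one has
    [h * sqrt (r / b h) <= r * h * rate h].  These estimates need regular variation uniformly in the
    ratio of the indices, which is a Baire category argument ([rv_window]). *)

Open Scope R_scope.

Ltac sq_ge0 x := pose proof (pow2_ge_0 x).
Ltac abs_ge0 x := pose proof (Rabs_pos x).
Ltac mod_ge0 x := pose proof (Cmod_ge_0 x).
Ltac mul_l := apply Rmult_le_compat_l; try lra.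
Ltac mul_r := apply Rmult_le_compat_r; try lra.
Tactic Notation "bound_by" uconstr(t) := eapply Rle_trans; [apply t|].

(** * Partial sums, products and bounded variation *)

Fixpoint psum (f : nat -> R) (n : nat) : R :=
  match n with
  | O => 0
  | S m => psum f m + f m
  end.

Lemma psum_sum_n (f : nat -> R) (n : nat) : psum f (S n) = sum_n f n.
Proof.
  induction n as [|n IH].
  - simpl. rewrite sum_O. ring.
  - rewrite sum_Sn, <- IH. reflexivity.
Qed.

Lemma psum_lim (f : nat -> R) :
  ex_series f -> is_lim_seq (psum f) (Series f).
Proof.
  intros Hf. apply is_lim_seq_incr_1.
  apply is_lim_seq_ext with (sum_n f).
  - intros n. symmetry. apply psum_sum_n.
  - exact (Series_correct f Hf).
Qed.

Lemma psum_nonneg (f : nat -> R) (n : nat) :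
  (forall k, 0 <= f k) -> 0 <= psum f n.
Proof. intros Hf. induction n as [|n IH]; simpl; [lra|]. specialize (Hf n). lra. Qed.

Lemma psum_le (f g : nat -> R) (n : nat) :
  (forall k, (k < n)%nat -> f k <= g k) -> psum f n <= psum g n.
Proof.
  induction n as [|n IH]; intros H; simpl; [lra|].
  assert (psum f n <= psum g n) by (apply IH; intros; apply H; lia).
  assert (f n <= g n) by (apply H; lia). lra.
Qed.

Lemma psum_plus (f g : nat -> R) (n : nat) :
  psum (fun k => f k + g k) n = psum f n + psum g n.
Proof. induction n as [|n IH]; simpl; [lra|]. rewrite IH. ring. Qed.

Lemma psum_scal (c : R) (f : nat -> R) (n : nat) :
  psum (fun k => c * f k) n = c * psum f n.
Proof. induction n as [|n IH]; simpl; [lra|]. rewrite IH. ring. Qed.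

Lemma psum_split (f : nat -> R) (n m : nat) :
  psum f (n + m) = psum f n + psum (fun k => f (n + k)%nat) m.
Proof.
  induction m as [|m IH].
  - rewrite Nat.add_0_r. simpl. ring.
  - rewrite Nat.add_succ_r. simpl. rewrite IH. ring.
Qed.

Lemma psum_const (c : R) (n : nat) : psum (fun _ => c) n = INR n * c.
Proof. induction n as [|n IH]; [simpl; ring|]. rewrite S_INR. simpl. rewrite IH. ring. Qed.

Lemma psum_mono (f : nat -> R) (n m : nat) :
  (forall k, 0 <= f k) -> (n <= m)%nat -> psum f n <= psum f m.
Proof.
  intros Hf Hnm. replace m with (n + (m - n))%nat by lia.
  rewrite psum_split.
  assert (0 <= psum (fun k => f (n + k)%nat) (m - n)) by (apply psum_nonneg; intros; apply Hf).
  lra.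
Qed.

Lemma psum_le_Series (f : nat -> R) (n : nat) :
  (forall k, 0 <= f k) -> ex_series f -> psum f n <= Series f.
Proof.
  intros Hf Hs.
  apply (is_lim_seq_incr_compare (psum f)).
  - apply psum_lim, Hs.
  - intros k. simpl. specialize (Hf k). lra.
Qed.

Lemma ex_series_of_psum_bounded (f : nat -> R) (M : R) :
  (forall k, 0 <= f k) -> (forall n, psum f n <= M) -> ex_series f.
Proof.
  intros Hf HM.
  destruct (ex_finite_lim_seq_incr (sum_n f) M) as [l Hl].
  - intros n. rewrite sum_Sn. unfold plus; simpl. specialize (Hf (S n)). lra.
  - intros n. rewrite <- psum_sum_n. apply HM.
  - exists l. exact Hl.
Qed.

Lemma ex_series_nonneg_le (f g : nat -> R) :
  (forall n, 0 <= f n <= g n) -> ex_series g -> ex_series f.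
Proof.
  intros H Hg. apply (ex_series_le f g); [|exact Hg].
  intros n. unfold norm; simpl. unfold abs; simpl.
  rewrite Rabs_pos_eq; apply H.
Qed.

Lemma ex_series_scal_R (c : R) (f : nat -> R) :
  ex_series f -> ex_series (fun n => c * f n).
Proof. intros H. exact (ex_series_scal_l (K := R_AbsRing) (V := R_NormedModule) c f H). Qed.

Lemma ex_series_plus_R (f g : nat -> R) :
  ex_series f -> ex_series g -> ex_series (fun n => f n + g n).
Proof. intros Hf Hg. exact (ex_series_plus f g Hf Hg). Qed.

Lemma ex_series_shift (f : nat -> R) (N : nat) :
  ex_series f <-> ex_series (fun k => f (N + k)%nat).
Proof. exact (ex_series_incr_n f N). Qed.

Lemma ex_series_S (f : nat -> R) :
  ex_series f -> ex_series (fun k => f (S k)).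
Proof. intros H. apply (ex_series_incr_1 f). exact H. Qed.

Lemma bounded_of_lim (x : nat -> R) :
  ex_finite_lim_seq x -> exists M, 0 < M /\ forall n, Rabs (x n) <= M.
Proof.
  intros [l Hl].
  apply is_lim_seq_spec in Hl.
  destruct (Hl (mkposreal 1 Rlt_0_1)) as [N HN]. simpl in HN.
  assert (Hfin : forall K : nat, exists M, forall n, (n < K)%nat -> Rabs (x n) <= M).
  { induction K as [|K [M HM]].
    - exists 0. intros; lia.
    - exists (Rmax M (Rabs (x K))). intros n Hn.
      destruct (Nat.eq_dec n K) as [->|Hne]; [apply Rmax_r|].
      eapply Rle_trans; [apply HM; lia|apply Rmax_l]. }
  destruct (Hfin N) as [M HM].
  exists (Rmax M (Rabs l + 1) + 1). split.
  - pose proof (Rmax_r M (Rabs l + 1)). abs_ge0 l. lra.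
  - intros n. destruct (le_lt_dec N n) as [H|H].
    + specialize (HN n H). pose proof (Rmax_r M (Rabs l + 1)).
      pose proof (Rabs_triang_inv (x n) l). lra.
    + specialize (HM n H). pose proof (Rmax_l M (Rabs l + 1)). lra.
Qed.

(** Finitely many indices only change the constant, because [g] is positive. *)
Lemma eventually_all_le (f g : nat -> R) (C : R) (N : nat) :
  (forall n, 0 < g n) -> (forall n, (N <= n)%nat -> f n <= C * g n) ->
  exists C', 0 < C' /\ forall n, f n <= C' * g n.
Proof.
  intros Hg HC.
  induction N as [|N IH].
  - exists (Rmax C 1). split; [pose proof (Rmax_r C 1); lra|].
    intros n. eapply Rle_trans; [apply HC; lia|].
    apply Rmult_le_compat_r; [specialize (Hg n); lra|apply Rmax_l].
  - destruct (classic (f N <= C * g N)) as [H|H].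
    + apply IH. intros n Hn. destruct (Nat.eq_dec n N) as [->|]; [exact H|apply HC; lia].
    + clear IH.
      assert (Hfin : forall K : nat, exists C', forall n, (n < K)%nat -> f n <= C' * g n).
      { clear - Hg. induction K as [|K [C1 H1]].
        - exists 0. intros; lia.
        - exists (Rmax C1 (f K / g K)). intros n Hn.
          destruct (Nat.eq_dec n K) as [->|Hne].
          + pose proof (Rmax_r C1 (f K / g K)). specialize (Hg K).
            apply Rle_trans with (f K / g K * g K); [right; field; lra|].
            mul_r.
          + eapply Rle_trans; [apply H1; lia|].
            apply Rmult_le_compat_r; [specialize (Hg n); lra|apply Rmax_l]. }
      destruct (Hfin (S N)) as [C1 H1].
      exists (Rmax (Rmax C C1) 1). split; [pose proof (Rmax_r (Rmax C C1) 1); lra|].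
      intros n.
      pose proof (Rmax_l (Rmax C C1) 1). pose proof (Rmax_l C C1). pose proof (Rmax_r C C1).
      specialize (Hg n).
      destruct (le_lt_dec (S N) n) as [Hn|Hn].
      * eapply Rle_trans; [apply HC; lia|]. mul_r.
      * eapply Rle_trans; [apply H1; lia|]. mul_r.
Qed.

Lemma exp_ge_1p (x : R) : 1 + x <= exp x.
Proof. destruct (Req_dec x 0) as [->|H]; [rewrite exp_0; lra|].
  pose proof (exp_ineq1 x H). lra. Qed.

Lemma exp_le (x y : R) : x <= y -> exp x <= exp y.
Proof. intros [H| ->]; [left; apply exp_increasing, H|right; reflexivity]. Qed.

Lemma gronwall (E k : nat -> R) :
  (forall n, E (S n) <= exp (k n) * E n) -> forall n, E n <= E O * exp (psum k n).
Proof.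
  intros Hk n. induction n as [|n IH]; simpl.
  - rewrite exp_0. lra.
  - rewrite exp_plus. bound_by Hk. pose proof (exp_pos (k n)).
    rewrite <- Rmult_assoc, (Rmult_comm _ (exp (k n))). mul_l.
Qed.

Lemma exp_factor (x y : R) : 0 <= y -> (1 + x) * y <= exp x * y.
Proof. intros Hy. apply Rmult_le_compat_r; [exact Hy|apply exp_ge_1p]. Qed.

(** Since [1 / (1 + x) = 1 - x / (1 + x) <= exp (- x / (1 + x))], a factor
    [1 + x] with [0 <= x <= M] is at least [exp (x / (1 + M))]. *)
Lemma exp_le_1p (x M : R) : 0 <= x <= M -> exp (x / (1 + M)) <= 1 + x.
Proof.
  intros [H0 HM].
  apply Rle_trans with (exp (x / (1 + x))).
  - apply exp_le. unfold Rdiv. mul_l.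
    apply Rinv_le_contravar; lra.
  - pose proof (exp_ge_1p (- (x / (1 + x)))) as H.
    replace (1 + - (x / (1 + x))) with (/ (1 + x)) in H by (field; lra).
    rewrite exp_Ropp in H.
    apply Rinv_le_contravar in H; [|apply Rinv_0_lt_compat; lra].
    rewrite !Rinv_inv in H. exact H.
Qed.

Lemma gronwall_lower (E k : nat -> R) (M : R) :
  (forall n, 0 <= k n <= M) -> 0 <= E O ->
  (forall n, 0 <= E n -> (1 + k n) * E n <= E (S n)) ->
  forall n, E O * exp (psum k n / (1 + M)) <= E n.
Proof.
  intros Hk H0 Hrec n.
  enough (0 <= E n /\ E O * exp (psum k n / (1 + M)) <= E n) by tauto.
  induction n as [|n [IH0 IH]]; simpl.
  - unfold Rdiv. rewrite Rmult_0_l, exp_0. lra.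
  - specialize (Hrec n IH0). pose proof (Hk n) as Hkn. split; [nra|].
    replace ((psum k n + k n) / (1 + M)) with (psum k n / (1 + M) + k n / (1 + M)) by (field; lra).
    rewrite exp_plus, <- Rmult_assoc.
    eapply Rle_trans; [|exact Hrec].
    rewrite Rmult_comm.
    pose proof (exp_pos (k n / (1 + M))). pose proof (exp_pos (psum k n / (1 + M))).
    apply Rmult_le_compat; [lra| nra | |exact IH].
    apply exp_le_1p, Hk.
Qed.

(** ** Sequences of bounded variation *)

Lemma bv_lim (x : nat -> R) : bounded_variation x -> ex_finite_lim_seq x.
Proof.
  intros H. apply ex_series_Rabs in H.
  exists (x O + Series (fun n => x (S n) - x n))%R.
  apply is_lim_seq_ext with (fun n => x O + psum (fun n => x (S n) - x n) n).
  - intros n. induction n as [|n IH]; simpl; [ring|]. lra.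
  - apply is_lim_seq_plus'; [apply is_lim_seq_const|apply psum_lim, H].
Qed.

Lemma bv_bounded (x : nat -> R) :
  bounded_variation x -> exists M, 0 < M /\ forall n, Rabs (x n) <= M.
Proof. intros H. apply bounded_of_lim, bv_lim, H. Qed.

Lemma bv_ext (x y : nat -> R) :
  (forall n, x n = y n) -> bounded_variation x -> bounded_variation y.
Proof.
  intros He H. unfold bounded_variation. eapply ex_series_ext; [|exact H].
  intros n. simpl. rewrite !He. reflexivity.
Qed.

Lemma bv_const (c : R) : bounded_variation (fun _ => c).
Proof.
  apply (ex_series_of_psum_bounded _ 0).
  - intros; apply Rabs_pos.
  - intros n. rewrite psum_const, Rminus_diag, Rabs_R0. lra.
Qed.

Lemma bv_plus (x y : nat -> R) :
  bounded_variation x -> bounded_variation y -> bounded_variation (fun n => x n + y n).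
Proof.
  intros Hx Hy. eapply ex_series_nonneg_le; [|exact (ex_series_plus_R _ _ Hx Hy)].
  intros n. simpl. split; [apply Rabs_pos|].
  replace (x (S n) + y (S n) - (x n + y n)) with ((x (S n) - x n) + (y (S n) - y n)) by ring.
  apply Rabs_triang.
Qed.

Lemma bv_mult (x y : nat -> R) :
  bounded_variation x -> bounded_variation y -> bounded_variation (fun n => x n * y n).
Proof.
  intros Hx Hy.
  destruct (bv_bounded x Hx) as [M [HM0 HM]]. destruct (bv_bounded y Hy) as [L [HL0 HL]].
  eapply ex_series_nonneg_le;
    [|exact (ex_series_plus_R _ _ (ex_series_scal_R M _ Hy) (ex_series_scal_R L _ Hx))].
  intros n. simpl. split; [apply Rabs_pos|].
  replace (x (S n) * y (S n) - x n * y n)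
    with (x (S n) * (y (S n) - y n) + y n * (x (S n) - x n)) by ring.
  bound_by Rabs_triang. rewrite !Rabs_mult.
  apply Rplus_le_compat; apply Rmult_le_compat_r; auto; apply Rabs_pos.
Qed.

Lemma bv_scal (c : R) (x : nat -> R) :
  bounded_variation x -> bounded_variation (fun n => c * x n).
Proof. intros H. apply bv_mult; [apply bv_const|exact H]. Qed.

Lemma bv_S (x : nat -> R) : bounded_variation x -> bounded_variation (fun n => x (S n)).
Proof. intros H. exact (ex_series_S _ H). Qed.

(** * Regularly varying sequences *)

Lemma floor_nat (x : R) (m : nat) :
  INR m <= x < INR m + 1 -> Z.to_nat (Zfloor x) = m.
Proof.
  intros H.
  rewrite (Zfloor_eq (Z.of_nat m)); [apply Nat2Z.id|].
  rewrite <- INR_IZR_INZ. exact H.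
Qed.

Definition comparable (c : nat -> R) (K : R) (n m : nat) : Prop :=
  c m <= K * c n /\ c n <= K * c m.

Lemma INR_eventually_ge (x : R) : exists N : nat, forall n, (N <= n)%nat -> x <= INR n.
Proof.
  exists (Z.to_nat (up (Rabs x))). intros n Hn. apply le_INR in Hn.
  destruct (archimed (Rabs x)) as [H1 _]. abs_ge0 x. pose proof (Rle_abs x).
  assert (0 <= up (Rabs x))%Z by (apply le_IZR; simpl; lra).
  rewrite INR_IZR_INZ, Z2Nat.id in Hn by assumption. lra.
Qed.

Lemma rv_eventually_comparable (c : nat -> R) (alpha lambda : R) :
  (forall n, 0 < c n) -> regularly_varying c alpha -> 0 < lambda ->
  exists N, forall n, (N <= n)%nat ->
    comparable c (INR N) n (Z.to_nat (Zfloor (lambda * INR n))).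
Proof.
  intros Hc Hrv Hl. set (L := Rpower lambda alpha). assert (HL : 0 < L) by apply exp_pos.
  pose proof (Hrv lambda Hl) as Hlim. apply is_lim_seq_spec in Hlim.
  assert (He : 0 < L / 2) by lra.
  destruct (Hlim (mkposreal _ He)) as [N1 HN1].
  destruct (INR_eventually_ge (2 * L + 2 / L)) as [N2 HN2].
  exists (Nat.max N1 N2). intros n Hn.
  specialize (HN1 n ltac:(lia)). simpl in HN1. fold L in HN1. apply Rabs_def2 in HN1.
  specialize (HN2 (Nat.max N1 N2) ltac:(lia)). set (K := INR (Nat.max N1 N2)) in *.
  assert (HLi : 0 < 2 / L) by (apply Rdiv_lt_0_compat; lra).
  set (m := Z.to_nat (Zfloor (lambda * INR n))) in *.
  pose proof (Hc n) as Hn0.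
  assert (Hr : c m = c m / c n * c n) by (field; lra).
  split; rewrite Hr; [mul_r|].
  apply Rle_trans with (2 / L * (L / 2 * c n)); [right; field; lra|].
  apply Rmult_le_compat; [lra|apply Rmult_le_pos; lra|lra|mul_r].
Qed.

Lemma comparable_trans (c : nat -> R) (K L : R) (n m l : nat) :
  0 <= K -> 0 <= L -> comparable c K n m -> comparable c L m l -> comparable c (K * L) n l.
Proof.
  intros HK HL [H1 H2] [H3 H4]. split.
  - eapply Rle_trans; [exact H3|]. rewrite (Rmult_comm K), Rmult_assoc. mul_l.
  - eapply Rle_trans; [exact H2|]. rewrite Rmult_assoc. mul_l.
Qed.

Lemma comparable_sym (c : nat -> R) (K : R) (n m : nat) :
  comparable c K n m -> comparable c K m n.
Proof. unfold comparable; tauto. Qed.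

Lemma comparable_weaken (c : nat -> R) (K L : R) (n m : nat) :
  (forall n, 0 < c n) -> K <= L -> comparable c K n m -> comparable c L n m.
Proof.
  intros Hc HKL [H1 H2]. pose proof (Hc n). pose proof (Hc m).
  split; (eapply Rle_trans; [eassumption|mul_r]).
Qed.

(** A Baire category argument. If comparability failed on every window, one
    could nest closed intervals of ratios, each of which fails at some large
    index; a common point of all of them would violate the pointwise limit. *)
Lemma rv_window (c : nat -> R) (alpha : R) :
  (forall n, 0 < c n) -> regularly_varying c alpha ->
  exists (p q : R) (N : nat), 1 <= p < q /\ q <= 2 /\
    forall n m, (N <= n)%nat -> p * INR n <= INR m < q * INR n ->
      comparable c (INR (S N)) n m.
Proof.
  intros Hc Hrv. apply NNPP. intros Hno.
  set (valid := fun I : R * R => 1 <= fst I < snd I /\ snd I <= 2).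
  assert (Hstep : forall (N : nat) (I : R * R), exists J : R * R, valid I ->
    valid J /\ fst I <= fst J /\ snd J <= snd I /\
    exists n, (N <= n)%nat /\ forall l, fst J <= l <= snd J ->
      ~ comparable c (INR (S N)) n (Z.to_nat (Zfloor (l * INR n)))).
  { intros N [p q]. destruct (classic (valid (p, q))) as [Hv|Hv]; [|exists (p, q); tauto].
    assert (Hex : exists n m, (N <= n)%nat /\ p * INR n <= INR m < q * INR n
                   /\ ~ comparable c (INR (S N)) n m).
    { apply NNPP. intros Hc'. apply Hno. exists p, q, N.
      destruct Hv as [Hv1 Hv2]. simpl in *. (repeat split); try lra.
      - apply NNPP. intros Hx. apply Hc'. exists n, m. unfold comparable; tauto.
      - apply NNPP. intros Hx. apply Hc'. exists n, m. unfold comparable; tauto. }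
    destruct Hex as [n [m [Hn [Hm Hbad]]]].
    assert (Hn0 : 0 < INR n).
    { destruct (pos_INR n) as [H|E]; [exact H|]. rewrite <- E in Hm. lra. }
    exists (INR m / INR n, Rmin q ((INR m + 1 / 2) / INR n)). intros [Hv1 Hv2]. simpl in *.
    assert (H1 : p <= INR m / INR n) by (apply Rle_div_r; lra).
    assert (H2 : INR m / INR n < q) by (apply Rlt_div_l; lra).
    assert (H3 : INR m / INR n < (INR m + 1 / 2) / INR n).
    { unfold Rdiv. apply Rmult_lt_compat_r; [apply Rinv_0_lt_compat|]; lra. }
    pose proof (Rmin_l q ((INR m + 1 / 2) / INR n)) as H4.
    pose proof (Rmin_r q ((INR m + 1 / 2) / INR n)) as H5.
    assert (H6 : INR m / INR n < Rmin q ((INR m + 1 / 2) / INR n)) by (apply Rmin_glb_lt; lra).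
    unfold valid; simpl. repeat split; try lra.
    exists n. split; [lia|]. intros l [Hl1 Hl2].
    rewrite (floor_nat _ m); [exact Hbad|].
    apply Rle_div_l in Hl1; [|lra].
    assert (l <= (INR m + 1 / 2) / INR n) as Hl3 by lra.
    apply Rle_div_r in Hl3; lra. }
  set (next := fun N I => proj1_sig (constructive_indefinite_description _ (Hstep N I))).
  assert (Hnext : forall N I, valid I ->
    valid (next N I) /\ fst I <= fst (next N I) /\ snd (next N I) <= snd I /\
    exists n, (N <= n)%nat /\ forall l, fst (next N I) <= l <= snd (next N I) ->
      ~ comparable c (INR (S N)) n (Z.to_nat (Zfloor (l * INR n)))).
  { intros N I. unfold next.
    exact (proj2_sig (constructive_indefinite_description _ (Hstep N I))). }
  set (I := fix I (i : nat) : R * R := match i with O => (1, 2) | S j => next j (I j) end).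
  assert (HI : forall i, valid (I i)).
  { induction i as [|i IH]; [unfold valid; simpl; lra|]. apply (Hnext i (I i) IH). }
  assert (HIf : forall i, fst (I i) <= fst (I (S i))) by (intros i; apply (Hnext i (I i) (HI i))).
  assert (HIs : forall i, snd (I (S i)) <= snd (I i)) by (intros i; apply (Hnext i (I i) (HI i))).
  assert (Hmf : forall i j, (i <= j)%nat -> fst (I i) <= fst (I j)).
  { intros i j Hij. induction Hij; [lra|]. specialize (HIf m). lra. }
  assert (Hms : forall i j, (i <= j)%nat -> snd (I j) <= snd (I i)).
  { intros i j Hij. induction Hij; [lra|]. specialize (HIs m). lra. }
  destruct (ex_finite_lim_seq_incr (fun i => fst (I i)) 2) as [l Hl].
  - exact HIf.
  - intros n. destruct (HI n) as [? ?]. lra.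
  - assert (Hl1 : forall i, fst (I i) <= l).
    { intros i. exact (is_lim_seq_incr_compare _ _ Hl HIf i). }
    assert (Hl2 : forall i, l <= snd (I i)).
    { intros i. apply (is_lim_seq_le (fun j => fst (I j)) (fun _ => snd (I i)) l (snd (I i))).
      - intros j. destruct (HI (Nat.max i j)) as [H1 H2].
        pose proof (Hmf j (Nat.max i j) ltac:(lia)). pose proof (Hms i (Nat.max i j) ltac:(lia)). lra.
      - exact Hl.
      - apply is_lim_seq_const. }
    assert (Hl12 : 1 <= l <= 2) by (split; [exact (Hl1 O)|exact (Hl2 O)]).
    destruct (rv_eventually_comparable c alpha l Hc Hrv ltac:(lra)) as [N HN].
    destruct (Hnext N (I N) (HI N)) as [_ [_ [_ [n [Hn Hbad]]]]].
    apply (Hbad l); [|eapply comparable_weaken; [exact Hc| |apply HN, Hn]; rewrite S_INR; lra].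
    split; [exact (Hl1 (S N))|exact (Hl2 (S N))].
Qed.

Lemma nat_in_interval (x y : R) : 0 <= x -> x + 1 < y -> exists m : nat, x <= INR m < y.
Proof.
  intros Hx Hxy. exists (Z.to_nat (up x)).
  destruct (archimed x) as [H1 H2].
  assert (0 <= up x)%Z by (apply le_IZR; simpl; lra).
  rewrite INR_IZR_INZ, Z2Nat.id by assumption. lra.
Qed.

(** Two indices whose ratio is at most [t] lie in the window of a common index. *)
Lemma rv_small_ratio (c : nat -> R) (alpha : R) :
  (forall n, 0 < c n) -> regularly_varying c alpha ->
  exists (t K : R) (N : nat), 1 < t /\ 1 <= K /\
    forall n m, (N <= n)%nat -> INR n <= INR m <= t * INR n -> comparable c K n m.
Proof.
  intros Hc Hrv.
  destruct (rv_window c alpha Hc Hrv) as [p [q [N [Hpq [Hq HN]]]]].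
  set (K := INR (S N)) in *.
  assert (HK : 1 <= K) by (unfold K; rewrite S_INR; pose proof (pos_INR N); lra).
  set (t := (1 + q / p) / 2).
  assert (Hqp : 1 < q / p) by (apply Rlt_div_r; lra).
  assert (Ht : 1 < t < q / p) by (unfold t; lra).
  assert (Hpt : p * t < q).
  { replace q with (p * (q / p)) by (field; lra). apply Rmult_lt_compat_l; lra. }
  destruct (INR_eventually_ge (2 / (q - p * t))) as [N1 HN1].
  exists t, (K * K), (Nat.max N N1).
  split; [lra|]. split; [nra|].
  intros n m Hn Hm.
  specialize (HN1 n ltac:(lia)).
  apply Rle_div_l in HN1; [|lra].
  destruct (nat_in_interval (p * INR m) (q * INR n)) as [l [Hl1 Hl2]].
  - pose proof (pos_INR m). nra.
  - assert (p * INR m <= p * (t * INR n)) by (mul_l). nra.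
  - apply comparable_trans with l; [lra|lra| |].
    + apply HN; [lia|]. split; [nra|exact Hl2].
    + apply comparable_sym. apply HN; [|split; [exact Hl1|]].
      * assert (n <= m)%nat by (apply INR_le; lra). lia.
      * nra.
Qed.

(** Windows of ratio [t] are chained until they cover the ratio 2. The ratio
    [t1 < t] leaves room for the rounding of the intermediate indices. *)
Lemma rv_comparable (c : nat -> R) (alpha : R) :
  (forall n, 0 < c n) -> regularly_varying c alpha ->
  exists (K : R) (N : nat), 1 <= K /\
    forall n m, (N <= n)%nat -> (n <= m <= 2 * n)%nat -> comparable c K n m.
Proof.
  intros Hc Hrv.
  destruct (rv_small_ratio c alpha Hc Hrv) as [t [K [N [Ht [HK HN]]]]].
  set (t1 := (1 + t) / 2). assert (Ht1 : 1 < t1 < t) by (unfold t1; lra).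
  assert (Hr : 0 < 1 - t1 / t).
  { assert (t1 / t < 1) by (apply Rlt_div_l; lra). lra. }
  destruct (INR_eventually_ge (2 / (1 - t1 / t))) as [N1 HN1].
  assert (Hchain : forall j n m, (Nat.max N N1 <= n)%nat -> INR n <= INR m <= t1 ^ j * INR n ->
            comparable c (K ^ S j) n m).
  { induction j as [|j IH]; intros n m Hn Hm.
    - simpl. rewrite Rmult_1_r. apply HN; [lia|]. simpl in Hm.
      pose proof (pos_INR n). nra.
    - pose proof (pos_INR n) as Hn0.
      pose proof (pow_R1_Rle K (S j) HK) as HKj.
      destruct (Rle_lt_dec (INR m) (t * INR n)) as [Hlt|Hgt].
      + apply comparable_weaken with K; [exact Hc| |apply HN; [lia|lra]].
        change (K ^ S (S j)) with (K * K ^ S j). nra.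
      + destruct (nat_in_interval (INR m / t) (INR m / t + 3 / 2)) as [l [Hl1 Hl2]].
        { apply Rdiv_le_0_compat; [apply pos_INR|lra]. }
        { lra. }
        assert (Hnl : INR n < INR m / t) by (apply Rlt_div_r; lra).
        specialize (HN1 n ltac:(lia)).
        apply Rle_div_l in HN1; [|exact Hr].
        assert (Hlj : INR l <= t1 ^ j * INR n).
        { assert (INR m / t <= t1 ^ j * INR n * (t1 / t)).
          { replace (t1 ^ j * INR n * (t1 / t)) with (t1 ^ S j * INR n / t) by (simpl; field; lra).
            unfold Rdiv. apply Rmult_le_compat_r; [left; apply Rinv_0_lt_compat; lra|lra]. }
          pose proof (pow_R1_Rle t1 j ltac:(lra)).
 nra. }
        change (K ^ S (S j)) with (K * K ^ S j). rewrite Rmult_comm.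
        assert (n <= l)%nat by (apply INR_le; lra).
        assert (Hlm : INR l <= INR m).
        { assert (t * (INR m / t) = INR m) by (field; lra).
          assert (INR m / t * (1 - t1 / t) <= INR m / t * (1 - / t)).
          { mul_l.
            assert (/ t <= t1 / t); [|lra].
            unfold Rdiv. rewrite <- (Rmult_1_l (/ t)) at 1.
            apply Rmult_le_compat_r; [left; apply Rinv_0_lt_compat|]; lra. }
          nra. }
        apply comparable_trans with l; [lra|lra| |].
        * apply IH; [lia|]. lra.
        * apply HN; [lia|]. split; [exact Hlm|].
          assert (t * (INR m / t) = INR m) by (field; lra). nra. }
  destruct (Pow_x_infinity t1) with (b := 2) as [j Hj].
  { rewrite Rabs_pos_eq; lra. }
  specialize (Hj j ltac:(lia)).
  rewrite Rabs_pos_eq in Hj by (apply pow_le; lra).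
  exists (K ^ S j), (Nat.max N N1). split; [apply pow_R1_Rle, HK|].
  intros n m Hn [Hm1 Hm2]. apply Hchain; [exact Hn|].
  apply le_INR in Hm1, Hm2. rewrite mult_INR in Hm2. simpl in Hm2.
 nra.
Qed.

(** What the growth estimate uses of regular variation, with [theta] in the role
    of [2 ^ index]. Both properties pass to quotients and square
    roots. *)
Definition dyadic (c : nat -> R) (theta : R) : Prop :=
  (forall n, 0 < c n) /\ 0 < theta /\
  (exists (K : R) (N : nat), 1 <= K /\
    forall n m, (N <= n)%nat -> (n <= m <= 2 * n)%nat -> comparable c K n m) /\
  is_lim_seq (fun n => c (2 * n)%nat / c n) theta.

Lemma dyadic_rv (c : nat -> R) (alpha : R) :
  (forall n, 0 < c n) -> regularly_varying c alpha -> dyadic c (Rpower 2 alpha).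
Proof.
  intros Hc Hrv. split; [exact Hc|]. split; [apply exp_pos|].
  split; [exact (rv_comparable c alpha Hc Hrv)|].
  eapply is_lim_seq_ext; [|exact (Hrv 2 ltac:(lra))].
  intros n. simpl. rewrite (floor_nat _ (2 * n)); [reflexivity|].
  rewrite mult_INR. simpl. lra.
Qed.

Lemma dyadic_div (c d : nat -> R) (theta eta : R) :
  dyadic c theta -> dyadic d eta -> dyadic (fun n => c n / d n) (theta / eta).
Proof.
  intros [Hc [Ht [[K [N [HK HN]]] Hl]]] [Hd [He [[L [M [HL HM]]] Hm]]].
  assert (Hpos : forall n, 0 < c n / d n) by (intros n; apply Rdiv_lt_0_compat; auto).
  split; [exact Hpos|]. split; [apply Rdiv_lt_0_compat; auto|]. split.
  - exists (K * L), (Nat.max N M). split; [nra|]. intros n m Hn Hnm.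
    destruct (HN n m ltac:(lia) Hnm) as [H1 H2]. destruct (HM n m ltac:(lia) Hnm) as [H3 H4].
    pose proof (Hc n). pose proof (Hc m). pose proof (Hd n). pose proof (Hd m).
    assert (Hi1 : / d m <= L * / d n).
    { apply Rmult_le_reg_l with (d m); [lra|]. apply Rmult_le_reg_l with (d n); [lra|].
      field_simplify; lra. }
    assert (Hi2 : / d n <= L * / d m).
    { apply Rmult_le_reg_l with (d m); [lra|]. apply Rmult_le_reg_l with (d n); [lra|].
      field_simplify; lra. }
    assert (0 < / d n) by (apply Rinv_0_lt_compat; lra).
    assert (0 < / d m) by (apply Rinv_0_lt_compat; lra).
    split; unfold Rdiv.
    + replace (K * L * (c n * / d n)) with ((K * c n) * (L * / d n)) by ring.
      apply Rmult_le_compat; lra.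
    + replace (K * L * (c m * / d m)) with ((K * c m) * (L * / d m)) by ring.
      apply Rmult_le_compat; lra.
  - eapply is_lim_seq_ext; [|exact (is_lim_seq_div' _ _ _ _ Hl Hm ltac:(lra))].
    intros n. simpl. pose proof (Hc n). pose proof (Hd n). pose proof (Hd (n + (n + 0))%nat).
    field. repeat split; lra.
Qed.

Lemma dyadic_sqrt (c : nat -> R) (theta : R) :
  dyadic c theta -> dyadic (fun n => sqrt (c n)) (sqrt theta).
Proof.
  intros [Hc [Ht [[K [N [HK HN]]] Hl]]].
  split; [intros n; apply sqrt_lt_R0, Hc|]. split; [apply sqrt_lt_R0, Ht|]. split.
  - exists (sqrt K), N. split; [rewrite <- sqrt_1; apply sqrt_le_1_alt; lra|].
    intros n m Hn Hnm. destruct (HN n m Hn Hnm) as [H1 H2].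
    split; rewrite <- sqrt_mult_alt by lra; apply sqrt_le_1_alt; assumption.
  - apply is_lim_seq_ext with (fun n => sqrt (c (2 * n)%nat / c n)).
    + intros n. apply sqrt_div_alt, Hc.
    + apply (is_lim_seq_continuous sqrt _ theta); [|exact Hl].
      apply continuity_pt_sqrt. lra.
Qed.

Lemma dyadic_inv (c : nat -> R) (theta : R) :
  dyadic c theta -> dyadic (fun n => / c n) (/ theta).
Proof.
  intros H.
  assert (H1 : dyadic (fun _ => 1) 1).
  { split; [intros; lra|]. split; [lra|]. split.
    - exists 1, O. split; [lra|]. intros. split; lra.
    - apply is_lim_seq_ext with (fun _ => 1); [intros; field|apply is_lim_seq_const]. }
  replace (fun n => / c n) with (fun n => 1 / c n)
    by (apply functional_extensionality; intros n; apply Rmult_1_l).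
  rewrite <- (Rmult_1_l (/ theta)). exact (dyadic_div _ _ _ _ H1 H).
Qed.

Lemma dyadic_ratio_ge (c : nat -> R) (theta q : R) :
  dyadic c theta -> q < theta ->
  exists N, forall n, (N <= n)%nat -> q * c n <= c (2 * n)%nat.
Proof.
  intros [Hc [_ [_ Hl]]] Hq. apply is_lim_seq_spec in Hl.
  assert (He : 0 < theta - q) by lra.
  destruct (Hl (mkposreal _ He)) as [N HN]. exists N. intros n Hn.
  specialize (HN n Hn). cbn -[Nat.mul] in HN. apply Rabs_def2 in HN.
  apply Rle_div_r; [apply Hc|]. apply Rlt_le. unfold Rdiv in *. lra.
Qed.

Lemma dyadic_scale (k h : nat) : (1 <= k <= h)%nat ->
  exists j, (2 ^ j * k <= h < 2 * (2 ^ j * k))%nat.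
Proof.
  induction h as [h IH] using (well_founded_induction lt_wf). intros Hk.
  destruct (le_lt_dec (2 * k) h) as [H|H].
  - assert (Hd : h = (2 * (h / 2) + h mod 2)%nat) by (apply Nat.div_mod; lia).
    pose proof (Nat.mod_upper_bound h 2 ltac:(lia)).
    destruct (IH (h / 2)%nat) as [j Hj]; [lia|lia|].
    exists (S j). rewrite Nat.pow_succ_r'. lia.
  - exists O. simpl. lia.
Qed.

(** [2 ^ j * N] is how dyadic sequences are followed; [q ^ j] is the growth
    that the limit of [c (2 n) / c n] forces along it. *)
Lemma dyadic_power (c : nat -> R) (q : R) (N : nat) :
  0 <= q -> (forall n, (N <= n)%nat -> q * c n <= c (2 * n)%nat) ->
  forall k j, (N <= k)%nat -> q ^ j * c k <= c (2 ^ j * k)%nat.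
Proof.
  intros Hq HN k j Hk. induction j as [|j IH].
  - simpl. rewrite Nat.add_0_r. lra.
  - assert (N <= 2 ^ j * k)%nat by (pose proof (Nat.pow_nonzero 2 j ltac:(lia)); nia).
    replace (2 ^ S j * k)%nat with (2 * (2 ^ j * k))%nat by (simpl; lia).
    eapply Rle_trans; [|apply HN; assumption].
    simpl (q ^ S j). rewrite Rmult_assoc. apply Rmult_le_compat_l; assumption.
Qed.

(** Along [2 ^ j * k] the sequence does not decrease, and between consecutive
    powers it changes by bounded factors. *)
Lemma dyadic_almost_increasing (c : nat -> R) (theta : R) :
  dyadic c theta -> 1 < theta ->
  exists (C : R) (N : nat), 0 < C /\ forall k h, (k <= h)%nat -> (N <= h)%nat -> c k <= C * c h.
Proof.
  intros Hd Ht. destruct (dyadic_ratio_ge c theta 1 Hd Ht) as [N1 HN1].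
  destruct Hd as [Hc [_ [[K [N2 [HK HN2]]] _]]].
  set (N := S (Nat.max N1 N2)).
  assert (Hmain : forall k h, (N <= k)%nat -> (k <= h)%nat -> c k <= K * c h).
  { intros k h Hk Hkh. destruct (dyadic_scale k h) as [j Hj]; [lia|].
    pose proof (dyadic_power c 1 N1 ltac:(lra) HN1 k j ltac:(lia)) as Hp.
    rewrite pow1, Rmult_1_l in Hp.
    eapply Rle_trans; [exact Hp|]. apply HN2; [|lia].
    pose proof (Nat.pow_nonzero 2 j ltac:(lia)). nia. }
  assert (Hfin : forall M : nat, exists B, 0 < B /\ forall k, (k < M)%nat -> c k <= B).
  { induction M as [|M [B [HB0 HB]]].
    - exists 1. split; [lra|]. intros; lia.
    - exists (Rmax B (c M)). split; [pose proof (Rmax_l B (c M)); lra|].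
      intros k Hk. destruct (Nat.eq_dec k M) as [->|]; [apply Rmax_r|].
      eapply Rle_trans; [apply HB; lia|apply Rmax_l]. }
  destruct (Hfin N) as [B [HB0 HB]].
  exists (K + B * K / c N), N. pose proof (Hc N) as HcN.
  assert (0 < B * K / c N) by (apply Rdiv_lt_0_compat; nra).
  split; [lra|]. intros k h Hkh Hh. pose proof (Hc h).
  destruct (le_lt_dec N k) as [Hk|Hk].
  - specialize (Hmain k h Hk Hkh). nra.
  - specialize (HB k Hk). specialize (Hmain N h ltac:(lia) Hh).
    assert (B <= B * K / c N * c h).
    { replace (B * K / c N * c h) with (B / c N * (K * c h)) by (field; lra).
      apply Rle_trans with (B / c N * c N); [right; field; lra|].
      apply Rmult_le_compat_l; [|exact Hmain]. left; apply Rdiv_lt_0_compat; lra. }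
    nra.
Qed.

Lemma dyadic_to_infinity (c : nat -> R) (theta : R) :
  dyadic c theta -> 1 < theta -> is_lim_seq c p_infty.
Proof.
  intros Hd Ht. set (q := (1 + theta) / 2).
  destruct (dyadic_ratio_ge c theta q Hd ltac:(unfold q; lra)) as [N1 HN1].
  destruct (dyadic_almost_increasing c theta Hd Ht) as [C [N2 [HC HN2]]].
  destruct Hd as [Hc _].
  apply is_lim_seq_spec. intros M.
  set (N := Nat.max N1 N2). pose proof (Hc N) as HcN.
  destruct (Pow_x_infinity q) with (b := C * (Rabs M + 1) / c N) as [j Hj].
  { rewrite Rabs_pos_eq; unfold q; lra. }
  specialize (Hj j ltac:(lia)). rewrite Rabs_pos_eq in Hj by (apply pow_le; unfold q; lra).
  exists (2 ^ j * N)%nat. intros h Hh.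
  assert (N <= 2 ^ j * N)%nat by (pose proof (Nat.pow_nonzero 2 j ltac:(lia)); nia).
  specialize (HN2 _ h Hh ltac:(lia)).
  pose proof (dyadic_power c q N1 ltac:(unfold q; lra) HN1 N j ltac:(lia)) as Hp.
  apply Rge_le in Hj. apply Rle_div_l in Hj; [|exact HcN].
  assert (C * (Rabs M + 1) <= C * c h) by lra.
  apply Rmult_le_reg_l in H0; [|exact HC]. pose proof (Rle_abs M). lra.
Qed.

(** The direct half of Karamata's theorem: an index above [-1] makes the last
    dyadic block dominate the sum. *)
Lemma dyadic_psum (c : nat -> R) (theta : R) :
  dyadic c theta -> 1 / 2 < theta ->
  exists (C : R) (N : nat), 0 < C /\
    forall h, (N <= h)%nat -> psum c (S h) <= C * (INR h * c h).
Proof.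
  intros Hd Ht. set (q := (1 / 2 + theta) / 2).
  assert (Hq : 1 / 2 < q) by (unfold q; lra).
  destruct (dyadic_ratio_ge c theta q Hd ltac:(unfold q; lra)) as [N1 HN1].
  destruct Hd as [Hc [_ [[K [N2 [HK HN2]]] _]]].
  set (N := S (Nat.max N1 N2)).
  assert (HNpos : 0 < INR N * c N).
  { apply Rmult_lt_0_compat; [apply lt_0_INR; unfold N; lia|apply Hc]. }
  set (M := Rmax (K / (2 * q - 1)) (psum c N / (INR N * c N))).
  assert (HM1 : K / (2 * q - 1) <= M) by apply Rmax_l.
  assert (HM2 : psum c N / (INR N * c N) <= M) by apply Rmax_r.
  assert (HMK : M + K <= 2 * q * M) by (apply Rle_div_l in HM1; lra).
  assert (HM0 : 0 < M).
  { eapply Rlt_le_trans; [|exact HM1]. apply Rdiv_lt_0_compat; lra. }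
  assert (Hblock : forall n m, (N <= n)%nat -> (m <= n)%nat ->
            psum (fun k => c (n + k)%nat) m <= INR n * (K * c n)).
  { intros n m Hn Hm.
    apply Rle_trans with (INR m * (K * c n)).
    - rewrite <- psum_const. apply psum_le. intros k Hk. apply (HN2 n (n + k)%nat); lia.
    - apply Rmult_le_compat_r; [|apply le_INR, Hm]. specialize (Hc n). nra. }
  assert (Hpow : forall j, (N <= 2 ^ j * N)%nat).
  { intros j. pose proof (Nat.pow_nonzero 2 j ltac:(lia)). nia. }
  assert (HS : forall j, psum c (2 ^ j * N) <= M * (INR (2 ^ j * N) * c (2 ^ j * N)%nat)).
  { induction j as [|j IH].
    - rewrite Nat.pow_0_r, Nat.mul_1_l. apply Rle_div_l in HM2; [lra|exact HNpos].
    - replace (2 ^ S j * N)%nat with (2 * (2 ^ j * N))%nat by (simpl; lia).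
      specialize (Hpow j). set (n := (2 ^ j * N)%nat) in *.
      replace (psum c (2 * n)) with (psum c (n + n)) by (f_equal; lia).
      rewrite psum_split.
      pose proof (Hblock n n ltac:(lia) ltac:(lia)).
      pose proof (HN1 n ltac:(lia)) as Hr.
      rewrite mult_INR. simpl (INR 2).
      assert (Hn0 : 0 <= INR n) by apply pos_INR. pose proof (Hc n).
      assert (INR n * c n * (M + K) <= INR n * c n * (2 * q * M)) by (apply Rmult_le_compat_l; nra).
      assert (2 * M * INR n * (q * c n) <= 2 * M * INR n * c (2 * n)%nat).
      { apply Rmult_le_compat_l; [nra|exact Hr]. }
      nra. }
  exists ((M + K) * K), N. split; [nra|]. intros h Hh.
  destruct (dyadic_scale N h) as [j [Hj1 Hj2]]; [unfold N in *; lia|].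
  specialize (HS j). specialize (Hpow j). set (n := (2 ^ j * N)%nat) in *.
  replace (S h) with (n + (S h - n))%nat by lia. rewrite psum_split.
  pose proof (Hblock n (S h - n)%nat ltac:(lia) ltac:(lia)).
  destruct (HN2 n h) as [_ Hcmp]; [lia|lia|].
  pose proof (pos_INR n). apply le_INR in Hj1. pose proof (Hc n).
  apply Rle_trans with ((M + K) * (INR n * c n)); [nra|].
  rewrite Rmult_assoc. mul_l.
  apply Rle_trans with (INR h * c n); [mul_r|].
 nra.
Qed.

Lemma tail_sum_step (x : nat -> R) (N : nat) :
  ex_series x -> tail_sum x N = x N + tail_sum x (S N).
Proof.
  intros Hx. unfold tail_sum.
  rewrite (Series_incr_1 (fun k => x (N + k)%nat)); [|apply (proj1 (ex_series_shift x N)), Hx].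
  rewrite Nat.add_0_r. f_equal. apply Series_ext. intros n. f_equal. lia.
Qed.

Lemma Series_tail_sum (x : nat -> R) (N : nat) :
  ex_series x -> Series x = psum x N + tail_sum x N.
Proof.
  intros Hx. induction N as [|N IH].
  - change (tail_sum x 0) with (Series x). simpl. ring.
  - rewrite (tail_sum_step x N Hx) in IH. simpl. lra.
Qed.

Lemma tail_sum_lim (x : nat -> R) : ex_series x -> is_lim_seq (tail_sum x) 0.
Proof.
  intros Hx.
  apply is_lim_seq_ext with (fun n => Series x - psum x n).
  - intros n. rewrite (Series_tail_sum x n Hx). ring.
  - replace 0 with (Series x - Series x) by ring.
    apply is_lim_seq_minus'; [apply is_lim_seq_const|apply psum_lim, Hx].
Qed.

Lemma psum_le_tail_sum (x : nat -> R) (N n : nat) :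
  (forall k, 0 <= x k) -> ex_series x -> psum (fun k => x (N + k)%nat) n <= tail_sum x N.
Proof.
  intros Hx Hs. apply psum_le_Series.
  - intros; apply Hx.
  - apply (proj1 (ex_series_shift x N)), Hs.
Qed.

Lemma dyadic_tail (c : nat -> R) (theta : R) :
  dyadic c theta -> ex_series c ->
  exists (C : R) (N : nat), 0 < C /\
    forall h, (N <= h)%nat -> INR h * c h <= C * tail_sum c h.
Proof.
  intros [Hc [_ [[K [N [HK HN]]] _]]] Hs.
  exists K, N. split; [lra|]. intros h Hh.
  eapply Rle_trans; [|mul_l; apply (psum_le_tail_sum c h h)];
    [| intros; left; apply Hc | exact Hs].
  rewrite <- psum_scal, <- psum_const. apply psum_le. intros k Hk. apply (HN h (h + k)%nat); lia.
Qed.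

(** If [theta > 1 / 2], then [dyadic_psum] bounds [h * c h] from below, while
    [dyadic_tail] bounds it by a tail. *)
Lemma dyadic_summable (c : nat -> R) (theta : R) :
  dyadic c theta -> ex_series c -> theta <= 1 / 2.
Proof.
  intros Hd Hs. apply Rnot_lt_le. intros Ht.
  destruct (dyadic_psum c theta Hd Ht) as [C [N [HC HN]]].
  destruct (dyadic_tail c theta Hd Hs) as [K [M [HK HM]]].
  destruct Hd as [Hc _].
  pose proof (tail_sum_lim c Hs) as Hl. apply is_lim_seq_spec in Hl.
  assert (He : 0 < c O / (C * K)) by (apply Rdiv_lt_0_compat; [apply Hc|nra]).
  destruct (Hl (mkposreal _ He)) as [L HL].
  set (h := Nat.max N (Nat.max M L)).
  specialize (HN h ltac:(lia)). specialize (HM h ltac:(lia)). specialize (HL h ltac:(lia)).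
  simpl in HL. apply Rabs_def2 in HL. destruct HL as [HL _].
  assert (H1 : c O <= psum c (S h)).
  { apply Rle_trans with (psum c 1); [simpl; lra|].
    apply psum_mono; [intros; left; apply Hc|lia]. }
  rewrite Rminus_0_r in HL. apply Rlt_div_r in HL; [|nra].
  nra.
Qed.

(** * The recurrence at [z = 0]: an almost conserved energy *)

Definition qf (A B C x y : R) : R := A * x ^ 2 + B * x * y + C * y ^ 2.

Lemma qf_definite (A B C : nat -> R) (A0 B0 C0 : R) :
  is_lim_seq A A0 -> is_lim_seq B B0 -> is_lim_seq C C0 ->
  0 < A0 -> B0 ^ 2 < 4 * A0 * C0 ->
  exists (c : R) (N : nat), 0 < c /\
    forall n x y, (N <= n)%nat -> c * (x ^ 2 + y ^ 2) <= qf (A n) (B n) (C n) x y.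
Proof.
  intros HA HB HC HA0 Hdisc.
  assert (HC0 : 0 < C0) by nra.
  set (c := (A0 * C0 - B0 ^ 2 / 4) / (A0 + C0)).
  assert (Hc : 0 < c) by (apply Rdiv_lt_0_compat; lra).
  assert (Hc1 : c * (A0 + C0) = A0 * C0 - B0 ^ 2 / 4) by (unfold c; field; lra).
  assert (HcA : c < A0).
  { apply Rmult_lt_reg_r with (A0 + C0); [lra|]. nra. }
  assert (Hlim : forall x y, c * (x ^ 2 + y ^ 2) <= qf A0 B0 C0 x y).
  { intros x y. unfold qf.
    assert (H : 0 <= 4 * (A0 - c) * ((A0 - c) * x ^ 2 + B0 * x * y + (C0 - c) * y ^ 2)).
    { replace (4 * (A0 - c) * ((A0 - c) * x ^ 2 + B0 * x * y + (C0 - c) * y ^ 2))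
        with ((2 * (A0 - c) * x + B0 * y) ^ 2
              + 4 * ((A0 * C0 - B0 ^ 2 / 4) - c * (A0 + C0) + c ^ 2) * y ^ 2) by field.
      rewrite Hc1. sq_ge0 (2 * (A0 - c) * x + B0 * y).
 nra. }
    assert (0 <= (A0 - c) * x ^ 2 + B0 * x * y + (C0 - c) * y ^ 2).
    { apply Rmult_le_reg_l with (4 * (A0 - c)); lra. }
    lra. }
  apply is_lim_seq_spec in HA, HB, HC.
  assert (He : 0 < c / 4) by lra.
  destruct (HA (mkposreal _ He)) as [N1 H1]. destruct (HB (mkposreal _ He)) as [N2 H2].
  destruct (HC (mkposreal _ He)) as [N3 H3]. simpl in H1, H2, H3.
  exists (c / 2), (Nat.max N1 (Nat.max N2 N3)). split; [lra|]. intros n x y Hn.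
  specialize (H1 n ltac:(lia)). specialize (H2 n ltac:(lia)). specialize (H3 n ltac:(lia)).
  apply Rabs_def2 in H1, H2, H3. specialize (Hlim x y). unfold qf in *.
  sq_ge0 x. sq_ge0 y.
  assert (- (c / 4) * x ^ 2 <= (A n - A0) * x ^ 2) by (mul_r).
  assert (- (c / 4) * y ^ 2 <= (C n - C0) * y ^ 2) by (mul_r).
  assert (- (c / 4) * (x ^ 2 + y ^ 2) <= (B n - B0) * (x * y)).
  { sq_ge0 (x + y). sq_ge0 (x - y).
    destruct (Rle_lt_dec 0 (x * y)); nra. }
  lra.
Qed.

(** Cauchy-Schwarz for a nonnegative form, with the weight [th] between the two
    arguments. *)
Lemma qf_cross (A B C th x y h k : R) :
  0 < th -> (forall u v, 0 <= qf A B C u v) ->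
  (1 - th) * qf A B C x y - qf A B C h k / th <= qf A B C (x + h) (y + k)
  <= (1 + th) * qf A B C x y + (1 + / th) * qf A B C h k.
Proof.
  intros Hth Hpos.
  set (cr := 2 * A * x * h + B * (x * k + y * h) + 2 * C * y * k).
  assert (Hsum : qf A B C (x + h) (y + k) = qf A B C x y + cr + qf A B C h k)
    by (unfold qf, cr; ring).
  assert (Hs : forall s, s ^ 2 = 1 -> 0 <= th * qf A B C x y + s * cr + / th * qf A B C h k).
  { intros s Hs. apply Rmult_le_reg_l with th; [exact Hth|]. rewrite Rmult_0_r.
    pose proof (Hpos (th * x + s * h) (th * y + s * k)) as H.
    replace (qf A B C (th * x + s * h) (th * y + s * k))
      with (th ^ 2 * qf A B C x y + th * (s * cr) + s ^ 2 * qf A B C h k) in H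
      by (unfold qf, cr; ring).
    rewrite Hs in H.
    replace (th * (th * qf A B C x y + s * cr + / th * qf A B C h k))
      with (th ^ 2 * qf A B C x y + th * (s * cr) + 1 * qf A B C h k) by (field; lra).
    exact H. }
  pose proof (Hs 1 ltac:(ring)). pose proof (Hs (-1) ltac:(ring)). pose proof (Hpos h k).
  unfold Rdiv. lra.
Qed.

Lemma sum_abs_sq (x y : R) : (Rabs x + Rabs y) ^ 2 <= 2 * (x ^ 2 + y ^ 2).
Proof.
  rewrite <- (pow2_abs x), <- (pow2_abs y). sq_ge0 (Rabs x - Rabs y). nra.
Qed.

Lemma qf_coef (A B C A' B' C' x y : R) :
  qf A' B' C' x y <= qf A B C x y
    + (Rabs (A' - A) + Rabs (B' - B) + Rabs (C' - C)) * (x ^ 2 + y ^ 2).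
Proof.
  unfold qf. sq_ge0 x. sq_ge0 y.
  abs_ge0 (A' - A). abs_ge0 (B' - B). abs_ge0 (C' - C).
  assert ((A' - A) * x ^ 2 <= Rabs (A' - A) * x ^ 2)
    by (mul_r; apply Rle_abs).
  assert ((C' - C) * y ^ 2 <= Rabs (C' - C) * y ^ 2)
    by (mul_r; apply Rle_abs).
  assert ((B' - B) * (x * y) <= Rabs (B' - B) * (x ^ 2 + y ^ 2)).
  { bound_by Rle_abs. rewrite Rabs_mult. mul_l.
    apply Rabs_le. sq_ge0 (x - y). nra. }
  nra.
Qed.

(** For a fixed real 2x2 matrix [T] the form [X |-> det (X, T X)] is multiplied
    by [det T] under [T], and it is definite exactly when [T] is elliptic. Here
    [T X = (x + eps m, (1 + eps sig) m)] with [m = (1 + eps s) y - eps D x], and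
    the form below is [- det (X, T X) / eps]; its coefficients have bounded
    variation, so it is conserved up to a summable relative error. The term [del]
    is a perturbation of [m]; the weight [om] compensates for [det T]. *)
Lemma energy_bounded (eps s sig D e x y del om : nat -> R) (s0 D0 : R) :
  bounded_variation eps -> bounded_variation s -> bounded_variation sig ->
  bounded_variation D ->
  is_lim_seq eps 0 -> is_lim_seq sig 0 -> is_lim_seq s s0 -> is_lim_seq D D0 ->
  s0 ^ 2 < 4 * D0 ->
  (forall n, 0 < e n) -> ex_series e ->
  (forall n, 0 < om n) ->
  (forall n, om n = (1 + eps n * s n) * (1 + eps n * sig n) * om (S n)) ->
  (forall n, Rabs (del n) <= e n * (Rabs (x n) + Rabs (y n))) ->
  (forall n, x (S n) = x n + eps n * ((1 + eps n * s n) * y n - eps n * D n * x n + del n)) ->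
  (forall n, y (S n) = (1 + eps n * sig n)
      * ((1 + eps n * s n) * y n - eps n * D n * x n + del n)) ->
  exists (C : R) (N : nat), forall n, (N <= n)%nat -> om n * (x n ^ 2 + y n ^ 2) <= C.
Proof.
  intros Veps Vs Vsig VD Leps Lsig Ls LD Hdisc He Hes Hom Homr Hdel Hx Hy.
  set (A := fun n => (1 + eps n * sig n) * D n).
  set (B := fun n => -1 * (s n + sig n + eps n * s n * sig n + eps n * D n)).
  set (C := fun n => 1 + eps n * s n).
  assert (VA : bounded_variation A).
  { apply bv_mult; [apply bv_plus; [apply bv_const|apply bv_mult]|]; assumption. }
  assert (VB : bounded_variation B).
  { apply bv_scal. repeat apply bv_plus; repeat apply bv_mult; assumption. }
  assert (VC : bounded_variation C).
  { apply bv_plus; [apply bv_const|apply bv_mult; assumption]. }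
  assert (Les : is_lim_seq (fun n => eps n * s n) 0).
  { replace 0 with (0 * s0) by ring. apply is_lim_seq_mult'; assumption. }
  assert (Lesig : is_lim_seq (fun n => eps n * sig n) 0).
  { replace 0 with (0 * 0) by ring. apply is_lim_seq_mult'; assumption. }
  assert (LA : is_lim_seq A D0).
  { replace D0 with ((1 + 0) * D0) by ring. apply is_lim_seq_mult'; [|assumption].
    apply is_lim_seq_plus'; [apply is_lim_seq_const|assumption]. }
  assert (LB : is_lim_seq B (-1 * (s0 + 0 + 0 * 0 + 0 * D0))).
  { apply is_lim_seq_mult'; [apply is_lim_seq_const|].
    repeat apply is_lim_seq_plus'; try apply is_lim_seq_mult'; assumption. }
  assert (LC : is_lim_seq C (1 + 0)).
  { apply is_lim_seq_plus'; [apply is_lim_seq_const|assumption]. }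
  destruct (qf_definite A B C _ _ _ LA LB LC) as [c [N1 [Hc Hdef]]]; [nra|nra|].
  destruct (bv_bounded A VA) as [MA [_ HMA]]. destruct (bv_bounded B VB) as [MB [_ HMB]].
  destruct (bv_bounded C VC) as [MC [_ HMC]].
  assert (Hsmall : exists N, forall n, (N <= n)%nat ->
    1 / 2 <= 1 + eps n * s n <= 2 /\ 1 / 2 <= 1 + eps n * sig n <= 2 /\ Rabs (eps n) <= 1).
  { apply is_lim_seq_spec in Les, Lesig, Leps.
    assert (Hh : 0 < 1 / 2) by lra.
    destruct (Les (mkposreal _ Hh)) as [K1 H1]. destruct (Lesig (mkposreal _ Hh)) as [K2 H2].
    destruct (Leps (mkposreal _ Hh)) as [K3 H3]. simpl in H1, H2, H3.
    exists (Nat.max K1 (Nat.max K2 K3)). intros n Hn.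
    specialize (H1 n ltac:(lia)). specialize (H2 n ltac:(lia)). specialize (H3 n ltac:(lia)).
    rewrite Rminus_0_r in H3. apply Rabs_def2 in H1, H2. lra. }
  destruct Hsmall as [N2 Hsmall].
  set (M := MA + MB + MC).
  assert (HM : forall n, Rabs (A n) <= M /\ Rabs (B n) <= M /\ Rabs (C n) <= M).
  { intros n. specialize (HMA n). specialize (HMB n). specialize (HMC n).
    abs_ge0 (A n). abs_ge0 (B n). abs_ge0 (C n).
    unfold M. lra. }
  assert (HM0 : 0 <= M) by (destruct (HM O) as [H _]; abs_ge0 (A O); lra).
  set (K := 120 * M / c). assert (HK : 0 <= K) by (apply Rdiv_le_0_compat; lra).
  set (Q := fun n => qf (A n) (B n) (C n)).
  set (eta := fun n => Rabs (A (S n) - A n) + Rabs (B (S n) - B n) + Rabs (C (S n) - C n)).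
  assert (Heta : forall n, 0 <= eta n).
  { intros n. unfold eta. abs_ge0 (A (S n) - A n).
    abs_ge0 (B (S n) - B n). abs_ge0 (C (S n) - C n). lra. }
  assert (Seta : ex_series eta) by (repeat apply ex_series_plus_R; assumption).
  set (N := Nat.max N1 N2). set (k := fun n => (1 + K) * e n + / c * eta n).
  assert (HQ0 : forall n u v, (N <= n)%nat -> c * (u ^ 2 + v ^ 2) <= Q n u v /\ 0 <= Q n u v).
  { intros n u v Hn. pose proof (Hdef n u v ltac:(unfold N in Hn; lia)) as H. fold (Q n) in H.
 split; [exact H|nra]. }
  assert (Hrec : forall n, (N <= n)%nat ->
    om (S n) * Q (S n) (x (S n)) (y (S n)) <= exp (k n) * (om n * Q n (x n) (y n))).
  { intros n Hn. destruct (Hsmall n ltac:(unfold N in Hn; lia)) as [H1 [H2 H3]].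
    specialize (He n). specialize (Heta n). specialize (Hdel n). pose proof (Hom (S n)) as Homp.
    set (tm := (1 + eps n * s n) * y n - eps n * D n * x n).
    set (d := (1 + eps n * s n) * (1 + eps n * sig n)). assert (Hd : 1 / 4 <= d) by (unfold d; nra).
    destruct (HQ0 n (x n) (y n) Hn) as [Hqc Hq0]. set (q := Q n (x n) (y n)) in *.
    assert (Hinv : Q n (x n + eps n * tm) ((1 + eps n * sig n) * tm) = d * q)
      by (unfold q, Q, qf, A, B, C, tm, d; ring).
    destruct (qf_cross (A n) (B n) (C n) (e n) (x n + eps n * tm) ((1 + eps n * sig n) * tm)
      (eps n * del n) ((1 + eps n * sig n) * del n) He) as [_ Hcr]; [intros; apply HQ0, Hn|].
    fold (Q n) in Hcr. rewrite Hinv in Hcr.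
    replace (x n + eps n * tm + eps n * del n) with (x (S n)) in Hcr by (rewrite Hx; unfold tm; ring).
    replace ((1 + eps n * sig n) * tm + (1 + eps n * sig n) * del n) with (y (S n)) in Hcr
      by (rewrite Hy; unfold tm; ring).
    destruct (HQ0 n (x (S n)) (y (S n)) Hn) as [Hqc' Hq0']. set (q' := Q n (x (S n)) (y (S n))) in *.
    assert (Hdel2 : del n ^ 2 <= 2 * e n ^ 2 * (q / c)).
    { pose proof (sum_abs_sq (x n) (y n)) as Hs.
      assert (Hr : (Rabs (x n) + Rabs (y n)) ^ 2 <= 2 * (q / c)).
      { assert (x n ^ 2 + y n ^ 2 <= q / c) by (apply (Rle_div_r _ q c); lra). lra. }
      rewrite <- (pow2_abs (del n)). abs_ge0 (del n).
      apply Rle_trans with ((e n * (Rabs (x n) + Rabs (y n))) ^ 2); [apply pow_incr; lra|].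
      rewrite Rpow_mult_distr. nra. }
    assert (Hh : Q n (eps n * del n) ((1 + eps n * sig n) * del n) <= 15 * M * del n ^ 2).
    { destruct (HM n) as [HA1 [HB1 HC1]].
      pose proof (qf_coef 0 0 0 (A n) (B n) (C n) (eps n) (1 + eps n * sig n)) as Hq1.
      rewrite !Rminus_0_r in Hq1. unfold qf at 2 in Hq1.
      assert (Heps : eps n ^ 2 <= 1) by (rewrite <- pow2_abs; abs_ge0 (eps n); nra).
      assert (Hq2 : qf (A n) (B n) (C n) (eps n) (1 + eps n * sig n) <= 3 * M * 5).
      { eapply Rle_trans; [exact Hq1|].
        rewrite !Rmult_0_l, !Rplus_0_l. apply Rmult_le_compat; try nra.
        abs_ge0 (A n). abs_ge0 (B n). abs_ge0 (C n). lra. }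
      replace (Q n (eps n * del n) ((1 + eps n * sig n) * del n))
        with (qf (A n) (B n) (C n) (eps n) (1 + eps n * sig n) * del n ^ 2) by (unfold Q, qf; ring).
      apply Rmult_le_compat_r; [apply pow2_ge_0|lra]. }
    assert (H4 : (1 + / e n) * Q n (eps n * del n) ((1 + eps n * sig n) * del n)
                 <= (1 + e n) * (K * e n) * (d * q)).
    { apply Rle_trans with ((1 + / e n) * (15 * M * (2 * e n ^ 2 * (q / c)))).
      - assert (0 < / e n) by (apply Rinv_0_lt_compat; exact He).
        mul_l. eapply Rle_trans; [exact Hh|].
        mul_l.
      - replace ((1 + / e n) * (15 * M * (2 * e n ^ 2 * (q / c))))
          with ((1 + e n) * (K * e n) * (1 / 4 * q)) by (unfold K; field; lra).
        apply Rmult_le_compat_l; [|mul_r].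
        apply Rmult_le_pos; [lra|apply Rmult_le_pos; lra]. }
    assert (Hdq : 0 <= d * q) by (apply Rmult_le_pos; lra).
    assert (H5 : q' <= exp ((1 + K) * e n) * (d * q)).
    { replace ((1 + K) * e n) with (K * e n + e n) by ring. rewrite exp_plus.
      apply Rle_trans with ((1 + K * e n) * ((1 + e n) * (d * q))); [lra|].
      rewrite Rmult_assoc. pose proof (Rmult_le_pos K (e n) HK (Rlt_le _ _ He)).
      pose proof (exp_ge_1p (K * e n)).
      apply Rmult_le_compat; [lra|apply Rmult_le_pos; lra|lra|apply exp_factor, Hdq]. }
    assert (H6 : Q (S n) (x (S n)) (y (S n)) <= exp (/ c * eta n) * q').
    { eapply Rle_trans; [|apply exp_factor, Hq0'].
      pose proof (qf_coef (A n) (B n) (C n) (A (S n)) (B (S n)) (C (S n)) (x (S n)) (y (S n))) as Hcf.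
      fold (Q n) in Hcf. fold (Q (S n)) in Hcf. fold (eta n) in Hcf. fold q' in Hcf.
      assert (x (S n) ^ 2 + y (S n) ^ 2 <= / c * q').
      { rewrite Rmult_comm. apply (Rle_div_r _ q' c); lra. }
      assert (eta n * (x (S n) ^ 2 + y (S n) ^ 2) <= eta n * (/ c * q'))
        by (mul_l).
      lra. }
    rewrite (Homr n). fold d. unfold k. rewrite Rplus_comm, exp_plus.
    replace (exp (/ c * eta n) * exp ((1 + K) * e n) * (d * om (S n) * q))
      with (om (S n) * (exp (/ c * eta n) * (exp ((1 + K) * e n) * (d * q)))) by ring.
    mul_l. eapply Rle_trans; [exact H6|].
    apply Rmult_le_compat_l; [left; apply exp_pos|exact H5]. }
  assert (Hk0 : forall n, 0 <= k n).
  { intros n. specialize (He n). specialize (Heta n).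
    apply Rplus_le_le_0_compat; apply Rmult_le_pos; try lra. left. apply Rinv_0_lt_compat, Hc. }
  assert (Sk : ex_series k) by (apply ex_series_plus_R; apply ex_series_scal_R; assumption).
  set (E := fun n => om (N + n)%nat * Q (N + n)%nat (x (N + n)%nat) (y (N + n)%nat)).
  assert (HE : forall n, E n <= E O * exp (psum (fun n => k (N + n)%nat) n)).
  { apply gronwall. intros n. unfold E. rewrite Nat.add_succ_r. apply Hrec. lia. }
  exists (E O * exp (Series (fun n => k (N + n)%nat)) / c), N.
  intros n Hn. apply (Rle_div_r _ _ c Hc).
  apply Rle_trans with (E (n - N)%nat).
  - unfold E. replace (N + (n - N))%nat with n by lia. rewrite Rmult_assoc.
    apply Rmult_le_compat_l; [left; apply Hom|]. rewrite Rmult_comm. apply HQ0, Hn.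
  - bound_by HE. apply Rmult_le_compat_l.
    + apply Rmult_le_pos; [left; apply Hom|apply HQ0; lia].
    + apply exp_le, psum_le_Series; [intros; apply Hk0|].
      apply (proj1 (ex_series_shift k N)), Sk.
Qed.

(** ** Tempered parameters *)

(** [b (S n) * pot b ap n] is the row sum of the Jacobi matrix, hence the
    potential in the equation for the differences of a solution. *)
Definition pot (b ap : nat -> R) (n : nat) : R := 1 + ap (S n) / b (S n) + b n / b (S n).

Definition rate (gamma b : nat -> R) (n : nat) : R := sqrt (gamma n) / b n.

Definition solves (b ap u : nat -> R) : Prop :=
  forall n, b (S n) * u (S (S n)) + ap (S n) * u (S n) + b n * u n = 0.

Definition energy_le (gamma b u : nat -> R) (K : R) : Prop :=
  forall n, u (S n) ^ 2 + gamma (S n) * (u (S n) - u n) ^ 2 <= K * rate gamma b (S n).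

Lemma solves_step (b ap u : nat -> R) (n : nat) :
  0 < b (S n) -> solves b ap u ->
  u (S (S n)) - u (S n) = b n / b (S n) * (u (S n) - u n) - pot b ap n * u (S n).
Proof.
  intros Hb Hu. specialize (Hu n). unfold pot.
  replace (u (S (S n))) with (- (ap (S n) * u (S n) + b n * u n) / b (S n)).
  - field. lra.
  - replace (- (ap (S n) * u (S n) + b n * u n)) with (b (S n) * u (S (S n))) by lra. field. lra.
Qed.

(** The energy form of [energy_bounded] tends to [D0 x ^ 2 - s0 x y + y ^ 2]. *)
Record normalized (gamma a b : nat -> R) (sg s0 D0 : R) : Prop := {
  nf_sign : sg = 1 \/ sg = -1;
  nf_ratio : is_lim_seq (fun n => b n / b (S n)) 1;
  nf_diag : is_lim_seq (fun n => sg * a n / b n) (-2);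
  nf_s_bv : bounded_variation (fun n => sqrt (gamma (S n)) * (b n / b (S n) - 1));
  nf_D_bv : bounded_variation (fun n => gamma (S n) * pot b (fun n => sg * a n) n);
  nf_step_bv : bounded_variation (fun n => sqrt (gamma (S n)) - sqrt (gamma n));
  nf_inv_bv : bounded_variation (fun n => 1 / sqrt (gamma (S n)));
  nf_s_lim : is_lim_seq (fun n => sqrt (gamma (S n)) * (b n / b (S n) - 1)) s0;
  nf_D_lim : is_lim_seq (fun n => gamma (S n) * pot b (fun n => sg * a n) n) D0
}.

(** The substitution [u n -> (-1) ^ n * u n] changes the sign of the diagonal, so
    both values of [mu] reduce to [-2], for which solutions vary slowly. *)
Lemma tempered_normalized (gamma a b : nat -> R) :
  (forall n, 0 < b n) -> tempered gamma a b ->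
  exists sg s0 D0, normalized gamma a b sg s0 D0.
Proof.
  intros Hb [_ [Hr [mu [Hmu [Hl [V1 [_ [_ [V4 [V5 V6]]]]]]]]]].
  assert (H : exists sg, (sg = 1 \/ sg = -1) /\ is_lim_seq (fun n => sg * a n / b n) (-2) /\
                bounded_variation (fun n => gamma (S n) * pot b (fun n => sg * a n) n)).
  { destruct Hmu as [-> | ->].
    - exists 1. rewrite sign_eq_m1 in V6 by lra. split; [tauto|]. split.
      + eapply is_lim_seq_ext; [|exact Hl]. intros n. simpl. f_equal. ring.
      + eapply bv_ext; [|exact (bv_scal (-1) _ V6)]. intros n. unfold pot.
        pose proof (Hb (S n)). field. lra.
    - exists (-1). rewrite sign_eq_1 in V6 by lra. split; [tauto|]. split.
      + replace (-2) with (-1 * 2) by ring.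
        eapply is_lim_seq_ext; [|exact (is_lim_seq_mult' _ _ _ _ (is_lim_seq_const (-1)) Hl)].
        intros n. simpl. pose proof (Hb n). field. lra.
      + eapply bv_ext; [|exact (bv_scal (-1) _ V6)]. intros n. unfold pot.
        pose proof (Hb (S n)). field. lra. }
  destruct H as [sg [Hsg [Hd VD]]].
  destruct (bv_lim _ V1) as [s0 Ls]. destruct (bv_lim _ VD) as [D0 LD].
  exists sg, s0, D0. constructor; assumption.
Qed.

Lemma sqrt_to_infinity (gamma : nat -> R) :
  is_lim_seq gamma p_infty -> is_lim_seq (fun n => sqrt (gamma n)) p_infty.
Proof.
  intros H. apply is_lim_seq_spec in H. apply is_lim_seq_spec. intros M.
  destruct (H (M ^ 2)) as [N HN]. exists N. intros n Hn. specialize (HN n Hn).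
  eapply Rle_lt_trans; [apply Rle_abs|].
  rewrite <- sqrt_Rsqr_abs. apply sqrt_lt_1_alt. unfold Rsqr. nra.
Qed.

Lemma inv_sqrt_lim (gamma : nat -> R) :
  is_lim_seq gamma p_infty -> is_lim_seq (fun n => 1 / sqrt (gamma (S n))) 0.
Proof.
  intros H. pose proof (sqrt_to_infinity gamma H) as Hs.
  apply is_lim_seq_incr_1 in Hs.
  apply is_lim_seq_ext with (fun n => / sqrt (gamma (S n))); [intros; unfold Rdiv; ring|].
  exact (is_lim_seq_inv _ _ Hs ltac:(discriminate)).
Qed.

(** Write [sg * a n / b n = -2 + t / sqrt (gamma n)].  Then [t + s] tends to [0] and
    [tau_seq = t ^ 2 - 4 * D], so that the limit is the discriminant of the limit
    of the energy form. *)
Lemma normalized_tau_lim (gamma a b : nat -> R) (sg s0 D0 : R) :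
  (forall n, 0 < gamma n) -> (forall n, 0 < b n) -> is_lim_seq gamma p_infty ->
  normalized gamma a b sg s0 D0 -> is_lim_seq (tau_seq gamma a b) (s0 ^ 2 - 4 * D0).
Proof.
  intros Hg Hb Hgl [Hsg _ _ _ _ _ _ Hs HD].
  replace (s0 ^ 2 - 4 * D0) with ((0 * D0 - s0) * (0 * D0 - s0) - 4 * D0) by ring.
  pose proof (is_lim_seq_mult' _ _ _ _ (inv_sqrt_lim gamma Hgl) HD) as H1.
  pose proof (is_lim_seq_minus' _ _ _ _ H1 Hs) as H2.
  eapply is_lim_seq_ext;
    [|exact (is_lim_seq_minus' _ _ _ _ (is_lim_seq_mult' _ _ _ _ H2 H2)
        (is_lim_seq_mult' _ _ _ _ (is_lim_seq_const 4) HD))].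
  intros n. unfold tau_seq, pot. cbv beta.
  pose proof (Hg (S n)) as Hgn. pose proof (Hb (S n)) as Hbn.
  pose proof (sqrt_lt_R0 _ Hgn) as HS.
  pose proof (sqrt_sqrt (gamma (S n)) ltac:(lra)) as HSS.
  set (T := sqrt (gamma (S n))) in *. rewrite <- HSS.
  destruct Hsg as [-> | ->]; field; lra.
Qed.

(** What the growth estimates need to know about the parameters once the
    perturbation has been absorbed; [ap] is the diagonal with the sign for which
    [ap n / b n] tends to [-2]. *)
Record tame (gamma b ap : nat -> R) (C : R) (e : nat -> R) : Prop := {
  tame_C : 1 <= C;
  tame_gamma : forall n, 0 < gamma n;
  tame_b : forall n, 0 < b n;
  tame_b_up : forall n, b (S n) <= C * b n;
  tame_b_down : forall n, b n <= C * b (S n);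
  tame_gamma_low : forall n, 1 <= C * sqrt (gamma n);
  tame_gamma_step : forall n, Rabs (sqrt (gamma (S n)) - sqrt (gamma n)) <= C;
  tame_ratio : forall n, sqrt (gamma (S n)) * Rabs (b n / b (S n) - 1) <= C;
  tame_e : forall n, 0 <= e n;
  tame_e_sum : ex_series e;
  tame_potential : forall n,
    gamma (S n) * Rabs (pot b ap n) <= C + sqrt (gamma (S n)) * e n;
  tame_solution : forall u : nat -> R, solves b ap u -> exists K, 0 < K /\ energy_le gamma b u K
}.

Lemma ex_lim_bounded (x : nat -> R) (l : R) :
  is_lim_seq x l -> exists M, 0 < M /\ forall n, Rabs (x n) <= M.
Proof. intros H. apply bounded_of_lim. exists l. exact H. Qed.

Lemma sqrt_low (gamma : nat -> R) :
  (forall n, 0 < gamma n) -> is_lim_seq gamma p_infty ->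
  exists L, 0 < L /\ forall n, 1 <= L * sqrt (gamma n).
Proof.
  intros Hg Hl.
  pose proof (sqrt_to_infinity gamma Hl) as Hs. apply is_lim_seq_spec in Hs.
  destruct (Hs 1) as [N HN].
  apply (eventually_all_le (fun _ => 1) (fun n => sqrt (gamma n)) 1 N).
  - intros n. apply sqrt_lt_R0, Hg.
  - intros n Hn. specialize (HN n Hn). lra.
Qed.

Lemma weighted_product (w x y z X Y F : R) :
  0 <= w -> Rabs x <= X -> 0 <= y <= Y -> w * Rabs z <= F ->
  w * Rabs (x * y * z) <= X * Y * F.
Proof.
  intros Hw Hx Hy Hz. rewrite !Rabs_mult, (Rabs_pos_eq y) by lra.
  replace (w * (Rabs x * y * Rabs z)) with (Rabs x * y * (w * Rabs z)) by ring.
  abs_ge0 x. abs_ge0 z.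
  apply Rmult_le_compat; try apply Rmult_le_pos; try apply Rmult_le_compat; lra.
Qed.

Record perturbed (gamma ta tb a b chi mu : nat -> R) : Prop := {
  pt_gamma_pos : forall n, 0 < gamma n;
  pt_gamma_lim : is_lim_seq gamma p_infty;
  pt_gamma_step : is_lim_seq (fun n => sqrt (gamma (S n)) - sqrt (gamma n)) 0;
  pt_tb_pos : forall n, 0 < tb n;
  pt_b_pos : forall n, 0 < b n;
  pt_b : forall n, b n = tb n * (1 + chi n);
  pt_a : forall n, a n = ta n * (1 + mu n);
  pt_sum : ex_series (fun n => sqrt (gamma n) * (Rabs (chi n) + Rabs (mu n)))
}.

Lemma perturbation_small (gamma ta tb a b chi mu : nat -> R) (sg s0 D0 : R) :
  perturbed gamma ta tb a b chi mu -> normalized gamma ta tb sg s0 D0 ->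
  exists (e : nat -> R) (K : R),
    0 < K /\ (forall n, b n <= K * tb n /\ tb n <= K * b n) /\
    (forall n, 0 < e n) /\ ex_series e /\
    (forall n, (1 + sqrt (gamma (S n))) * Rabs (b n / b (S n) - tb n / tb (S n)) <= e n) /\
    (forall n, (1 + sqrt (gamma (S n)))
       * Rabs (pot b (fun n => sg * a n) n - pot tb (fun n => sg * ta n) n) <= e n).
Proof.
  intros [Hg Hgl Hstep Htb Hb Hbe Hae Hsum] [_ Hr Ht _ _ _ _ _ _].
  destruct (sqrt_low gamma Hg Hgl) as [L [HL0 HL]].
  destruct (ex_lim_bounded _ _ Hstep) as [St [HSt0 HSt]].
  destruct (ex_lim_bounded _ _ Hr) as [R0 [HR0 HR]].
  destruct (ex_lim_bounded _ _ Ht) as [T0 [HT0 HT]].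
  assert (HS : forall n, 0 < sqrt (gamma n)) by (intros; apply sqrt_lt_R0, Hg).
  set (f := fun n => sqrt (gamma n) * (Rabs (chi n) + Rabs (mu n))) in *.
  assert (Hf0 : forall n, 0 <= f n).
  { intros n. apply Rmult_le_pos; [left; apply HS|].
    abs_ge0 (chi n). abs_ge0 (mu n). lra. }
  assert (Hchi_lim : is_lim_seq chi 0).
  { apply is_lim_seq_abs_0. apply is_lim_seq_le_le with (fun _ => 0) (fun n => L * f n).
    - intros n. split; [apply Rabs_pos|]. specialize (HL n). unfold f.
      abs_ge0 (chi n). abs_ge0 (mu n).
      rewrite <- Rmult_assoc. nra.
    - apply is_lim_seq_const.
    - replace 0 with (L * 0) by ring.
      apply is_lim_seq_mult'; [apply is_lim_seq_const|apply ex_series_lim_0, Hsum]. }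
  assert (Hp : forall n, 0 < 1 + chi n).
  { intros n. specialize (Hb n). specialize (Htb n). rewrite (Hbe n) in Hb.
    apply Rmult_lt_reg_l with (tb n); lra. }
  assert (H1chi : is_lim_seq (fun n => 1 + chi n) (1 + 0)).
  { apply is_lim_seq_plus'; [apply is_lim_seq_const|exact Hchi_lim]. }
  destruct (ex_lim_bounded _ _ H1chi) as [M1 [HM10 HM1]].
  assert (Hinv : is_lim_seq (fun n => 1 / (1 + chi n)) (1 / (1 + 0))).
  { apply is_lim_seq_div'; [apply is_lim_seq_const|exact H1chi|lra]. }
  destruct (ex_lim_bounded _ _ Hinv) as [M2 [HM20 HM2]].
  assert (HM2i : forall n, 0 <= / (1 + chi n) <= M2).
  { intros n. pose proof (Rinv_0_lt_compat _ (Hp n)). split; [lra|].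
    specialize (HM2 n). unfold Rdiv in HM2. rewrite Rmult_1_l, Rabs_pos_eq in HM2; lra. }
  set (Q := 1 + L + St * L). assert (HQ : 0 < Q) by (unfold Q; nra).
  assert (Hweight : forall n x y, 0 <= x -> 0 <= y ->
     (1 + sqrt (gamma (S n))) * (x + y) <= Q * (sqrt (gamma n) * x + sqrt (gamma (S n)) * y)).
  { intros n x y Hx Hy. specialize (HSt n). apply Rabs_le_between in HSt.
    pose proof (HL n). pose proof (HL (S n)). pose proof (HS (S n)).
    assert (1 + sqrt (gamma (S n)) <= Q * sqrt (gamma n)) by (unfold Q; nra).
    assert (1 + sqrt (gamma (S n)) <= Q * sqrt (gamma (S n))).
    { unfold Q. assert (0 <= St * L * sqrt (gamma (S n))) by (repeat apply Rmult_le_pos; lra). lra. }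
    nra. }
  set (F := fun n => Q * (f n + f (S n))).
  set (W := (R0 + T0) * M2). assert (HW : 0 < W) by (apply Rmult_lt_0_compat; lra).
  (* The summand [(1 / 2) ^ n] makes the error positive: it serves as the weight
     of [qf_cross] in [energy_bounded]. *)
  exists (fun n => W * F n + (1 / 2) ^ n), (M1 + M2).
  assert (Hhalf : forall n, 0 < (1 / 2) ^ n) by (intros; apply pow_lt; lra).
  assert (HF : forall n, 0 <= F n).
  { intros n. apply Rmult_le_pos; [lra|]. pose proof (Hf0 n). pose proof (Hf0 (S n)). lra. }
  split; [lra|]. split; [|split; [|split]].
  - intros n. specialize (HM1 n). specialize (HM2i n). pose proof (Hp n). pose proof (Htb n).
    rewrite Rabs_pos_eq in HM1 by lra.
    assert (1 <= M2 * (1 + chi n)).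
    { apply Rle_trans with (/ (1 + chi n) * (1 + chi n)).
      - rewrite Rinv_l; lra.
      - mul_r. }
    rewrite (Hbe n). split; [nra|].
    assert (0 <= M1 * (tb n * (1 + chi n))) by (apply Rmult_le_pos; nra). nra.
  - intros n. specialize (Hhalf n). pose proof (Rmult_le_pos W (F n) (Rlt_le _ _ HW) (HF n)). lra.
  - apply ex_series_plus_R; [|apply ex_series_geom; rewrite Rabs_pos_eq; lra].
    apply ex_series_scal_R, ex_series_scal_R, ex_series_plus_R; [exact Hsum|apply ex_series_S, Hsum].
  - assert (Hd : forall n,
      (1 + sqrt (gamma (S n))) * Rabs (b n / b (S n) - tb n / tb (S n)) <= R0 * M2 * F n /\
      (1 + sqrt (gamma (S n))) * Rabs (sg * a (S n) / b (S n) - sg * ta (S n) / tb (S n))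
        <= T0 * M2 * F n).
    { intros n. pose proof (Hp (S n)). pose proof (Htb (S n)).
      abs_ge0 (chi n). abs_ge0 (chi (S n)). abs_ge0 (mu (S n)).
      abs_ge0 (mu n). pose proof (HS (S n)). pose proof (HS n).
      assert (Hz : forall z y x, 0 <= x <= Rabs (chi n) -> 0 <= y <= Rabs (chi (S n)) + Rabs (mu (S n)) ->
                Rabs z <= x + y -> (1 + sqrt (gamma (S n))) * Rabs z <= F n).
      { intros z y x Hx Hy Hz. apply Rle_trans with ((1 + sqrt (gamma (S n))) * (x + y)).
        - mul_l.
        - eapply Rle_trans; [apply Hweight; lra|]. unfold F, f.
          mul_l.
          apply Rplus_le_compat; mul_l. }
      split.
      - replace (b n / b (S n) - tb n / tb (S n))
          with (tb n / tb (S n) * / (1 + chi (S n)) * (chi n - chi (S n)))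
          by (rewrite !Hbe; field; lra).
        apply weighted_product; auto; [lra|].
        apply (Hz _ (Rabs (chi (S n))) (Rabs (chi n))); try lra.
        bound_by Rabs_triang. rewrite Rabs_Ropp. lra.
      - replace (sg * a (S n) / b (S n) - sg * ta (S n) / tb (S n))
          with (sg * ta (S n) / tb (S n) * / (1 + chi (S n)) * (mu (S n) - chi (S n)))
          by (rewrite Hbe, Hae; field; lra).
        apply weighted_product; [lra|exact (HT (S n))|auto|].
        apply (Hz _ (Rabs (chi (S n)) + Rabs (mu (S n))) 0); try lra.
        bound_by Rabs_triang. rewrite Rabs_Ropp. lra. }
    assert (Hnn : forall n, 0 <= R0 * M2 * F n /\ 0 <= T0 * M2 * F n).
    { intros n. split; (apply Rmult_le_pos; [apply Rmult_le_pos; lra|apply HF]). }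
    split; intros n; destruct (Hd n) as [H1 H2]; destruct (Hnn n) as [H3 H4];
      specialize (Hhalf n); pose proof (HS (S n)); unfold W.
    + lra.
    + unfold pot.
      replace (1 + sg * a (S n) / b (S n) + b n / b (S n)
               - (1 + sg * ta (S n) / tb (S n) + tb n / tb (S n)))
        with ((b n / b (S n) - tb n / tb (S n))
              + (sg * a (S n) / b (S n) - sg * ta (S n) / tb (S n))) by ring.
      eapply Rle_trans; [mul_l; apply Rabs_triang|]. lra.
Qed.

Lemma le_chain (K R0 x y u v : R) :
  0 <= K -> 0 <= R0 -> x <= K * u -> u <= R0 * v -> v <= K * y -> x <= K * R0 * K * y.
Proof.
  intros HK HR H1 H2 H3. replace (K * R0 * K * y) with (K * (R0 * (K * y))) by ring.
  eapply Rle_trans; [exact H1|]. mul_l.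
  eapply Rle_trans; [exact H2|]. mul_l.
Qed.

Lemma tame_of_perturbed (gamma ta tb a b chi mu : nat -> R) (sg s0 D0 : R) :
  perturbed gamma ta tb a b chi mu -> normalized gamma ta tb sg s0 D0 -> s0 ^ 2 < 4 * D0 ->
  exists C e, tame gamma b (fun n => sg * a n) C e.
Proof.
  intros Hpt Hnf Hdisc.
  destruct (perturbation_small gamma ta tb a b chi mu sg s0 D0 Hpt Hnf)
    as [e [K [HK [Hbt [He [Hes [Hd1 Hd]]]]]]].
  destruct Hpt as [Hg Hgl Hstep Htb Hb _ _ _]. destruct Hnf as [_ Hr _ Vs VD Vsig Veps Ls LD].
  destruct (sqrt_low gamma Hg Hgl) as [L [HL0 HL]].
  destruct (bv_bounded _ Vs) as [Ms [HMs0 HMs]].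
  destruct (bv_bounded _ VD) as [MD [HMD0 HMD]].
  destruct (bv_bounded _ Vsig) as [Mg [HMg0 HMg]].
  destruct (ex_lim_bounded _ _ Hr) as [R0 [HR0 HR]].
  assert (Hri : is_lim_seq (fun n => 1 / (tb n / tb (S n))) (1 / 1)).
  { apply is_lim_seq_div'; [apply is_lim_seq_const|exact Hr|lra]. }
  destruct (ex_lim_bounded _ _ Hri) as [R1 [HR10 HR1]].
  destruct (ex_lim_bounded e 0) as [Me [HMe0 HMe]]; [apply ex_series_lim_0, Hes|].
  assert (HS : forall n, 0 < sqrt (gamma n)) by (intros; apply sqrt_lt_R0, Hg).
  assert (HSS : forall n, sqrt (gamma n) * sqrt (gamma n) = gamma n)
    by (intros n; apply sqrt_sqrt; left; apply Hg).
  assert (Htbr : forall n, tb n <= R0 * tb (S n) /\ tb (S n) <= R1 * tb n).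
  { intros n. pose proof (Htb n). pose proof (Htb (S n)). specialize (HR n). specialize (HR1 n).
    rewrite Rabs_pos_eq in HR by (apply Rdiv_le_0_compat; lra).
    replace (1 / (tb n / tb (S n))) with (tb (S n) / tb n) in HR1 by (field; lra).
    rewrite Rabs_pos_eq in HR1 by (apply Rdiv_le_0_compat; lra).
    split; apply Rle_div_l; assumption. }
  set (C := 1 + L + Ms + MD + Mg + Me + K * R0 * K + K * R1 * K).
  assert (HKR0 : 0 < K * R0 * K) by (repeat apply Rmult_lt_0_compat; lra).
  assert (HKR1 : 0 < K * R1 * K) by (repeat apply Rmult_lt_0_compat; lra).
  set (tpot := pot tb (fun n => sg * ta n)) in *. set (ptl := pot b (fun n => sg * a n)) in *.
  exists C, e. constructor; auto.
  - unfold C. lra.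
  - intros n. pose proof (Hb n).
    apply Rle_trans with (K * R1 * K * b n); [|apply Rmult_le_compat_r; unfold C; lra].
    apply (le_chain K R1 _ _ (tb (S n)) (tb n)); try lra; [apply Hbt|apply Htbr|apply Hbt].
  - intros n. pose proof (Hb (S n)).
    apply Rle_trans with (K * R0 * K * b (S n)); [|apply Rmult_le_compat_r; unfold C; lra].
    apply (le_chain K R0 _ _ (tb n) (tb (S n))); try lra; [apply Hbt|apply Htbr|apply Hbt].
  - intros n. apply Rle_trans with (L * sqrt (gamma n)); [apply HL|].
    apply Rmult_le_compat_r; [left; apply HS|unfold C; lra].
  - intros n. eapply Rle_trans; [apply HMg|unfold C; lra].
  - intros n. specialize (HMs n). specialize (Hd1 n). specialize (HMe n). specialize (He n).
    rewrite Rabs_pos_eq in HMe by lra. pose proof (HS (S n)).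
    rewrite Rabs_mult, (Rabs_pos_eq (sqrt _)) in HMs by lra.
    replace (b n / b (S n) - 1) with ((b n / b (S n) - tb n / tb (S n)) + (tb n / tb (S n) - 1)) by ring.
    eapply Rle_trans; [mul_l; apply Rabs_triang|].
    abs_ge0 (b n / b (S n) - tb n / tb (S n)). unfold C. lra.
  - intros n. left. apply He.
  - intros n. specialize (HMD n). specialize (Hd n). pose proof (HS (S n)). pose proof (Hg (S n)).
    rewrite Rabs_mult, (Rabs_pos_eq (gamma _)) in HMD by lra. fold ptl.
    replace (ptl n) with (tpot n + (ptl n - tpot n)) by ring.
    eapply Rle_trans; [mul_l; apply Rabs_triang|].
    abs_ge0 (ptl n - tpot n).
    assert (gamma (S n) * Rabs (ptl n - tpot n) <= sqrt (gamma (S n)) * e n).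
    { rewrite <- (HSS (S n)) at 1. rewrite Rmult_assoc. mul_l. }
    unfold C. lra.
  - intros u Hu.
    set (eps := fun n => 1 / sqrt (gamma (S n))).
    set (s := fun n => sqrt (gamma (S n)) * (tb n / tb (S n) - 1)) in *.
    set (D := fun n => gamma (S n) * tpot n) in *.
    set (sig := fun n => sqrt (gamma (S (S n))) - sqrt (gamma (S n))).
    set (x := fun n => u (S n)).
    set (y := fun n => sqrt (gamma (S n)) * (u (S n) - u n)).
    set (r := fun n => b n / b (S n)). set (tr := fun n => tb n / tb (S n)).
    set (del := fun n => (r n - tr n) * y n - sqrt (gamma (S n)) * (ptl n - tpot n) * x n).
    assert (Hes' : forall n, 1 + eps n * s n = tr n).
    { intros n. unfold eps, s, tr. pose proof (HS (S n)). pose proof (Htb (S n)). field. lra. }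
    assert (HeD : forall n, eps n * D n = sqrt (gamma (S n)) * tpot n).
    { intros n. unfold eps, D. rewrite <- (HSS (S n)) at 2. pose proof (HS (S n)). field. lra. }
    assert (Hesig : forall n, 1 + eps n * sig n = sqrt (gamma (S (S n))) / sqrt (gamma (S n))).
    { intros n. unfold eps, sig. pose proof (HS (S n)). field. lra. }
    assert (Hm : forall n, (1 + eps n * s n) * y n - eps n * D n * x n + del n
                   = sqrt (gamma (S n)) * (u (S (S n)) - u (S n))).
    { intros n. rewrite Hes', HeD, (solves_step b _ u n (Hb (S n)) Hu). fold ptl.
      unfold del, y, x, r. ring. }
    destruct (energy_bounded eps s sig D e x y del (fun n => tb n / sqrt (gamma (S n))) s0 D0)
      as [B [N HN]]; auto.
    + exact (bv_S _ Vsig).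
    + exact (inv_sqrt_lim gamma Hgl).
    + exact (proj1 (is_lim_seq_incr_1 _ _) Hstep).
    + intros n. apply Rdiv_lt_0_compat; auto.
    + intros n. rewrite Hes', Hesig. unfold tr. pose proof (HS (S n)). pose proof (HS (S (S n))).
      pose proof (Htb (S n)). field. lra.
    + intros n. unfold del. specialize (Hd n). specialize (Hd1 n). fold (r n) (tr n) in Hd1.
      pose proof (HS (S n)).
      bound_by Rabs_triang. rewrite Rabs_Ropp, !Rabs_mult.
      rewrite (Rabs_pos_eq (sqrt _)) by lra.
 abs_ge0 (ptl n - tpot n).
      abs_ge0 (x n). abs_ge0 (y n).
      assert (Rabs (r n - tr n) <= e n) by nra.
      nra.
    + intros n. rewrite Hm. unfold x, eps. pose proof (HS (S n)). field. lra.
    + intros n. rewrite Hm, Hesig. unfold y. pose proof (HS (S n)). field. lra.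
    + apply (eventually_all_le (fun n => u (S n) ^ 2 + gamma (S n) * (u (S n) - u n) ^ 2)
               (fun n => rate gamma b (S n)) (Rabs B * (K * R1)) N).
      * intros n. apply Rdiv_lt_0_compat; auto.
      * intros n Hn. specialize (HN n Hn). cbv beta in HN.
        replace (x n ^ 2 + y n ^ 2) with (u (S n) ^ 2 + gamma (S n) * (u (S n) - u n) ^ 2) in HN
          by (unfold x, y; rewrite <- (HSS (S n)) at 1; ring).
        pose proof (HS (S n)). pose proof (Htb n). pose proof (Hb (S n)).
        destruct (Htbr n) as [_ Hx1]. destruct (Hbt (S n)) as [Hx2 _].
        pose proof (Rle_abs B). abs_ge0 B.
        apply Rmult_le_reg_l with (tb n / sqrt (gamma (S n))); [apply Rdiv_lt_0_compat; lra|].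
        apply Rle_trans with (Rabs B); [lra|]. unfold rate.
        replace (tb n / sqrt (gamma (S n)) * (Rabs B * (K * R1) * (sqrt (gamma (S n)) / b (S n))))
          with (Rabs B * (K * (R1 * tb n) / b (S n))) by (field; lra).
        rewrite <- (Rmult_1_r (Rabs B)) at 1. mul_l.
        apply Rle_div_r; [lra|]. rewrite Rmult_1_l.
        eapply Rle_trans; [exact Hx2|]. mul_l.
Qed.

(** * The canonical system *)

(** The value at [z] of a solution, expressed in the two solutions at [0]. *)
Definition csol (p q : nat -> R) (al be : nat -> C) (n : nat) : C :=
  (p n * al n + q n * be n)%C.

(** Variation of constants: the coefficients of a solution at [z] with respect to
    the solutions [p], [q] at [0] follow a discrete canonical system whose
    Hamiltonian at [n] is the rank one matrix of [(p n, q n)]. *)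
Definition canonical (p q : nat -> R) (z : C) (al be : nat -> C) : Prop :=
  forall n, al (S n) = (al n - z * (q n * csol p q al be n))%C /\
            be (S n) = (be n + z * (p n * csol p q al be n))%C.

Definition cnorm (al be : nat -> C) (n : nat) : R := Cmod (al n) + Cmod (be n).

Lemma cnorm_nonneg (al be : nat -> C) (n : nat) : 0 <= cnorm al be n.
Proof. unfold cnorm. mod_ge0 (al n). mod_ge0 (be n). lra. Qed.

Lemma Cmod_RtoC_mult (x : R) (c : C) : Cmod (x * c)%C = Rabs x * Cmod c.
Proof. rewrite Cmod_mult, Cmod_R. reflexivity. Qed.

Lemma pow_sign (sg : R) (n : nat) : sg = 1 \/ sg = -1 -> sg ^ n * sg ^ n = 1.
Proof.
  intros H. rewrite <- Rpow_mult_distr. replace (sg * sg) with 1 by (destruct H; subst; ring).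
  apply pow1.
Qed.

(** [p] and [q] enter the system quadratically, so the change of sign that turns
    the diagonal [a] into [- a] leaves it unchanged. *)
Lemma canonical_flip (sg : R) (p q : nat -> R) (z : C) (al be : nat -> C) :
  sg = 1 \/ sg = -1 -> canonical p q z al be ->
  canonical (fun n => sg ^ n * p n) (fun n => sg ^ n * q n) z al be.
Proof.
  intros Hsg H n. destruct (H n) as [Ha Hb]. rewrite Ha, Hb.
  pose proof (pow_sign sg n Hsg) as Hs. apply (f_equal RtoC) in Hs. rewrite RtoC_mult in Hs.
  unfold csol. rewrite !RtoC_mult. set (s := RtoC (sg ^ n)) in *.
  split; f_equal.
  - transitivity (z * ((s * s) * q n * (p n * al n + q n * be n)))%C; [rewrite Hs|]; ring.
  - transitivity (z * ((s * s) * p n * (p n * al n + q n * be n)))%C; [rewrite Hs|]; ring.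
Qed.

(** At [z = i r] the coefficients of the solution starting from [(1, 0)] keep
    [Im (conj al * be)] nondecreasing, and the first step makes it equal to [r]. *)
Lemma form_lower (p q : nat -> R) (r : R) (al be : nat -> C) :
  canonical p q (0, r) al be -> 0 <= r -> p O = 1 -> q O = 0 ->
  al O = RtoC 1 -> be O = RtoC 0 ->
  forall n, r <= Re (al (S n)) * Im (be (S n)) - Im (al (S n)) * Re (be (S n)).
Proof.
  intros H Hr Hp Hq Ha Hb.
  assert (Hstep : forall n, Re (al (S n)) * Im (be (S n)) - Im (al (S n)) * Re (be (S n))
    = Re (al n) * Im (be n) - Im (al n) * Re (be n)
      + r * ((p n * Re (al n) + q n * Re (be n)) ^ 2 + (p n * Im (al n) + q n * Im (be n)) ^ 2)).
  { intros n. destruct (H n) as [-> ->]. unfold csol. destruct (al n), (be n). cbn. ring. }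
  induction n as [|n IH].
  - rewrite Hstep, Hp, Hq, Ha, Hb. cbn. lra.
  - rewrite Hstep.
    sq_ge0 (p (S n) * Re (al (S n)) + q (S n) * Re (be (S n))).
    sq_ge0 (p (S n) * Im (al (S n)) + q (S n) * Im (be (S n))). nra.
Qed.

Lemma Cmod_sq (c : C) : Cmod c ^ 2 = Re c ^ 2 + Im c ^ 2.
Proof. apply pow2_sqrt. apply Rplus_le_le_0_compat; apply pow2_ge_0. Qed.

(** * Exponential growth on the imaginary axis *)

(** With [z = i] and real and imaginary parts [(a1, b1)], [(a2, b2)], the form
    [a1 b2 - a2 b1] increases by [s1 ^ 2 + s2 ^ 2] in each step. This alone says
    nothing where [s1, s2] are small compared with the vector. There the
    virial form [qf A B C] increases instead; a small multiple [kappa] of it is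
    added, so that the sum increases by a fixed fraction of [g] times the squared
    norm. The shift by [2 K] makes the added form nonnegative. The case [z = i y]
    is contained in this one: [p] and [q] are multiplied by [sqrt y]. *)
Lemma canonical_growth (K c : R) : 1 <= K -> 0 < c ->
  exists c1, 0 < c1 /\
  forall (p q A B C g a1 a2 b1 b2 : nat -> R),
    (forall n, 0 < g n <= K) ->
    (forall n, p n ^ 2 + q n ^ 2 <= K * g n) ->
    (forall n, Rabs (A n) <= K) -> (forall n, Rabs (B n) <= K) -> (forall n, Rabs (C n) <= K) ->
    (forall n x y, qf (A n) (B n) (C n) x y + c * (g n * (x ^ 2 + y ^ 2))
        <= qf (A (S n)) (B (S n)) (C (S n)) x y + K * (p n * x + q n * y) ^ 2) ->
    (forall n, a1 (S n) = a1 n + q n * (p n * a2 n + q n * b2 n)) ->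
    (forall n, b1 (S n) = b1 n - p n * (p n * a2 n + q n * b2 n)) ->
    (forall n, a2 (S n) = a2 n - q n * (p n * a1 n + q n * b1 n)) ->
    (forall n, b2 (S n) = b2 n + p n * (p n * a1 n + q n * b1 n)) ->
    0 <= a1 O * b2 O - a2 O * b1 O ->
    forall n, (a1 O * b2 O - a2 O * b1 O) * exp (c1 * psum g n)
      <= 5 * (a1 n ^ 2 + a2 n ^ 2 + b1 n ^ 2 + b2 n ^ 2).
Proof.
  intros HK Hc.
  assert (HK3 : 0 < K ^ 3) by (apply pow_lt; lra).
  set (K1 := 32 * K ^ 3 / c).
  assert (HK1 : 0 < K1) by (apply Rdiv_lt_0_compat; lra).
  set (kappa := 1 / (K + K1)).
  assert (Hkap : 0 < kappa) by (unfold kappa; apply Rdiv_lt_0_compat; lra).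
  assert (HkK : kappa * K <= 1).
  { unfold kappa. apply Rmult_le_reg_r with (K + K1); [lra|]. field_simplify; lra. }
  assert (HkK1 : kappa * (K + K1) = 1) by (unfold kappa; field; lra).
  set (k0 := kappa * c / 10).
  assert (Hk0 : 0 < k0) by (unfold k0; apply Rdiv_lt_0_compat; nra).
  exists (k0 / (1 + k0 * K)). split; [apply Rdiv_lt_0_compat; nra|].
  intros p q A B C g a1 a2 b1 b2 Hg Hpq HA HB HC Hvir Ha1 Hb1 Ha2 Hb2 HF0.
  set (P := fun n => qf (A n + 2 * K) (B n) (C n + 2 * K)).
  assert (HP : forall n x y, 0 <= P n x y <= 4 * K * (x ^ 2 + y ^ 2)).
  { intros n x y. unfold P, qf. specialize (HA n). specialize (HB n). specialize (HC n).
    apply Rabs_le_between in HA, HB, HC.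
    sq_ge0 (x + y). sq_ge0 (x - y).
    split; nra. }
  assert (Hstep : forall n x y t,
     P n x y + c / 2 * (g n * (x ^ 2 + y ^ 2)) - K * (p n * x + q n * y) ^ 2 - K1 * t ^ 2
     <= P (S n) (x + t * q n) (y - t * p n)).
  { intros n x y t. pose proof (Hg n) as Hgn.
    set (th := c / (8 * K) * g n).
    assert (Hc8 : 0 < c / (8 * K)) by (apply Rdiv_lt_0_compat; lra).
    assert (Hth : 0 < th) by (apply Rmult_lt_0_compat; lra).
    destruct (qf_cross (A (S n) + 2 * K) (B (S n)) (C (S n) + 2 * K) th x y (t * q n) (- (t * p n)) Hth)
      as [H1 _]; [intros; apply HP|].
    fold (P (S n)) in H1.
    assert (H2 : th * P (S n) x y <= c / 2 * (g n * (x ^ 2 + y ^ 2))).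
    { apply Rle_trans with (th * (4 * K * (x ^ 2 + y ^ 2))).
      - mul_l; apply HP.
      - right. unfold th. field. lra. }
    assert (H4 : P (S n) (t * q n) (- (t * p n)) / th <= K1 * t ^ 2).
    { apply (Rle_div_l _ _ th Hth).
      apply Rle_trans with (4 * K * t ^ 2 * (p n ^ 2 + q n ^ 2)).
      - bound_by HP. right. ring.
      - apply Rle_trans with (4 * K * t ^ 2 * (K * g n)).
        + apply Rmult_le_compat_l; [|apply Hpq]. nra.
        + right. unfold K1, th. field. lra. }
    specialize (Hvir n x y).
    assert (H3 : P (S n) x y - P n x y
                 = qf (A (S n)) (B (S n)) (C (S n)) x y - qf (A n) (B n) (C n) x y)
      by (unfold P, qf; ring).
    change (y - t * p n) with (y + - (t * p n)). lra. }
  set (Phi := fun n => a1 n * b2 n - a2 n * b1 n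
                       + kappa * (P n (a1 n) (b1 n) + P n (a2 n) (b2 n))).
  set (X := fun n => a1 n ^ 2 + a2 n ^ 2 + b1 n ^ 2 + b2 n ^ 2).
  assert (HPhiX : forall n, Phi n <= 5 * X n).
  { intros n. unfold Phi, X.
    destruct (HP n (a1 n) (b1 n)) as [_ H1]. destruct (HP n (a2 n) (b2 n)) as [_ H2].
 sq_ge0 (a2 n + b1 n).
    sq_ge0 (a1 n). sq_ge0 (b1 n).
    sq_ge0 (a2 n). sq_ge0 (b2 n).
    assert (kappa * (P n (a1 n) (b1 n) + P n (a2 n) (b2 n))
            <= kappa * (4 * K * (a1 n ^ 2 + b1 n ^ 2 + (a2 n ^ 2 + b2 n ^ 2))))
      by (mul_l).
    assert (kappa * K * (a1 n ^ 2 + b1 n ^ 2 + (a2 n ^ 2 + b2 n ^ 2))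
            <= 1 * (a1 n ^ 2 + b1 n ^ 2 + (a2 n ^ 2 + b2 n ^ 2)))
      by (mul_r).
    nra. }
  assert (HPhi : forall n, Phi n + kappa * c / 2 * (g n * X n) <= Phi (S n)).
  { intros n. unfold Phi, X.
    set (s1 := p n * a1 n + q n * b1 n). set (s2 := p n * a2 n + q n * b2 n).
    pose proof (Hstep n (a1 n) (b1 n) s2) as H1. pose proof (Hstep n (a2 n) (b2 n) (- s1)) as H2.
    fold s1 in H1. fold s2 in H2.
    replace (a1 (S n)) with (a1 n + s2 * q n) by (rewrite Ha1; unfold s2; ring).
    replace (b1 (S n)) with (b1 n - s2 * p n) by (rewrite Hb1; unfold s2; ring).
    replace (a2 (S n)) with (a2 n + - s1 * q n) by (rewrite Ha2; unfold s1; ring).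
    replace (b2 (S n)) with (b2 n - - s1 * p n) by (rewrite Hb2; unfold s1; ring).
    assert (HF : (a1 n + s2 * q n) * (b2 n - - s1 * p n) - (a2 n + - s1 * q n) * (b1 n - s2 * p n)
                 = a1 n * b2 n - a2 n * b1 n + s1 ^ 2 + s2 ^ 2) by (unfold s1, s2; ring).
    rewrite HF.
    assert (H3 : kappa * (P n (a1 n) (b1 n) + c / 2 * (g n * (a1 n ^ 2 + b1 n ^ 2)) - K * s1 ^ 2 - K1 * s2 ^ 2
                  + (P n (a2 n) (b2 n) + c / 2 * (g n * (a2 n ^ 2 + b2 n ^ 2)) - K * s2 ^ 2 - K1 * (- s1) ^ 2))
                <= kappa * (P (S n) (a1 n + s2 * q n) (b1 n - s2 * p n)
                            + P (S n) (a2 n + - s1 * q n) (b2 n - - s1 * p n)))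
      by (mul_l).
    replace (kappa * (P n (a1 n) (b1 n) + c / 2 * (g n * (a1 n ^ 2 + b1 n ^ 2)) - K * s1 ^ 2 - K1 * s2 ^ 2
                  + (P n (a2 n) (b2 n) + c / 2 * (g n * (a2 n ^ 2 + b2 n ^ 2)) - K * s2 ^ 2 - K1 * (- s1) ^ 2)))
      with (kappa * (P n (a1 n) (b1 n) + P n (a2 n) (b2 n))
            + kappa * c / 2 * (g n * (a1 n ^ 2 + a2 n ^ 2 + b1 n ^ 2 + b2 n ^ 2))
            - kappa * (K + K1) * (s1 ^ 2 + s2 ^ 2)) in H3 by field.
    rewrite HkK1 in H3. lra. }
  assert (HPhi0 : a1 O * b2 O - a2 O * b1 O <= Phi O).
  { unfold Phi. destruct (HP O (a1 O) (b1 O)) as [H1 _].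
    destruct (HP O (a2 O) (b2 O)) as [H2 _].
    assert (0 <= kappa * (P O (a1 O) (b1 O) + P O (a2 O) (b2 O)))
      by (apply Rmult_le_pos; lra).
    lra. }
  intros n. fold (X n). eapply Rle_trans; [|apply HPhiX].
  apply Rle_trans with (Phi O * exp (psum (fun n => k0 * g n) n / (1 + k0 * K))).
  - rewrite psum_scal. replace (k0 * psum g n / (1 + k0 * K)) with (k0 / (1 + k0 * K) * psum g n)
      by (field; nra).
    apply Rmult_le_compat_r; [left; apply exp_pos|exact HPhi0].
  - apply gronwall_lower.
    + intros m. destruct (Hg m). split; [nra|]. mul_l.
    + lra.
    + intros m _. specialize (HPhi m). specialize (HPhiX m). destruct (Hg m) as [Hgm _].
      assert (k0 * g m * Phi m <= k0 * g m * (5 * X m)) by (apply Rmult_le_compat_l; nra).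
      assert (k0 * g m * (5 * X m) = kappa * c / 2 * (g m * X m)) by (unfold k0; field).
      lra.
Qed.

(** The discrete virial identity: [gamma u u'] has derivative
    [gamma u' ^ 2] up to terms that are small or carry a factor [u ^ 2]. *)
Lemma virial_step (C E T T' rho d e u v : R) :
  1 <= C -> 0 < T -> 1 <= C * T -> T / 2 <= T' <= 2 * T -> Rabs (T' - T) <= C ->
  1 / 2 <= rho <= 2 -> T * Rabs (rho - 1) <= C ->
  0 <= e -> T ^ 2 * Rabs d <= C + T * e -> C * C + e <= E ->
  T ^ 2 * v ^ 2 / 64 - (E ^ 2 + 784 * C ^ 2 + 4 * C) * u ^ 2 - 4 * (T * e) * u ^ 2
  <= T' ^ 2 * ((u + (rho * v - d * u)) * (rho * v - d * u)) - T ^ 2 * (u * v).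
Proof.
  intros HC HT HCT HT' Hstep Hrho Hr He Hd HE.
  set (G := T' ^ 2 / T ^ 2).
  set (eta := T * v). set (m := rho * eta - T * d * u).
  assert (HT2 : 0 < T ^ 2) by nra.
  assert (HG : 1 / 4 <= G <= 4).
  { assert (H1 : 1 / 4 * T ^ 2 <= T' ^ 2) by nra.
    assert (H2 : T' ^ 2 <= 4 * T ^ 2) by nra.
    unfold G. split; [apply (Rle_div_r _ _ (T ^ 2) HT2)|apply (Rle_div_l _ _ (T ^ 2) HT2)]; lra. }
  assert (HG1 : T * Rabs (G - 1) <= 3 * C).
  { replace (G - 1) with ((T' - T) * ((T' + T) / T ^ 2)) by (unfold G; field; lra).
    rewrite Rabs_mult, (Rabs_pos_eq ((T' + T) / T ^ 2)) by (apply Rdiv_le_0_compat; lra).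
    replace (T * (Rabs (T' - T) * ((T' + T) / T ^ 2))) with (Rabs (T' - T) * ((T' + T) / T)) by (field; lra).
    rewrite (Rmult_comm 3). apply Rmult_le_compat; [apply Rabs_pos|apply Rdiv_le_0_compat; lra|lra|].
    apply Rle_div_l; lra. }
  assert (HGr : T * Rabs (G * rho - 1) <= 7 * C).
  { replace (G * rho - 1) with (G * (rho - 1) + (G - 1)) by ring.
    pose proof (Rabs_triang (G * (rho - 1)) (G - 1)) as Ht. rewrite Rabs_mult, (Rabs_pos_eq G) in Ht by lra.
    assert (T * (G * Rabs (rho - 1)) <= 4 * C) by nra.
    apply Rle_trans with (T * (G * Rabs (rho - 1) + Rabs (G - 1))); [apply Rmult_le_compat_l|]; lra. }
  assert (Hexp : T' ^ 2 * ((u + (rho * v - d * u)) * (rho * v - d * u)) - T ^ 2 * (u * v)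
     = G * m ^ 2 + (T * (G * rho - 1)) * (u * eta) - G * (T ^ 2 * d) * u ^ 2).
  { unfold m, eta, G. field. lra. }
  rewrite Hexp.
  pose proof (pow2_ge_0 u) as Hu2. pose proof (pow2_ge_0 m) as Hm2.
  pose proof (Rabs_pos d) as Hd0.
  assert (HTd : (T * d) ^ 2 <= E ^ 2).
  { rewrite <- (pow2_abs (T * d)). apply pow_incr. split; [apply Rabs_pos|].
    rewrite Rabs_mult, (Rabs_pos_eq T) by lra.
    apply Rmult_le_reg_l with T; [lra|].
    apply Rle_trans with (C + T * e); [lra|].
 nra. }
  assert (Hm : eta ^ 2 / 8 - E ^ 2 * u ^ 2 <= m ^ 2).
  { sq_ge0 (rho * eta - 2 * (T * d * u)).
    assert (H1 : rho ^ 2 * eta ^ 2 / 2 - (T * d) ^ 2 * u ^ 2 <= m ^ 2) by (unfold m; nra).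
    assert ((T * d) ^ 2 * u ^ 2 <= E ^ 2 * u ^ 2) by (mul_r).
    assert (1 / 4 * eta ^ 2 <= rho ^ 2 * eta ^ 2) by (apply Rmult_le_compat_r; nra). lra. }
  assert (HGm : eta ^ 2 / 32 - E ^ 2 * u ^ 2 <= G * m ^ 2).
  { assert (1 / 4 * m ^ 2 <= G * m ^ 2) by (mul_r).
 nra. }
  assert (Hcross : - (eta ^ 2 / 64) - 784 * C ^ 2 * u ^ 2 <= (T * (G * rho - 1)) * (u * eta)).
  { assert (H1 : Rabs ((T * (G * rho - 1)) * (u * eta)) <= 7 * C * (Rabs u * Rabs eta)).
    { rewrite !Rabs_mult, (Rabs_pos_eq T) by lra.
      apply Rmult_le_compat_r; [apply Rmult_le_pos; apply Rabs_pos|exact HGr]. }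
    apply Rabs_le_between in H1.
    pose proof (pow2_ge_0 (Rabs eta / 8 - 28 * C * Rabs u)) as H2.
    rewrite <- (pow2_abs u), <- (pow2_abs eta). nra. }
  assert (Hdu : G * (T ^ 2 * d) * u ^ 2 <= 4 * (C + T * e) * u ^ 2).
  { mul_r.
    assert (T ^ 2 * d <= T ^ 2 * Rabs d) by (mul_l; apply Rle_abs).
    assert (G * (T ^ 2 * d) <= G * (T ^ 2 * Rabs d)) by (mul_l).
    assert (G * (T ^ 2 * Rabs d) <= 4 * (T ^ 2 * Rabs d)) by (apply Rmult_le_compat_r; nra). lra. }
  replace (T ^ 2 * v ^ 2) with (eta ^ 2) by (unfold eta; ring). lra.
Qed.

(** Cauchy-Schwarz for the inverse of a 2x2 matrix: its norm is at most the norm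
    of the matrix divided by the determinant. *)
Lemma adjugate_bound (p q r s x y H W : R) :
  p ^ 2 + r ^ 2 <= H -> q ^ 2 + s ^ 2 <= H -> (p * s - q * r) ^ 2 = W ->
  W * (x ^ 2 + y ^ 2) <= 2 * H * ((p * x + q * y) ^ 2 + (r * x + s * y) ^ 2).
Proof.
  intros H1 H2 HW. subst W.
  set (u := p * x + q * y). set (v := r * x + s * y).
  assert (Hx : (p * s - q * r) * x = s * u - q * v) by (unfold u, v; ring).
  assert (Hy : (p * s - q * r) * y = p * v - r * u) by (unfold u, v; ring).
  replace ((p * s - q * r) ^ 2 * (x ^ 2 + y ^ 2))
    with (((p * s - q * r) * x) ^ 2 + ((p * s - q * r) * y) ^ 2) by ring.
  rewrite Hx, Hy.
  sq_ge0 (s * v + q * u). sq_ge0 (r * v + p * u).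
  sq_ge0 u. sq_ge0 v.
  nra.
Qed.

Definition wronskian (b p q : nat -> R) (n : nat) : R :=
  b n * (p n * q (S n) - q n * p (S n)).

(** Where [y <= b n / gamma n], the growth rate at [z = i y] is at least a
    constant times [y * sqrt (gamma n) / b n]. The shift of the virial form by a
    tail of [e] absorbs the part of the potential that is merely summable. *)
Lemma growth_lower (gamma b ap : nat -> R) (C : R) (e : nat -> R) (p q : nat -> R) (K0 : R) :
  tame gamma b ap C e ->
  is_lim_seq gamma p_infty ->
  solves b ap p -> solves b ap q ->
  (forall n, wronskian b p q n ^ 2 = 1) ->
  0 < K0 -> energy_le gamma b p K0 -> energy_le gamma b q K0 ->
  exists c1 N, 0 < c1 /\
  forall h y (al be : nat -> Complex.C), (N <= h)%nat -> 0 < y ->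
    (forall n, (h < n)%nat -> y <= b n / gamma n) ->
    canonical p q (0, y) al be ->
    0 <= Re (al (S h)) * Im (be (S h)) - Im (al (S h)) * Re (be (S h)) ->
    forall n,
      (Re (al (S h)) * Im (be (S h)) - Im (al (S h)) * Re (be (S h)))
        * exp (c1 * psum (fun k => y * rate gamma b (S h + k)) n)
      <= 5 * cnorm al be (S h + n) ^ 2.
Proof.
  intros Ht Hgl Hp Hq HW HK0 HEp HEq.
  destruct Ht as [HC Hg Hb Hbu Hbd HSlow HSstep Hratio He Hes Hpot _].
  assert (HS : forall n, 0 < sqrt (gamma n)) by (intros; apply sqrt_lt_R0, Hg).
  assert (HSS : forall n, sqrt (gamma n) ^ 2 = gamma n)
    by (intros n; apply pow2_sqrt; left; apply Hg).
  destruct (bounded_of_lim e) as [Me [HMe0 HMe]]; [exists 0; apply ex_series_lim_0, Hes|].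
  assert (Hlarge : exists N, forall n, (N <= n)%nat -> 2 * C <= sqrt (gamma n)).
  { pose proof (sqrt_to_infinity gamma Hgl) as Hl. apply is_lim_seq_spec in Hl.
    destruct (Hl (2 * C)) as [N HN]. exists N. intros n Hn. left. apply HN, Hn. }
  destruct Hlarge as [N HN].
  set (E := C * C + Me).
  set (D := E ^ 2 + 784 * C ^ 2 + 4 * C).
  assert (HD : 0 <= D) by (unfold D; sq_ge0 E; sq_ge0 C; lra).
  set (ET := Series e).
  assert (HET : 0 <= ET).
  { pose proof (psum_le_Series e 0 He Hes) as H. exact H. }
  set (K := D + 1 + C + 2 * K0 + 8 * K0 * ET).
  assert (HK8 : 0 <= 8 * K0 * ET) by (apply Rmult_le_pos; lra).
  assert (HK : 1 <= K) by (unfold K; lra).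
  set (c := 1 / (128 * (K0 * (C * C)))).
  assert (Hc : 0 < c).
  { unfold c. apply Rdiv_lt_0_compat; [lra|]. apply Rmult_lt_0_compat; [lra|].
    apply Rmult_lt_0_compat; nra. }
  destruct (canonical_growth K c HK Hc) as [c1 [Hc1 Hgrow]].
  exists c1, N. split; [exact Hc1|].
  intros h y al be Hh Hy Hyb Hcan HF n.
  assert (Hyn : forall n, (h < n)%nat -> y * (gamma n / b n) <= 1).
  { intros k Hk. specialize (Hyb k Hk). pose proof (Hg k). pose proof (Hb k).
    apply (Rle_div_r y (b k) (gamma k)) in Hyb; [|lra].
    unfold Rdiv. rewrite <- Rmult_assoc. apply (Rle_div_l (y * gamma k) 1 (b k)); lra. }
  set (sy := sqrt y). assert (Hsy : sy ^ 2 = y) by (apply pow2_sqrt; lra).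
  assert (Hg0 : forall m, 0 < rate gamma b m) by (intros; apply Rdiv_lt_0_compat; auto).
  assert (HyS : forall m, (h < m)%nat -> sqrt (gamma m) * (y * rate gamma b m) <= 1).
  { intros m Hm. specialize (Hyn m Hm). rewrite <- (HSS m) in Hyn. pose proof (Hb m).
    unfold rate. replace (sqrt (gamma m) * (y * (sqrt (gamma m) / b m))) with (y * (sqrt (gamma m) ^ 2 / b m))
      by (field; lra). exact Hyn. }
  assert (Htail : forall j, 0 <= tail_sum e j <= ET).
  { intros j. split.
    - exact (psum_le_tail_sum e j 0 He Hes).
    - unfold ET. rewrite (Series_tail_sum e j Hes). pose proof (psum_nonneg e j He). lra. }
  assert (Hprod : forall u v j, (h <= j)%nat ->
     u (S j) ^ 2 + gamma (S j) * (u (S j) - u j) ^ 2 <= K0 * rate gamma b (S j) ->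
     v (S j) ^ 2 + gamma (S j) * (v (S j) - v j) ^ 2 <= K0 * rate gamma b (S j) ->
     Rabs (y * (gamma (S j) * (u (S j) * (v (S j) - v j)))) <= K0).
  { intros u v j Hj Hu Hv. specialize (HyS (S j) ltac:(lia)).
    pose proof (HS (S j)) as HSj.
    rewrite <- (HSS (S j)) in Hu, Hv |- *.
    set (T := sqrt (gamma (S j))) in *. set (eta := T * (v (S j) - v j)).
    replace (y * (T ^ 2 * (u (S j) * (v (S j) - v j)))) with (y * T * (u (S j) * eta))
      by (unfold eta; ring).
    rewrite !Rabs_mult, (Rabs_pos_eq y), (Rabs_pos_eq T) by lra.
    assert (Hue : Rabs (u (S j)) * Rabs eta <= K0 * rate gamma b (S j)).
    { pose proof (pow2_ge_0 (Rabs (u (S j)) - Rabs eta)) as H1.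
      assert (H2 : Rabs eta ^ 2 = T ^ 2 * (v (S j) - v j) ^ 2) by (rewrite pow2_abs; unfold eta; ring).
      pose proof (pow2_abs (u (S j))).
      assert (0 <= T ^ 2 * (u (S j) - u j) ^ 2) by (apply Rmult_le_pos; apply pow2_ge_0). nra. }
    apply Rle_trans with (y * T * (K0 * rate gamma b (S j))).
    - apply Rmult_le_compat_l; [nra|exact Hue].
    - replace (y * T * (K0 * rate gamma b (S j))) with (K0 * (T * (y * rate gamma b (S j)))) by ring.
      rewrite <- (Rmult_1_r K0) at 2. mul_l. }
  set (A := fun n => y * (gamma (S (h + n)) * (p (S (h + n)) * (p (S (h + n)) - p (h + n)%nat)))
                     - 8 * K0 * tail_sum e (h + n)).
  set (B := fun n => y * (gamma (S (h + n)) * (p (S (h + n)) * (q (S (h + n)) - q (h + n)%nat)))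
                     + y * (gamma (S (h + n)) * (q (S (h + n)) * (p (S (h + n)) - p (h + n)%nat)))).
  set (Cc := fun n => y * (gamma (S (h + n)) * (q (S (h + n)) * (q (S (h + n)) - q (h + n)%nat)))
                     - 8 * K0 * tail_sum e (h + n)).
  assert (Habs : forall m u v k, Rabs u <= m -> Rabs v <= k -> Rabs (u - v) <= m + k).
  { intros m u v k Hu Hv. bound_by Rabs_triang. rewrite Rabs_Ropp. lra. }
  assert (Htl8 : forall j, Rabs (8 * K0 * tail_sum e j) <= 8 * K0 * ET).
  { intros j. destruct (Htail j). rewrite Rabs_pos_eq by (apply Rmult_le_pos; lra).
    mul_l. }
  specialize (Hgrow (fun n => sy * p (S h + n)%nat) (fun n => sy * q (S h + n)%nat) A B Cc
    (fun n => y * rate gamma b (S h + n))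
    (fun n => Re (al (S h + n)%nat)) (fun n => Im (al (S h + n)%nat))
    (fun n => Re (be (S h + n)%nat)) (fun n => Im (be (S h + n)%nat))).
  cbv beta in Hgrow. rewrite Nat.add_0_r in Hgrow.
  assert (Hcn : 5 * (Re (al (S h + n)%nat) ^ 2 + Im (al (S h + n)%nat) ^ 2
      + Re (be (S h + n)%nat) ^ 2 + Im (be (S h + n)%nat) ^ 2) <= 5 * cnorm al be (S h + n) ^ 2).
  { unfold cnorm. pose proof (Cmod_sq (al (S h + n)%nat)). pose proof (Cmod_sq (be (S h + n)%nat)).
    mod_ge0 (al (S h + n)%nat). mod_ge0 (be (S h + n)%nat). nra. }
  eapply Rle_trans; [|exact Hcn]. clear Hcn. apply Hgrow; clear Hgrow.
  - intros m. specialize (Hg0 (S h + m)%nat). split; [nra|].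
    specialize (HyS (S h + m)%nat ltac:(lia)). specialize (HSlow (S h + m)%nat).
    set (T := sqrt (gamma (S h + m)%nat)) in *. set (g := y * rate gamma b (S h + m)) in *.
    assert (0 < g) by (apply Rmult_lt_0_compat; lra).
    assert (1 * g <= C * T * g) by (mul_r).
    assert (C * (T * g) <= C * 1) by (mul_l). unfold K. lra.
  - intros m. change (S h + m)%nat with (S (h + m)).
    specialize (HEp (h + m)%nat). specialize (HEq (h + m)%nat).
    pose proof (Hg (S (h + m))).
    assert (0 <= gamma (S (h + m)) * (p (S (h + m)) - p (h + m)%nat) ^ 2)
      by (apply Rmult_le_pos; [lra|apply pow2_ge_0]).
    assert (0 <= gamma (S (h + m)) * (q (S (h + m)) - q (h + m)%nat) ^ 2)
      by (apply Rmult_le_pos; [lra|apply pow2_ge_0]).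
    rewrite !Rpow_mult_distr, Hsy.
    specialize (Hg0 (S (h + m))). set (g := rate gamma b (S (h + m))) in *.
    replace (K * (y * g)) with (y * (K * g)) by ring.
    rewrite <- Rmult_plus_distr_l. mul_l.
    apply Rle_trans with (2 * K0 * g); [lra|]. mul_r. unfold K. lra.
  - intros m. unfold A. eapply Rle_trans; [apply Habs; [apply Hprod; auto; lia|apply Htl8]|].
    unfold K. lra.
  - intros m. unfold B. bound_by Rabs_triang.
    pose proof (Hprod p q (h + m)%nat ltac:(lia) (HEp _) (HEq _)).
    pose proof (Hprod q p (h + m)%nat ltac:(lia) (HEq _) (HEp _)). unfold K. lra.
  - intros m. unfold Cc. eapply Rle_trans; [apply Habs; [apply Hprod; auto; lia|apply Htl8]|].
    unfold K. lra.
  - intros m wx wy.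
    set (j := (h + m)%nat) in *. change (S h + m)%nat with (S j).
    set (u := fun n => p n * wx + q n * wy).
    assert (Hsu : solves b ap u).
    { intros i. transitivity (wx * (b (S i) * p (S (S i)) + ap (S i) * p (S i) + b i * p i)
                      + wy * (b (S i) * q (S (S i)) + ap (S i) * q (S i) + b i * q i)).
      - unfold u. ring.
      - rewrite (Hp i), (Hq i). ring. }
    pose proof (solves_step b ap u j (Hb (S j)) Hsu) as Hu.
    set (T := sqrt (gamma (S j))) in *. set (T' := sqrt (gamma (S (S j)))) in *.
    set (rho := b j / b (S j)) in *. set (d := pot b ap j) in *.
    assert (HTj : 0 < T) by apply HS.
    assert (HT2C : 2 * C <= T) by (apply HN; unfold j; lia).
    assert (HstepT : Rabs (T' - T) <= C) by apply HSstep.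
    assert (Hrj : T * Rabs (rho - 1) <= C) by apply Hratio.
    assert (Hrho : 1 / 2 <= rho <= 2).
    { assert (Rabs (rho - 1) <= 1 / 2).
      { apply Rmult_le_reg_l with T; [lra|]. lra. }
      apply Rabs_le_between in H. lra. }
    assert (HTT' : T / 2 <= T' <= 2 * T).
    { apply Rabs_le_between in HstepT. lra. }
    assert (HeMe : e j <= Me).
    { specialize (HMe j). rewrite Rabs_pos_eq in HMe by apply He. exact HMe. }
    assert (HpotT : T ^ 2 * Rabs d <= C + T * e j).
    { unfold T at 1. rewrite HSS. apply Hpot. }
    pose proof (virial_step C E T T' rho d (e j) (u (S j)) (u (S j) - u j) HC HTj (HSlow _) HTT'
      HstepT Hrho Hrj (He j) HpotT ltac:(unfold E; lra)) as Hvir.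
    fold D in Hvir. rewrite <- Hu in Hvir.
    set (g := rate gamma b (S j)).
    assert (Hgj : 0 < g) by (apply Hg0).
    assert (Hmin : g / (2 * (K0 * (C * C))) * (wx ^ 2 + wy ^ 2)
                    <= u (S j) ^ 2 + T ^ 2 * (u (S j) - u j) ^ 2).
    { pose proof (adjugate_bound (p (S j)) (q (S j)) (T * (p (S j) - p j)) (T * (q (S j) - q j))
        wx wy (K0 * g) ((T / b j) ^ 2)) as Hadj.
      replace ((T * (p (S j) - p j) * wx + T * (q (S j) - q j) * wy) ^ 2)
        with (T ^ 2 * (u (S j) - u j) ^ 2) in Hadj by (unfold u; ring).
      fold (u (S j)) in Hadj.
      assert (Hadj' : (T / b j) ^ 2 * (wx ^ 2 + wy ^ 2)
        <= 2 * (K0 * g) * (u (S j) ^ 2 + T ^ 2 * (u (S j) - u j) ^ 2)).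
      { apply Hadj.
        - rewrite Rpow_mult_distr. unfold T at 1. rewrite HSS. apply HEp.
        - rewrite Rpow_mult_distr. unfold T at 1. rewrite HSS. apply HEq.
        - replace (p (S j) * (T * (q (S j) - q j)) - q (S j) * (T * (p (S j) - p j)))
            with (T / b j * wronskian b p q j)
            by (unfold wronskian; pose proof (Hb j); field; lra).
          rewrite Rpow_mult_distr, HW. ring. }
      assert (Hgg : g / C <= T / b j).
      { unfold g. apply Rle_div_l; [lra|].
        replace (T / b j * C) with (T * (C / b j)) by (field; apply Rgt_not_eq, Hb).
        unfold Rdiv at 1. mul_l.
        pose proof (Hb j). pose proof (Hb (S j)). specialize (Hbd j).
        apply Rle_div_r; [lra|]. rewrite Rmult_comm. apply (Rle_div_l (b j) C (b (S j))); lra. }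
      assert (Hgg2 : (g / C) ^ 2 <= (T / b j) ^ 2).
      { apply pow_incr. split; [apply Rdiv_le_0_compat; lra|exact Hgg]. }
      sq_ge0 wx. sq_ge0 wy.
      assert ((g / C) ^ 2 * (wx ^ 2 + wy ^ 2) <= (T / b j) ^ 2 * (wx ^ 2 + wy ^ 2))
        by (mul_r).
      apply Rmult_le_reg_l with (2 * (K0 * g)); [nra|].
      replace (2 * (K0 * g) * (g / (2 * (K0 * (C * C))) * (wx ^ 2 + wy ^ 2)))
        with ((g / C) ^ 2 * (wx ^ 2 + wy ^ 2)) by (field; lra).
      lra. }
    assert (Hu2 : u (S j) ^ 2 <= 2 * K0 * g * (wx ^ 2 + wy ^ 2)).
    { specialize (HEp j). specialize (HEq j). fold T in HEp, HEq. fold g in HEp, HEq.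
      assert (0 <= gamma (S j) * (p (S j) - p j) ^ 2)
        by (apply Rmult_le_pos; [left; apply Hg|apply pow2_ge_0]).
      assert (0 <= gamma (S j) * (q (S j) - q j) ^ 2)
        by (apply Rmult_le_pos; [left; apply Hg|apply pow2_ge_0]).
      sq_ge0 wx. sq_ge0 wy.
      apply Rle_trans with ((p (S j) ^ 2 + q (S j) ^ 2) * (wx ^ 2 + wy ^ 2)).
      - unfold u. sq_ge0 (p (S j) * wy - q (S j) * wx). nra.
      - mul_r. }
    assert (HyTg : y * (T * g) <= 1).
    { specialize (HyS (S j) ltac:(unfold j; lia)). fold T in HyS. fold g in HyS. lra. }
    set (w2 := wx ^ 2 + wy ^ 2) in *.
    assert (Hw2 : 0 <= w2) by (unfold w2; sq_ge0 wx; sq_ge0 wy; lra).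
    assert (Herr : y * (4 * (T * e j) * u (S j) ^ 2) <= 8 * K0 * e j * w2).
    { apply Rle_trans with (y * (4 * (T * e j) * (2 * K0 * g * w2))).
      - mul_l. apply Rmult_le_compat_l; [|exact Hu2].
        specialize (He j). apply Rmult_le_pos; nra.
      - replace (y * (4 * (T * e j) * (2 * K0 * g * w2))) with (8 * K0 * e j * w2 * (y * (T * g))) by ring.
        rewrite <- (Rmult_1_r (8 * K0 * e j * w2)) at 2. apply Rmult_le_compat_l; [|exact HyTg].
        specialize (He j). apply Rmult_le_pos; [|exact Hw2]. apply Rmult_le_pos; lra. }
    assert (Hc64 : c * (y * g * w2) = y * (g / (2 * (K0 * (C * C))) * w2 / 64)).
    { unfold c. field. lra. }
    assert (Hform : forall i x0 y0, qf (A i) (B i) (Cc i) x0 y0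
       = y * (gamma (S (h + i)) * ((p (S (h + i)) * x0 + q (S (h + i)) * y0)
            * ((p (S (h + i)) * x0 + q (S (h + i)) * y0) - (p (h + i)%nat * x0 + q (h + i)%nat * y0))))
         - 8 * K0 * tail_sum e (h + i) * (x0 ^ 2 + y0 ^ 2)).
    { intros i x0 y0. unfold qf, A, B, Cc. ring. }
    rewrite !Hform. rewrite Nat.add_succ_r. fold j.
    fold (u (S (S j))) (u (S j)) (u j). fold w2.
    rewrite (tail_sum_step e j Hes).
    replace (sy * p (S j) * wx + sy * q (S j) * wy) with (sy * u (S j)) by (unfold u; ring).
    rewrite Rpow_mult_distr, Hsy.
    rewrite <- (HSS (S j)), <- (HSS (S (S j))). fold T T'.
    assert (Hvir' : y * (T ^ 2 * (u (S j) - u j) ^ 2 / 64 - D * u (S j) ^ 2 - 4 * (T * e j) * u (S j) ^ 2)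
       <= y * (T' ^ 2 * ((u (S j) + (u (S (S j)) - u (S j))) * (u (S (S j)) - u (S j)))
               - T ^ 2 * (u (S j) * (u (S j) - u j)))) by (mul_l).
    assert (Hmin' : y * (g / (2 * (K0 * (C * C))) * w2 / 64)
       <= y * ((u (S j) ^ 2 + T ^ 2 * (u (S j) - u j) ^ 2) / 64)) by (mul_l).
    assert (HKD : (D + 1) * (y * u (S j) ^ 2) <= K * (y * u (S j) ^ 2)).
    { apply Rmult_le_compat_r; [|unfold K; lra]. apply Rmult_le_pos; [lra|apply pow2_ge_0]. }
    fold g. rewrite Hc64.
    replace (u (S j) + (u (S (S j)) - u (S j))) with (u (S (S j))) in Hvir' by ring.
    assert (0 <= y * u (S j) ^ 2) by (apply Rmult_le_pos; [lra|apply pow2_ge_0]).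
    lra.
  - intros m. rewrite Nat.add_succ_r. destruct (Hcan (S h + m)%nat) as [-> _].
    unfold csol. destruct (al (S h + m)%nat), (be (S h + m)%nat). cbn. rewrite <- Hsy. ring.
  - intros m. rewrite Nat.add_succ_r. destruct (Hcan (S h + m)%nat) as [_ ->].
    unfold csol. destruct (al (S h + m)%nat), (be (S h + m)%nat). cbn. rewrite <- Hsy. ring.
  - intros m. rewrite Nat.add_succ_r. destruct (Hcan (S h + m)%nat) as [-> _].
    unfold csol. destruct (al (S h + m)%nat), (be (S h + m)%nat). cbn. rewrite <- Hsy. ring.
  - intros m. rewrite Nat.add_succ_r. destruct (Hcan (S h + m)%nat) as [_ ->].
    unfold csol. destruct (al (S h + m)%nat), (be (S h + m)%nat). cbn. rewrite <- Hsy. ring.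
  - exact HF.
Qed.

(** * Upper bounds for the canonical product *)

Lemma csol_le (p q : nat -> R) (al be : nat -> C) (n : nat) :
  Cmod (csol p q al be n) <= (Rabs (p n) + Rabs (q n)) * cnorm al be n.
Proof.
  unfold csol, cnorm. bound_by Cmod_triangle. rewrite !Cmod_RtoC_mult.
  abs_ge0 (p n). abs_ge0 (q n).
  mod_ge0 (al n). mod_ge0 (be n). nra.
Qed.

Lemma canonical_step (p q : nat -> R) (z : C) (al be : nat -> C) (n : nat) :
  canonical p q z al be ->
  cnorm al be (S n) <= (1 + Cmod z * (2 * (p n ^ 2 + q n ^ 2))) * cnorm al be n.
Proof.
  intros H. destruct (H n) as [Ha Hb]. unfold cnorm at 1. rewrite Ha, Hb.
  pose proof (Cmod_ge_0 z) as Hz.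
  pose proof (csol_le p q al be n) as Hs. pose proof (cnorm_nonneg al be n) as Hc.
  abs_ge0 (p n). abs_ge0 (q n).
  pose proof (sum_abs_sq (p n) (q n)) as Hsq.
  assert (G1 : Cmod (al n - z * (q n * csol p q al be n))%C
               <= Cmod (al n) + Cmod z * (Rabs (q n) * Cmod (csol p q al be n))).
  { unfold Cminus. bound_by Cmod_triangle.
    rewrite Cmod_opp, Cmod_mult, Cmod_RtoC_mult. lra. }
  assert (G2 : Cmod (be n + z * (p n * csol p q al be n))%C
               <= Cmod (be n) + Cmod z * (Rabs (p n) * Cmod (csol p q al be n))).
  { bound_by Cmod_triangle. rewrite Cmod_mult, Cmod_RtoC_mult. lra. }
  set (s := Cmod (csol p q al be n)) in *. set (V := Rabs (p n) + Rabs (q n)) in *.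
  assert (G3 : V * s <= V ^ 2 * cnorm al be n).
  { assert (V * s <= V * (V * cnorm al be n)) by (apply Rmult_le_compat_l; [unfold V; lra|exact Hs]). lra. }
  assert (G4 : V ^ 2 * cnorm al be n <= 2 * (p n ^ 2 + q n ^ 2) * cnorm al be n)
    by (mul_r).
  assert (G5 : Cmod z * (V * s) <= Cmod z * (2 * (p n ^ 2 + q n ^ 2) * cnorm al be n))
    by (mul_l).
  unfold V in G5 at 1. unfold cnorm in *. lra.
Qed.

Lemma canonical_tail (p q g : nat -> R) (K : R) (z : C) (al be : nat -> C) :
  canonical p q z al be -> (forall n, p n ^ 2 + q n ^ 2 <= K * g n) ->
  forall m n, cnorm al be (m + n)
    <= cnorm al be m * exp (Cmod z * (2 * K) * psum (fun k => g (m + k)%nat) n).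
Proof.
  intros H Hg m n. rewrite <- psum_scal.
  assert (Hgr := gronwall (fun k => cnorm al be (m + k)) (fun k => Cmod z * (2 * K) * g (m + k)%nat)).
  cbv beta in Hgr. rewrite Nat.add_0_r in Hgr. apply Hgr.
    intros k. rewrite Nat.add_succ_r.
    eapply Rle_trans; [apply (canonical_step p q z), H|].
    eapply Rle_trans; [|apply exp_factor, cnorm_nonneg].
    apply Rmult_le_compat_r; [apply cnorm_nonneg|].
    mod_ge0 z.
    assert (Cmod z * (2 * (p (m + k)%nat ^ 2 + q (m + k)%nat ^ 2)) <= Cmod z * (2 * (K * g (m + k)%nat))).
    { mul_l. specialize (Hg (m + k)%nat). lra. }
    lra.
Qed.

Lemma canonical_bounded (p q g : nat -> R) (K : R) (z : C) (al be : nat -> C) :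
  canonical p q z al be -> 0 <= K -> (forall n, 0 <= g n) -> ex_series g ->
  (forall n, p n ^ 2 + q n ^ 2 <= K * g n) ->
  forall n, cnorm al be n <= cnorm al be 0 * exp (Cmod z * (2 * K) * Series g).
Proof.
  intros H HK Hg0 Hgs Hg n.
  pose proof (canonical_tail p q g K z al be H Hg 0 n) as Ht. simpl in Ht.
  eapply Rle_trans; [exact Ht|]. apply Rmult_le_compat_l; [apply cnorm_nonneg|].
  apply exp_le. apply Rmult_le_compat_l.
  - mod_ge0 z. nra.
  - exact (psum_le_Series g n Hg0 Hgs).
Qed.

(** Quasi-derivative of [csol]. It uses the coefficients at [n + 1]; those at [n]
    would give the same value of [csol] at [n], by the choice of the system. *)
Definition cquasi (b p q : nat -> R) (al be : nat -> C) (n : nat) : C :=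
  (b n * ((p (S n) - p n)%R * al (S n) + (q (S n) - q n)%R * be (S n)))%C.

Lemma csol_next_coef (p q : nat -> R) (z : C) (al be : nat -> C) (n : nat) :
  canonical p q z al be -> csol p q al be n = (p n * al (S n) + q n * be (S n))%C.
Proof. intros H. destruct (H n) as [Ha Hb]. rewrite Ha, Hb. unfold csol. ring. Qed.

Lemma csol_step (b p q : nat -> R) (z : C) (al be : nat -> C) (n : nat) :
  canonical p q z al be -> 0 < b n ->
  csol p q al be (S n) = (csol p q al be n + cquasi b p q al be n / b n)%C.
Proof.
  intros H Hb. rewrite (csol_next_coef p q z al be n H). unfold csol, cquasi.
  rewrite !RtoC_minus. field. intros E. apply RtoC_inj in E. lra.
Qed.

Lemma cquasi_step (b ap p q : nat -> R) (z : C) (al be : nat -> C) (n : nat) :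
  canonical p q z al be -> (forall n, 0 < b n) -> solves b ap p -> solves b ap q ->
  cquasi b p q al be (S n)
  = (cquasi b p q al be n
     + (wronskian b p q (S n) * z
        - (b (S n) * pot b ap n)%R) * csol p q al be (S n))%C.
Proof.
  intros H Hb Hp Hq. destruct (H (S n)) as [Ha Hb'].
  unfold cquasi. rewrite Ha, Hb'.
  assert (Hd : forall u, solves b ap u ->
    b (S n) * (u (S (S n)) - u (S n)) = b n * (u (S n) - u n) - b (S n) * pot b ap n * u (S n)).
  { intros u Hu. rewrite (solves_step b ap u n (Hb (S n)) Hu). pose proof (Hb (S n)). field. lra. }
  set (d := b (S n) * pot b ap n) in *.
  pose proof (Hd p Hp) as Dp. pose proof (Hd q Hq) as Dq.
  set (s := csol p q al be (S n)).
  assert (Hs : s = (p (S n) * al (S n) + q (S n) * be (S n))%C) by reflexivity.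
  assert (HWr : (wronskian b p q (S n) : C)
    = (- (b (S n) * (p (S (S n)) - p (S n)) * q (S n))%R
       + (b (S n) * (q (S (S n)) - q (S n)) * p (S n))%R)%C).
  { rewrite <- RtoC_opp, <- RtoC_plus. f_equal. unfold wronskian. ring. }
  rewrite HWr, Dp, Dq.
  transitivity (((b (S n) * (p (S (S n)) - p (S n)))%R * al (S n)
                 + (b (S n) * (q (S (S n)) - q (S n)))%R * be (S n))
      + z * (- ((b (S n) * (p (S (S n)) - p (S n)))%R * q (S n)) * s
             + (b (S n) * (q (S (S n)) - q (S n)))%R * p (S n) * s))%C.
  - rewrite !RtoC_mult. ring.
  - rewrite Dp, Dq, Hs. rewrite !RtoC_mult, !RtoC_minus, !RtoC_mult, !RtoC_minus. ring.
Qed.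

Lemma sqrt_le_1p_dist (x : R) : 0 <= x -> sqrt x <= 1 + Rabs (x - 1).
Proof.
  intros Hx. destruct (Rle_lt_dec x 1) as [H|H].
  - abs_ge0 (x - 1).
    assert (sqrt x <= sqrt 1) by (apply sqrt_le_1_alt; exact H). rewrite sqrt_1 in *. lra.
  - rewrite Rabs_pos_eq by lra.
 pose proof (sqrt_sqrt x Hx). nra.
Qed.

(** Below [h] the spectral parameter dominates: [1 / gamma n] is at most a
    constant times [r / b n], so the quasi-derivative is measured on the scale
    [sqrt (r * b n)] and each step costs a factor [1 + O (sqrt (r / b n) + e n)]. *)
Lemma canonical_head_step (gamma b ap : nat -> R) (C : R) (e p q : nat -> R) (C1 rt : R) (z : Complex.C)
    (al be : nat -> Complex.C) (n : nat) :
  tame gamma b ap C e -> solves b ap p -> solves b ap q ->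
  (forall n, wronskian b p q n ^ 2 = 1) -> canonical p q z al be ->
  0 < rt -> Cmod z = rt ^ 2 -> 1 <= C1 ->
  sqrt (b (S n)) <= C1 * (rt * sqrt (gamma (S n))) ->
  let N n := Cmod (csol p q al be n) + Cmod (cquasi b p q al be n) / (rt * sqrt (b n)) in
  let th := (2 * C * C1 ^ 2) * (rt / sqrt (b n) + rt / sqrt (b (S n)) + e n) in
  N (S n) <= exp (2 * th) * N n.
Proof.
  intros Ht Hp Hq HW Hcan HR Hz HC1 HbS N th.
  destruct Ht as [HC Hg Hb Hbu Hbd HSlow HSstep Hratio He Hes Hpot _].
  pose proof (sqrt_lt_R0 _ (Hb n)) as HB. pose proof (sqrt_lt_R0 _ (Hb (S n))) as HB'.
  pose proof (sqrt_lt_R0 _ (Hg (S n))) as HSp.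
  pose proof (sqrt_sqrt _ (Rlt_le _ _ (Hb n))) as HBB.
  pose proof (sqrt_sqrt _ (Rlt_le _ _ (Hb (S n)))) as HBB'.
  pose proof (sqrt_sqrt _ (Rlt_le _ _ (Hg (S n)))) as HSS.
  specialize (He n). specialize (Hratio n). specialize (Hpot n).
  set (B := sqrt (b n)) in *. set (B' := sqrt (b (S n))) in *. set (T := sqrt (gamma (S n))) in *.
  set (x := rt / B). set (x' := rt / B').
  assert (Hx : 0 < x) by (apply Rdiv_lt_0_compat; lra).
  assert (Hx' : 0 < x') by (apply Rdiv_lt_0_compat; lra).
  assert (HC12 : 1 <= C1 ^ 2) by nra.
  assert (HCC : C1 <= C * C1 ^ 2) by nra.
  assert (HCC2 : C1 ^ 2 <= C * C1 ^ 2) by nra.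
  assert (HiT : 1 / T <= C1 * x').
  { unfold x'. apply Rle_div_l; [lra|].
    replace (C1 * (rt / B') * T) with (C1 * (rt * T) / B') by (field; lra).
    apply Rle_div_r; lra. }
  assert (HthE : th = 2 * (C * C1 ^ 2) * (x + x' + e n)) by (unfold th, x, x'; ring).
  assert (Hth0 : 0 <= th).
  { rewrite HthE. apply Rmult_le_pos; nra. }
  assert (Hth1 : x <= th).
  { rewrite HthE.
    assert (1 * (x + x' + e n) <= C * C1 ^ 2 * (x + x' + e n)) by (mul_r). lra. }
  set (rho := b n / b (S n)) in *.
  set (d := pot b ap n) in *.
  assert (Hrho : B / B' <= 1 + th).
  { assert (Hsr : B / B' = sqrt rho) by (symmetry; apply sqrt_div_alt, Hb).
    rewrite Hsr. bound_by sqrt_le_1p_dist.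
    - apply Rdiv_le_0_compat; [left|]; apply Hb.
    - apply Rplus_le_compat_l.
      assert (H1 : Rabs (rho - 1) <= C * (1 / T)).
      { replace (C * (1 / T)) with (C / T) by (field; lra). apply Rle_div_r; lra. }
      rewrite HthE.
      assert (C * (C1 * x') <= C * C1 ^ 2 * x').
      { replace (C * (C1 * x')) with (C * C1 * x') by ring. apply Rmult_le_compat_r; nra. }
 nra. }
  assert (Hcoef : (rt ^ 2 + b (S n) * Rabs d) / (rt * B') <= th).
  { assert (H1 : b (S n) * Rabs d / (rt * B') <= C1 * (C * (C1 * x') + e n)).
    { assert (H2 : Rabs d <= (C + T * e n) / (T * T)) by (apply Rle_div_r; [nra|]; rewrite HSS; lra).
      apply Rle_trans with (b (S n) * ((C + T * e n) / (T * T)) / (rt * B')).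
      - unfold Rdiv at 1 3. apply Rmult_le_compat_r.
        + left. apply Rinv_0_lt_compat. nra.
        + apply Rmult_le_compat_l; [left; apply Hb|exact H2].
      - rewrite <- HBB'.
        replace (B' * B' * ((C + T * e n) / (T * T)) / (rt * B'))
          with (B' / (rt * T) * (C * (1 / T) + e n)) by (field; lra).
        assert (B' / (rt * T) <= C1) by (apply Rle_div_l; nra).
        assert (0 <= 1 / T) by (apply Rdiv_le_0_compat; lra).
        assert (0 <= B' / (rt * T)) by (apply Rdiv_le_0_compat; nra).
        apply Rmult_le_compat; [lra|nra|lra|]. nra. }
    replace ((rt ^ 2 + b (S n) * Rabs d) / (rt * B')) with (x' + b (S n) * Rabs d / (rt * B'))
      by (unfold x'; field; lra).
    rewrite HthE.
 nra. }
  pose proof (csol_step b p q z al be n Hcan (Hb n)) as Hs.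
  pose proof (cquasi_step b ap p q z al be n Hcan Hb Hp Hq) as Hqs. fold rho d in Hqs.
  assert (Hs' : Cmod (csol p q al be (S n))
                <= Cmod (csol p q al be n) + x * (Cmod (cquasi b p q al be n) / (rt * B))).
  { rewrite Hs. bound_by Cmod_triangle.
    rewrite Cmod_div by (intros E; apply RtoC_inj in E; pose proof (Hb n); lra).
    rewrite Cmod_R, Rabs_pos_eq by (left; apply Hb). rewrite <- HBB.
    right. unfold x. field. lra. }
  assert (HWa : Rabs (wronskian b p q (S n)) = 1).
  { pose proof (pow2_abs (wronskian b p q (S n))) as H1. rewrite HW in H1.
    abs_ge0 (wronskian b p q (S n)). nra. }
  assert (Hq' : Cmod (cquasi b p q al be (S n))
     <= Cmod (cquasi b p q al be n) + (rt ^ 2 + b (S n) * Rabs d) * Cmod (csol p q al be (S n))).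
  { rewrite Hqs. bound_by Cmod_triangle. apply Rplus_le_compat_l.
    rewrite Cmod_mult. apply Rmult_le_compat_r; [apply Cmod_ge_0|].
    unfold Cminus. bound_by Cmod_triangle.
    rewrite Cmod_RtoC_mult, Cmod_opp, Cmod_R, HWa, Hz, Rabs_mult, (Rabs_pos_eq (b _)) by (left; apply Hb).
    lra. }
  unfold N. fold B B'.
  set (us := Cmod (csol p q al be (S n))) in *. set (u := Cmod (csol p q al be n)) in *.
  set (ys := Cmod (cquasi b p q al be (S n))) in *. set (y := Cmod (cquasi b p q al be n)) in *.
  assert (Hu0 : 0 <= u) by apply Cmod_ge_0. assert (Hy0 : 0 <= y) by apply Cmod_ge_0.
  assert (Hus0 : 0 <= us) by apply Cmod_ge_0.
  set (Y := y / (rt * B)) in *.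
  assert (HY0 : 0 <= Y) by (apply Rdiv_le_0_compat; nra).
  assert (Hys : ys / (rt * B') <= (1 + th) * Y + th * us).
  { apply Rle_trans with ((y + (rt ^ 2 + b (S n) * Rabs d) * us) / (rt * B')).
    - unfold Rdiv. apply Rmult_le_compat_r; [|exact Hq']. left. apply Rinv_0_lt_compat. nra.
    - replace ((y + (rt ^ 2 + b (S n) * Rabs d) * us) / (rt * B'))
        with (B / B' * Y + (rt ^ 2 + b (S n) * Rabs d) / (rt * B') * us) by (unfold Y; field; lra).
      apply Rplus_le_compat; mul_r. }
  apply Rle_trans with ((1 + th) * ((1 + th) * (u + Y))).
  - assert (x * Y <= th * Y) by (mul_r).
    assert (0 <= th * u) by (apply Rmult_le_pos; lra).
 nra.
  - rewrite <- Rmult_assoc. mul_r.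
    replace (2 * th) with (th + th) by ring. rewrite exp_plus.
    pose proof (exp_ge_1p th). apply Rmult_le_compat; lra.
Qed.

(** Cramer's rule; the determinant is the Wronskian. *)
Lemma cnorm_of_csol (b p q : nat -> R) (V : R) (z : C) (al be : nat -> C) (n : nat) :
  canonical p q z al be -> (forall n, 0 < b n) -> (forall n, wronskian b p q n ^ 2 = 1) ->
  (forall n, Rabs (p n) <= V /\ Rabs (q n) <= V) ->
  cnorm al be (S n)
  <= 2 * V * (2 * (b n * Cmod (csol p q al be n)) + Cmod (cquasi b p q al be n)).
Proof.
  intros Hcan Hb HW HV.
  set (u := csol p q al be n). set (Y := cquasi b p q al be n).
  assert (Hu : u = (p n * al (S n) + q n * be (S n))%C) by exact (csol_next_coef p q z al be n Hcan).
  assert (Hal : (wronskian b p q n * al (S n))%C = (b n * (q (S n) - q n)%R * u - q n * Y)%C).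
  { rewrite Hu. unfold Y, cquasi, wronskian. rewrite !RtoC_mult, !RtoC_minus, !RtoC_mult. ring. }
  assert (Hbe : (wronskian b p q n * be (S n))%C = (p n * Y - b n * (p (S n) - p n)%R * u)%C).
  { rewrite Hu. unfold Y, cquasi, wronskian. rewrite !RtoC_mult, !RtoC_minus, !RtoC_mult. ring. }
  assert (HWa : Rabs (wronskian b p q n) = 1).
  { pose proof (pow2_abs (wronskian b p q n)) as H1. rewrite HW in H1.
    abs_ge0 (wronskian b p q n). nra. }
  destruct (HV n) as [Hpn Hqn]. destruct (HV (S n)) as [HpS HqS].
  assert (Hbn : Rabs (b n) = b n) by (apply Rabs_pos_eq; left; apply Hb).
  pose proof (Hb n) as Hb0. pose proof (Cmod_ge_0 u) as Hu0. pose proof (Cmod_ge_0 Y) as HY0.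
  assert (Hdp : Rabs (p (S n) - p n) <= 2 * V).
  { bound_by Rabs_triang. rewrite Rabs_Ropp. lra. }
  assert (Hdq : Rabs (q (S n) - q n) <= 2 * V).
  { bound_by Rabs_triang. rewrite Rabs_Ropp. lra. }
  assert (Hbu : 0 <= b n * Cmod u) by (apply Rmult_le_pos; lra).
  unfold cnorm.
  assert (H1 : Cmod (al (S n)) <= 2 * V * (b n * Cmod u) + V * Cmod Y).
  { rewrite <- (Rmult_1_l (Cmod _)), <- HWa, <- Cmod_RtoC_mult, Hal.
    unfold Cminus. bound_by Cmod_triangle.
    rewrite Cmod_opp, !Cmod_mult, !Cmod_R, Hbn.
    apply Rplus_le_compat; [|mul_r].
    replace (b n * Rabs (q (S n) - q n) * Cmod u) with (Rabs (q (S n) - q n) * (b n * Cmod u)) by ring.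
    mul_r. }
  assert (H2 : Cmod (be (S n)) <= V * Cmod Y + 2 * V * (b n * Cmod u)).
  { rewrite <- (Rmult_1_l (Cmod _)), <- HWa, <- Cmod_RtoC_mult, Hbe.
    unfold Cminus. bound_by Cmod_triangle.
    rewrite Cmod_opp, !Cmod_mult, !Cmod_R, Hbn.
    apply Rplus_le_compat; [mul_r|].
    replace (b n * Rabs (p (S n) - p n) * Cmod u) with (Rabs (p (S n) - p n) * (b n * Cmod u)) by ring.
    mul_r. }
  lra.
Qed.

(** The factor [b h ^ 2] collects the cost of passing from coefficients to the
    solution at [0] and back at [h]; [b_growth] shows that it is harmless. *)
Lemma canonical_head (gamma b ap : nat -> R) (K : R) (e p q : nat -> R) (V C1 : R) :
  tame gamma b ap K e -> solves b ap p -> solves b ap q ->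
  (forall n, wronskian b p q n ^ 2 = 1) ->
  (forall n, Rabs (p n) <= V /\ Rabs (q n) <= V) -> 1 <= C1 ->
  exists K2, 0 < K2 /\ forall h r z al be,
    1 <= r -> Cmod z = r -> canonical p q z al be -> cnorm al be 0 <= 1 ->
    (forall n, (n <= h)%nat -> sqrt (b n) <= C1 * (sqrt r * sqrt (gamma n))) ->
    r <= C1 * b h ->
    cnorm al be (S h) <= K2 * b h ^ 2 * exp (K2 * (sqrt r * psum (fun k => / sqrt (b k)) (S h))).
Proof.
  intros Ht Hp Hq HW HV HC1.
  assert (Ht' := Ht). destruct Ht' as [HC _ Hb _ _ _ _ _ He Hes _ _].
  assert (HV0 : 0 <= V) by (destruct (HV O) as [H _]; abs_ge0 (p O); lra).
  set (Kt := 2 * K * C1 ^ 2).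
  assert (HKt : 0 < Kt) by (unfold Kt; apply Rmult_lt_0_compat; nra).
  set (Es := Series e).
  assert (HEs : 0 <= Es) by exact (psum_le_Series e 0 He Hes).
  assert (HB0 : 0 < sqrt (b O)) by apply sqrt_lt_R0, Hb.
  set (M0 := 2 * V + 2 * V * b O * (1 + 4 * V ^ 2) / sqrt (b O)).
  assert (HM0 : 0 <= M0).
  { unfold M0. apply Rplus_le_le_0_compat; [lra|]. apply Rdiv_le_0_compat; [|lra].
    apply Rmult_le_pos; [apply Rmult_le_pos; [lra|left; apply Hb]|]. sq_ge0 V. lra. }
  set (K3 := 2 * V * (2 + C1) * (M0 * C1) * exp (2 * Kt * Es)).
  assert (HK3 : 0 <= K3).
  { unfold K3. apply Rmult_le_pos; [|left; apply exp_pos]. apply Rmult_le_pos; nra. }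
  exists (K3 + 4 * Kt + 1). split; [lra|].
  intros h r z al be Hr Hz Hcan H0 Hbn Hrb.
  set (rt := sqrt r).
  assert (Hrt1 : 1 <= rt) by (unfold rt; rewrite <- sqrt_1; apply sqrt_le_1_alt; lra).
  assert (Hrt2 : rt ^ 2 = r) by (apply pow2_sqrt; lra).
  set (th := fun n => Kt * (rt / sqrt (b n) + rt / sqrt (b (S n)) + e n)).
  set (N := fun n => Cmod (csol p q al be n) + Cmod (cquasi b p q al be n) / (rt * sqrt (b n))).
  assert (HB : forall n, 0 < sqrt (b n)) by (intros; apply sqrt_lt_R0, Hb).
  assert (HN : forall n, (n <= h)%nat -> N n <= N O * exp (2 * psum th n)).
  { induction n as [|n IH]; intros Hn.
    - simpl. rewrite Rmult_0_r, exp_0. lra.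
    - pose proof (canonical_head_step gamma b ap K e p q C1 rt z al be n Ht Hp Hq HW Hcan
        ltac:(lra) ltac:(lra) HC1 (Hbn (S n) Hn)) as Hst. cbv zeta beta in Hst.
      fold (N (S n)) (N n) in Hst. fold Kt in Hst. fold (th n) in Hst.
      eapply Rle_trans; [exact Hst|]. simpl psum. rewrite Rmult_plus_distr_l, exp_plus.
      specialize (IH ltac:(lia)). pose proof (exp_pos (2 * th n)).
      rewrite (Rmult_comm (exp (2 * psum th n))), <- Rmult_assoc, (Rmult_comm (N O)), Rmult_assoc.
      mul_l. }
  set (Sg := psum (fun k => / sqrt (b k)) (S h)).
  assert (Hinv : forall n, 0 <= / sqrt (b n)) by (intros; left; apply Rinv_0_lt_compat, HB).
  assert (Hth : psum th h <= Kt * (2 * (rt * Sg) + Es)).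
  { unfold th. rewrite psum_scal. mul_l.
    rewrite !psum_plus.
    assert (H1 : psum (fun k => rt / sqrt (b k)) h <= rt * Sg).
    { unfold Rdiv. rewrite psum_scal. mul_l.
      apply psum_mono; [exact Hinv|lia]. }
    assert (H2 : psum (fun k => rt / sqrt (b (S k))) h <= rt * Sg).
    { unfold Rdiv. rewrite (psum_scal rt (fun k => / sqrt (b (S k)))). mul_l.
      unfold Sg. change (S h) with (1 + h)%nat. rewrite psum_split. simpl (psum _ 1).
      specialize (Hinv O). change (fun k => / sqrt (b (1 + k)%nat)) with (fun k => / sqrt (b (S k))).
      lra. }
    pose proof (psum_le_Series e h He Hes) as H3. fold Es in H3. lra. }
  assert (HN0 : N O <= M0 * r).
  { unfold N.
    destruct (HV O) as [Hp0 Hq0]. destruct (HV 1%nat) as [Hp1 Hq1].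
    pose proof (cnorm_nonneg al be 0). abs_ge0 (p O). abs_ge0 (q O).
    assert (Hu : Cmod (csol p q al be 0) <= 2 * V).
    { bound_by csol_le. nra. }
    assert (Hc1 : cnorm al be 1 <= (1 + 4 * V ^ 2) * r).
    { eapply Rle_trans; [apply (canonical_step p q z), Hcan|]. rewrite Hz.
      assert (p O ^ 2 <= V ^ 2) by (rewrite <- pow2_abs; apply pow_incr; lra).
      assert (q O ^ 2 <= V ^ 2) by (rewrite <- pow2_abs; apply pow_incr; lra).
      apply Rle_trans with ((1 + r * (2 * (p O ^ 2 + q O ^ 2))) * 1).
      - apply Rmult_le_compat_l; [|exact H0]. nra.
      - nra. }
    assert (HY : Cmod (cquasi b p q al be 0) <= b O * (2 * V * ((1 + 4 * V ^ 2) * r))).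
    { unfold cquasi. rewrite Cmod_RtoC_mult, Rabs_pos_eq by (left; apply Hb).
      apply Rmult_le_compat_l; [left; apply Hb|].
      bound_by Cmod_triangle. rewrite !Cmod_RtoC_mult.
      assert (Hdp : Rabs (p 1%nat - p O) <= 2 * V).
      { bound_by Rabs_triang. rewrite Rabs_Ropp. lra. }
      assert (Hdq : Rabs (q 1%nat - q O) <= 2 * V).
      { bound_by Rabs_triang. rewrite Rabs_Ropp. lra. }
      apply Rle_trans with (2 * V * cnorm al be 1).
      - unfold cnorm. rewrite Rmult_plus_distr_l.
        apply Rplus_le_compat; apply Rmult_le_compat_r; auto using Cmod_ge_0.
      - mul_l. }
    assert (HY2 : Cmod (cquasi b p q al be 0) / (rt * sqrt (b O))
       <= 2 * V * b O * (1 + 4 * V ^ 2) / sqrt (b O) * r).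
    { apply Rle_trans with (Cmod (cquasi b p q al be 0) / sqrt (b O)).
      - unfold Rdiv. apply Rmult_le_compat_l; [apply Cmod_ge_0|]. apply Rinv_le_contravar; [lra|].
        rewrite <- (Rmult_1_l (sqrt (b O))) at 1. mul_r.
      - replace (2 * V * b O * (1 + 4 * V ^ 2) / sqrt (b O) * r)
          with (b O * (2 * V * ((1 + 4 * V ^ 2) * r)) / sqrt (b O)) by (field; lra).
        unfold Rdiv. apply Rmult_le_compat_r; [apply Hinv|exact HY]. }
    unfold M0. rewrite Rmult_plus_distr_r.
    assert (2 * V * 1 <= 2 * V * r) by (mul_l). lra. }
  pose proof (cnorm_of_csol b p q V z al be h Hcan Hb HW HV) as Hend.
  assert (HBh := HB h). pose proof (Hb h) as Hbh.
  assert (HrtB : rt * sqrt (b h) <= C1 * b h).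
  { unfold rt. rewrite <- sqrt_mult_alt by lra.
    apply Rle_trans with (sqrt ((C1 * b h) ^ 2)).
    - apply sqrt_le_1_alt.
      assert (r * b h <= C1 * b h * b h) by (mul_r).
      assert (1 * (C1 * b h * b h) <= C1 * (C1 * b h * b h)).
      { apply Rmult_le_compat_r; [|lra]. apply Rmult_le_pos; nra. }
      lra.
    - rewrite sqrt_pow2 by nra. lra. }
  assert (HNh : 2 * (b h * Cmod (csol p q al be h)) + Cmod (cquasi b p q al be h)
                <= (2 + C1) * b h * N h).
  { unfold N. pose proof (Cmod_ge_0 (csol p q al be h)) as Hu0.
    pose proof (Cmod_ge_0 (cquasi b p q al be h)) as HY0.
    set (u := Cmod (csol p q al be h)) in *. set (Y := Cmod (cquasi b p q al be h)) in *.
    assert (HYe : Y = rt * sqrt (b h) * (Y / (rt * sqrt (b h)))) by (field; lra).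
    assert (HYp : 0 <= Y / (rt * sqrt (b h))) by (apply Rdiv_le_0_compat; nra).
    assert (Y <= C1 * b h * (Y / (rt * sqrt (b h)))).
    { rewrite HYe at 1. mul_r. }
    nra. }
  specialize (HN h (le_n h)).
  assert (Hexp : exp (2 * psum th h) <= exp (2 * Kt * Es) * exp (4 * Kt * (rt * Sg))).
  { rewrite <- exp_plus. apply exp_le. lra. }
  assert (HSg : 0 <= rt * Sg) by (apply Rmult_le_pos; [lra|apply psum_nonneg, Hinv]).
  assert (HNh2 : N h <= M0 * (C1 * b h) * (exp (2 * Kt * Es) * exp (4 * Kt * (rt * Sg)))).
  { apply Rle_trans with (M0 * (C1 * b h) * exp (2 * psum th h)).
    - eapply Rle_trans; [exact HN|]. apply Rmult_le_compat_r; [left; apply exp_pos|].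
      eapply Rle_trans; [exact HN0|]. mul_l.
    - apply Rmult_le_compat_l; [|exact Hexp]. apply Rmult_le_pos; nra. }
  apply Rle_trans with (K3 * b h ^ 2 * exp (4 * Kt * (rt * Sg))).
  - apply Rle_trans with (2 * V * ((2 + C1) * b h * N h)).
    + eapply Rle_trans; [exact Hend|]. mul_l.
    + apply Rle_trans with (2 * V * ((2 + C1) * b h *
         (M0 * (C1 * b h) * (exp (2 * Kt * Es) * exp (4 * Kt * (rt * Sg)))))).
      * mul_l. apply Rmult_le_compat_l; [nra|exact HNh2].
      * right. unfold K3. ring.
  - sq_ge0 (b h). pose proof (exp_pos (4 * Kt * (rt * Sg))).
    apply Rmult_le_compat.
    + apply Rmult_le_pos; lra.
    + lra.
    + mul_r.
    + apply exp_le. mul_r.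
Qed.

(** So [ln (b h)] is of the order of [h / sqrt (gamma h)], by [cmp_psum_gamma]. *)
Lemma b_growth (gamma b ap : nat -> R) (K : R) (e : nat -> R) :
  tame gamma b ap K e ->
  forall h, b h <= b O * exp (K ^ 2 * psum (fun k => / sqrt (gamma k)) (S h)).
Proof.
  intros [HC Hg Hb Hbu _ _ _ Hratio _ _ _ _] h.
  assert (HS : forall n, 0 < sqrt (gamma n)) by (intros; apply sqrt_lt_R0, Hg).
  assert (Hgr := gronwall b (fun k => K ^ 2 * / sqrt (gamma (S k)))).
  bound_by Hgr.
  - intros n. eapply Rle_trans; [|apply exp_factor; left; apply Hb].
 pose proof (Hb (S n)). pose proof (HS (S n)).
    specialize (Hratio n). specialize (Hbu n).
    assert (G1 : Rabs (b n / b (S n) - 1) <= K * / sqrt (gamma (S n))).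
    { apply (Rle_div_r _ K (sqrt (gamma (S n)))); lra. }
    assert (G2 : b (S n) - b n <= b (S n) * Rabs (b n / b (S n) - 1)).
    { replace (b (S n) - b n) with (b (S n) * (- (b n / b (S n) - 1))) by (field; lra).
      mul_l. rewrite <- Rabs_Ropp. apply Rle_abs. }
    assert (G3 : b (S n) * Rabs (b n / b (S n) - 1) <= K * b n * (K * / sqrt (gamma (S n)))).
    { apply Rmult_le_compat; auto using Rabs_pos; lra. }
    lra.
  - apply Rmult_le_compat_l; [left; apply Hb|]. apply exp_le. rewrite psum_scal.
    apply Rmult_le_compat_l; [nra|].
    change (S h) with (1 + h)%nat. rewrite psum_split. simpl (psum _ 1).
    assert (0 < / sqrt (gamma O)) by apply Rinv_0_lt_compat, HS.
    change (fun k => / sqrt (gamma (1 + k)%nat)) with (fun k => / sqrt (gamma (S k))). lra.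
Qed.

(** * The threshold index and the comparison function *)

Lemma max_nat_spec (P : nat -> Prop) (k M : nat) :
  P k -> (forall n, P n -> (n < M)%nat) -> is_max_nat P (max_nat P).
Proof.
  intros Hk HM. unfold max_nat. apply epsilon_spec.
  revert HM. induction M as [|M IH]; intros HM.
  - specialize (HM k Hk). lia.
  - destruct (classic (P M)) as [H|H].
    + exists M. split; [exact H|]. intros m Hm. specialize (HM m Hm). lia.
    + apply IH. intros n Hn. specialize (HM n Hn).
      destruct (Nat.eq_dec n M) as [->|]; [contradiction|lia].
Qed.

Lemma h_index_spec (gamma b : nat -> R) :
  is_lim_seq (fun n => b n / gamma n) p_infty ->
  forall N, exists r0, forall r, r0 <= r ->
    (N <= h_index gamma b r)%nat /\
    b (h_index gamma b r) / gamma (h_index gamma b r) < r /\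
    forall n, (h_index gamma b r < n)%nat -> r <= b n / gamma n.
Proof.
  intros Hl N. apply is_lim_seq_spec in Hl.
  exists (b N / gamma N + 1). intros r Hr.
  destruct (Hl r) as [M HM].
  destruct (max_nat_spec (fun n => b n / gamma n < r) N M) as [H1 H2].
  - lra.
  - intros n Hn. destruct (le_lt_dec M n) as [H|H]; [|exact H].
    specialize (HM n H). simpl in HM. lra.
  - unfold h_index. split; [apply H2; lra|]. split; [exact H1|].
    intros n Hn. apply Rnot_lt_le. intros H. specialize (H2 n H). lia.
Qed.

Lemma Rpower_2_lt_4 (a : R) : a < 2 -> Rpower 2 a < 4.
Proof.
  intros H. replace 4 with (Rpower 2 (INR 2)).
  - apply Rpower_lt; simpl; lra.
  - rewrite Rpower_pow by lra. ring.
Qed.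

Record comparison (gamma b : nat -> R) (C : R) (N : nat) : Prop := {
  cmp_C : 1 <= C;
  cmp_N : (1 <= N)%nat;
  cmp_ratio : forall k h, (k <= h)%nat -> (N <= h)%nat ->
    b k / gamma k <= C * (b h / gamma h);
  cmp_psum_b : forall h, (N <= h)%nat ->
    psum (fun k => / sqrt (b k)) (S h) <= C * (INR h * / sqrt (b h));
  cmp_psum_gamma : forall h, (N <= h)%nat ->
    psum (fun k => / sqrt (gamma k)) (S h) <= C * (INR h * / sqrt (gamma h));
  cmp_tail : forall h, (N <= h)%nat ->
    INR h * rate gamma b h <= C * tail_sum (rate gamma b) h
}.

(** Summability of [sqrt (gamma n) / b n] forces the index of [b] to be at least
    [1 + beta / 2], where [beta < 2] is that of [gamma]; hence [b n / gamma n] has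
    a positive index. *)
Lemma comparison_holds (gamma b : nat -> R) (alpha beta : R) :
  (forall n, 0 < gamma n) -> (forall n, 0 < b n) ->
  ex_series (rate gamma b) ->
  alpha < 2 -> regularly_varying b alpha ->
  beta < 2 -> regularly_varying gamma beta ->
  is_lim_seq (fun n => b n / gamma n) p_infty /\ exists C N, comparison gamma b C N.
Proof.
  intros Hg Hb Hsum Ha Hba Hbe Hgb.
  pose proof (dyadic_rv b alpha Hb Hba) as Db. pose proof (dyadic_rv gamma beta Hg Hgb) as Dg.
  pose proof (Rpower_2_lt_4 alpha Ha) as Ha4. pose proof (Rpower_2_lt_4 beta Hbe) as Hb4.
  set (tb := Rpower 2 alpha) in *. set (tg := Rpower 2 beta) in *.
  assert (Htb : 0 < tb) by apply exp_pos. assert (Htg : 0 < tg) by apply exp_pos.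
  pose proof (dyadic_div _ _ _ _ (dyadic_sqrt _ _ Dg) Db) as Dgrow.
  pose proof (dyadic_div _ _ _ _ Db Dg) as Dratio.
  pose proof (dyadic_inv _ _ (dyadic_sqrt _ _ Db)) as Dbi.
  pose proof (dyadic_inv _ _ (dyadic_sqrt _ _ Dg)) as Dgi.
  pose proof (dyadic_summable _ _ Dgrow Hsum) as Hth.
  assert (Hsq : forall t, 0 < t -> t < 4 -> 0 < sqrt t < 2).
  { intros t H1 H2. split; [apply sqrt_lt_R0, H1|]. replace 2 with (sqrt (2 * 2)) by (apply sqrt_square; lra).
    apply sqrt_lt_1_alt. lra. }
  destruct (Hsq tb Htb Ha4) as [Hsb0 Hsb2]. destruct (Hsq tg Htg Hb4) as [Hsg0 Hsg2].
  assert (Hratio : 1 < tb / tg).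
  { apply (Rle_div_l (sqrt tg) (1 / 2) tb Htb) in Hth. apply Rlt_div_r; [exact Htg|].
    pose proof (sqrt_sqrt tg ltac:(lra)). nra. }
  assert (Hhalf : forall s, 0 < s < 2 -> 1 / 2 < / s).
  { intros s [H1 H2]. unfold Rdiv. rewrite Rmult_1_l. apply Rinv_lt_contravar; nra. }
  split; [exact (dyadic_to_infinity _ _ Dratio Hratio)|].
  destruct (dyadic_almost_increasing _ _ Dratio Hratio) as [C1 [N1 [HC1 H1]]].
  destruct (dyadic_psum _ _ Dbi (Hhalf _ (conj Hsb0 Hsb2))) as [C2 [N2 [HC2 H2]]].
  destruct (dyadic_psum _ _ Dgi (Hhalf _ (conj Hsg0 Hsg2))) as [C3 [N3 [HC3 H3]]].
  destruct (dyadic_tail _ _ Dgrow Hsum) as [C4 [N4 [HC4 H4]]].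
  assert (Hmono : forall D x, D <= 1 + C1 + C2 + C3 + C4 -> 0 <= x ->
                  D * x <= (1 + C1 + C2 + C3 + C4) * x)
    by (intros; apply Rmult_le_compat_r; assumption).
  exists (1 + C1 + C2 + C3 + C4), (S (Nat.max (Nat.max N1 N2) (Nat.max N3 N4))).
  constructor; [lra|lia| | | |].
  - intros k h Hk Hh. eapply Rle_trans; [apply (H1 k h Hk); lia|]. apply Hmono; [lra|].
    left. apply Rdiv_lt_0_compat; auto.
  - intros h Hh. eapply Rle_trans; [apply H2; lia|]. apply Hmono; [lra|].
    apply Rmult_le_pos; [apply pos_INR|]. left. apply Rinv_0_lt_compat, sqrt_lt_R0, Hb.
  - intros h Hh. eapply Rle_trans; [apply H3; lia|]. apply Hmono; [lra|].
    apply Rmult_le_pos; [apply pos_INR|]. left. apply Rinv_0_lt_compat, sqrt_lt_R0, Hg.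
  - intros h Hh. eapply Rle_trans; [apply H4; lia|]. apply Hmono; [lra|].
    apply (psum_le_tail_sum _ h 0); [|exact Hsum].
    intros k. left. apply Rdiv_lt_0_compat; [apply sqrt_lt_R0|]; auto.
Qed.

Lemma sqrt_gamma_linear (gamma b ap : nat -> R) (K : R) (e : nat -> R) :
  tame gamma b ap K e ->
  forall h, (1 <= h)%nat -> sqrt (gamma h) <= (sqrt (gamma O) + K) * INR h.
Proof.
  intros Ht h Hh. destruct Ht as [HC _ _ _ _ _ Hst _ _ _ _ _].
  assert (H : forall n, sqrt (gamma n) <= sqrt (gamma O) + K * INR n).
  { induction n as [|n IH]; [simpl; lra|]. rewrite S_INR.
    specialize (Hst n). apply Rabs_le_between in Hst. lra. }
  specialize (H h). apply le_INR in Hh. simpl in Hh. pose proof (sqrt_pos (gamma O)). nra.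
Qed.

(** [r * tail] dominates every term of the upper bound: each reduces to
    [r * h * rate h] by means of [b h / gamma h < r]. *)
Lemma growth_upper (gamma b ap : nat -> R) (K : R) (e p q : nat -> R) (K0 C : R) (N : nat) :
  tame gamma b ap K e -> solves b ap p -> solves b ap q ->
  (forall n, wronskian b p q n ^ 2 = 1) ->
  comparison gamma b C N ->
  ex_series (rate gamma b) ->
  0 < K0 -> (forall n, p n ^ 2 + q n ^ 2 <= K0 * rate gamma b n) ->
  exists M, 0 < M /\ forall h r,
    (N <= h)%nat -> 1 <= r -> b h / gamma h < r ->
    (forall n, (h < n)%nat -> r <= b n / gamma n) ->
    1 <= M * (r * tail_sum (rate gamma b) h) /\
    forall z al be, Cmod z = r -> canonical p q z al be -> cnorm al be 0 <= 1 ->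
    forall n, cnorm al be (S h + n)
      <= exp (M * (r * tail_sum (rate gamma b) h)).
Proof.
  intros Ht Hp Hq HW Hcmp Hsum HK0 Hpq.
  assert (Ht' := Ht). destruct Ht' as [HK Hg Hb Hbu _ HSlow _ _ _ _ _ _].
  set (g := rate gamma b) in *.
  assert (HS : forall n, 0 < sqrt (gamma n)) by (intros; apply sqrt_lt_R0, Hg).
  assert (HSS : forall n, sqrt (gamma n) * sqrt (gamma n) = gamma n)
    by (intros; apply sqrt_sqrt; left; apply Hg).
  assert (HB : forall n, 0 < sqrt (b n)) by (intros; apply sqrt_lt_R0, Hb).
  assert (HBB : forall n, sqrt (b n) * sqrt (b n) = b n)
    by (intros; apply sqrt_sqrt; left; apply Hb).
  assert (Hg0 : forall n, 0 < g n) by (intros; apply Rdiv_lt_0_compat; auto).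
  assert (HgS : forall n, g n <= Series g).
  { intros n. rewrite (Series_tail_sum g n Hsum), (tail_sum_step g n Hsum).
    pose proof (psum_nonneg g n ltac:(intros; left; apply Hg0)).
    pose proof (psum_le_tail_sum g (S n) 0 ltac:(intros; left; apply Hg0) Hsum) as H1. simpl in H1. lra. }
  set (V := K0 * Series g + 1).
  assert (HVV : forall u n, u ^ 2 <= K0 * g n -> Rabs u <= V).
  { intros u n Hu. specialize (HgS n).
    assert (K0 * g n <= K0 * Series g) by (mul_l).
    apply Rabs_le. unfold V. nra. }
  assert (HV : forall n, Rabs (p n) <= V /\ Rabs (q n) <= V).
  { intros n. specialize (Hpq n). sq_ge0 (p n). sq_ge0 (q n).
    split; apply (HVV _ n); lra. }
  destruct Hcmp as [HC HN1 Hratio Hpb Hpg Htail].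
  set (C1 := C + K * K ^ 2).
  assert (HKK : 0 < K * K ^ 2) by (apply Rmult_lt_0_compat; nra).
  destruct (canonical_head gamma b ap K e p q V C1 Ht Hp Hq HW HV ltac:(unfold C1; lra))
    as [K2 [HK2 Hhead]].
  set (L := sqrt (gamma O) + K).
  assert (HL : 0 < L) by (unfold L; specialize (HS O); lra).
  pose proof (Hb O) as Hb0.
  set (A0 := K2 * b O ^ 2).
  set (M1 := L * C * Rabs (ln A0) + 2 * K ^ 2 * C * C + K2 * C * C + 2 * K0).
  assert (HM1 : 0 <= L * C * Rabs (ln A0) /\ 0 <= 2 * K ^ 2 * C * C /\ 0 <= K2 * C * C).
  { repeat split; repeat apply Rmult_le_pos; try apply Rabs_pos; try apply pow2_ge_0; lra. }
  assert (HLC : 0 < L * C) by (apply Rmult_lt_0_compat; lra).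
  exists (M1 + L * C). split; [unfold M1; lra|].
  intros h r Hh Hr Hhr Hafter.
  set (X := r * tail_sum g h).
  assert (Hb_h := Hb h). assert (Hg_h := Hg h). assert (HS_h := HS h). assert (HB_h := HB h).
  assert (Hbr : b h <= r * gamma h).
  { apply Rlt_le in Hhr. apply Rle_div_l in Hhr; lra. }
  assert (HhS : INR h * / sqrt (gamma h) <= C * X).
  { apply Rle_trans with (r * (INR h * g h)).
    - replace (INR h * / sqrt (gamma h)) with (INR h * rate gamma b h * (b h / gamma h))
        by (unfold rate; rewrite <- (HSS h) at 2; field; lra).
      rewrite Rmult_comm. fold (g h). apply Rmult_le_compat_r; [|lra].
      apply Rmult_le_pos; [apply pos_INR|left; apply Hg0].
    - unfold X. replace (C * (r * tail_sum g h)) with (r * (C * tail_sum g h)) by ring.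
      mul_l. apply Htail, Hh. }
  assert (HhB : sqrt r * (INR h * / sqrt (b h)) <= C * X).
  { apply Rle_trans with (r * (INR h * g h)).
    - assert (Hsr : sqrt (b h) <= sqrt r * sqrt (gamma h)).
      { rewrite <- sqrt_mult_alt by lra. apply sqrt_le_1_alt. lra. }
      assert (Hr0 : 0 < sqrt r) by (apply sqrt_lt_R0; lra).
      pose proof (sqrt_sqrt r ltac:(lra)) as Hrr.
      apply Rle_trans with (sqrt r * (INR h * / sqrt (b h)) * (sqrt r * sqrt (gamma h) / sqrt (b h))).
      + rewrite <- (Rmult_1_r (sqrt r * (INR h * / sqrt (b h)))) at 1.
        apply Rmult_le_compat_l.
        * apply Rmult_le_pos; [lra|]. apply Rmult_le_pos; [apply pos_INR|].
          left; apply Rinv_0_lt_compat, HB.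
        * apply (Rle_div_r 1 (sqrt r * sqrt (gamma h)) (sqrt (b h))); lra.
      + right. unfold g, rate. rewrite <- (HBB h) at 3. rewrite <- Hrr at 3. field. lra.
    - unfold X. replace (C * (r * tail_sum g h)) with (r * (C * tail_sum g h)) by ring.
      mul_l. apply Htail, Hh. }
  assert (HX1 : 1 <= L * C * X).
  { pose proof (sqrt_gamma_linear gamma b ap K e Ht h ltac:(lia)) as Hlin. fold L in Hlin.
    apply Rle_trans with (L * (INR h * / sqrt (gamma h))).
    - rewrite <- Rmult_assoc. apply (Rle_div_r 1 (L * INR h) (sqrt (gamma h))); lra.
    - rewrite Rmult_assoc. mul_l. }
  assert (HX0 : 0 < X) by nra.
  split.
  { assert (0 <= M1 * X) by (apply Rmult_le_pos; unfold M1; lra). lra. }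
  intros z al be Hz Hcan H0 n.
  assert (Hrb : r <= C1 * b h).
  { specialize (Hafter (S h) ltac:(lia)). apply Rle_div_r in Hafter; [|apply Hg].
    specialize (HSlow (S h)). specialize (Hbu h).
    assert (Hg1 : 1 <= K ^ 2 * gamma (S h)) by (rewrite <- HSS; nra).
    assert (r * 1 <= r * (K ^ 2 * gamma (S h))) by (mul_l).
    assert (K ^ 2 * (r * gamma (S h)) <= K ^ 2 * (K * b h)).
    { apply Rmult_le_compat_l; [apply pow2_ge_0|lra]. }
    assert (0 <= C * b h) by (apply Rmult_le_pos; lra).
    unfold C1. lra. }
  assert (Hsq : forall k, (k <= h)%nat -> sqrt (b k) <= C1 * (sqrt r * sqrt (gamma k))).
  { intros k Hk. specialize (Hratio k h Hk Hh). pose proof (Hg k).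
    assert (Hbk : b k <= C * r * gamma k).
    { apply Rle_div_l; [apply Hg|]. eapply Rle_trans; [exact Hratio|]. mul_l. }
    rewrite <- sqrt_mult_alt by lra.
    apply Rle_trans with (sqrt (C1 ^ 2 * (r * gamma k))).
    - apply sqrt_le_1_alt. eapply Rle_trans; [exact Hbk|]. rewrite Rmult_assoc.
      apply Rmult_le_compat_r; [nra|]. unfold C1. nra.
    - rewrite sqrt_mult_alt by apply pow2_ge_0. rewrite sqrt_pow2 by (unfold C1; lra). lra. }
  specialize (Hhead h r z al be Hr Hz Hcan H0 Hsq Hrb).
  pose proof (canonical_tail p q g K0 z al be Hcan Hpq (S h) n) as Hta. rewrite Hz in Hta.
  assert (Htl : r * (2 * K0) * psum (fun k => g (S h + k)%nat) n <= 2 * K0 * X).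
  { unfold X. replace (2 * K0 * (r * tail_sum g h)) with (r * (2 * K0) * tail_sum g h) by ring.
    apply Rmult_le_compat_l; [nra|].
    eapply Rle_trans; [apply (psum_le_tail_sum g (S h) n); [intros; left; apply Hg0|exact Hsum]|].
    rewrite (tail_sum_step g h Hsum). specialize (Hg0 h). lra. }
  assert (Hbh2 : b h ^ 2 <= b O ^ 2 * exp (2 * K ^ 2 * C * C * X)).
  { pose proof (b_growth gamma b ap K e Ht h) as H1.
    apply Rle_trans with ((b O * exp (K ^ 2 * psum (fun k => / sqrt (gamma k)) (S h))) ^ 2).
    - apply pow_incr. split; [lra|exact H1].
    - rewrite Rpow_mult_distr. apply Rmult_le_compat_l; [apply pow2_ge_0|].
      rewrite <- Rsqr_pow2. unfold Rsqr. rewrite <- exp_plus. apply exp_le.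
      specialize (Hpg h Hh).
      assert (psum (fun k => / sqrt (gamma k)) (S h) <= C * (C * X)).
      { eapply Rle_trans; [exact Hpg|]. mul_l. }
      assert (K ^ 2 * psum (fun k => / sqrt (gamma k)) (S h) <= K ^ 2 * (C * (C * X)))
        by (apply Rmult_le_compat_l; [apply pow2_ge_0|lra]).
      lra. }
  assert (Hpb' : K2 * (sqrt r * psum (fun k => / sqrt (b k)) (S h)) <= K2 * C * C * X).
  { replace (K2 * C * C * X) with (K2 * (C * (C * X))) by ring.
    mul_l. specialize (Hpb h Hh).
    apply Rle_trans with (sqrt r * (C * (INR h * / sqrt (b h)))).
    - apply Rmult_le_compat_l; [apply sqrt_pos|exact Hpb].
    - replace (sqrt r * (C * (INR h * / sqrt (b h)))) with (C * (sqrt r * (INR h * / sqrt (b h)))) by ring.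
      mul_l. }
  assert (HA0 : A0 <= exp (L * C * Rabs (ln A0) * X)).
  { assert (HA0p : 0 < A0) by (unfold A0; apply Rmult_lt_0_compat; nra).
    rewrite <- (exp_ln A0 HA0p) at 1. apply exp_le.
    bound_by Rle_abs.
    replace (L * C * Rabs (ln A0) * X) with (Rabs (ln A0) * (L * C * X)) by ring.
    rewrite <- (Rmult_1_r (Rabs (ln A0))) at 1. apply Rmult_le_compat_l; [apply Rabs_pos|exact HX1]. }
  assert (Hhead2 : cnorm al be (S h)
     <= exp (L * C * Rabs (ln A0) * X) * exp (2 * K ^ 2 * C * C * X) * exp (K2 * C * C * X)).
  { eapply Rle_trans; [exact Hhead|].
    apply Rmult_le_compat; [apply Rmult_le_pos; [lra|apply pow2_ge_0]|left; apply exp_pos| |apply exp_le, Hpb'].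
    apply Rle_trans with (A0 * exp (2 * K ^ 2 * C * C * X)).
    - unfold A0. rewrite Rmult_assoc. mul_l.
    - apply Rmult_le_compat_r; [left; apply exp_pos|exact HA0]. }
  apply Rle_trans with (exp (M1 * X)); [|apply exp_le, Rmult_le_compat_r; lra].
  eapply Rle_trans; [exact Hta|].
  replace (M1 * X) with (L * C * Rabs (ln A0) * X + 2 * K ^ 2 * C * C * X + K2 * C * C * X + 2 * K0 * X)
    by (unfold M1; ring).
  rewrite !exp_plus. apply Rmult_le_compat; [apply cnorm_nonneg|left; apply exp_pos|exact Hhead2|].
  apply exp_le, Htl.
Qed.

(** * The Nevanlinna matrix as the limit of the canonical product *)

Fixpoint rsol (a b : nat -> R) (u0 u1 : R) (n : nat) : R :=
  match n with
  | O => u0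
  | S m =>
      match m with
      | O => u1
      | S k => ((0 - a m) * rsol a b u0 u1 m - b k * rsol a b u0 u1 k) / b m
      end
  end.

Lemma pair_induction (P : nat -> Prop) :
  P O -> P 1%nat -> (forall n, P n -> P (S n) -> P (S (S n))) -> forall n, P n.
Proof.
  intros H0 H1 HS n. enough (P n /\ P (S n)) by tauto.
  induction n as [|n [IH1 IH2]]; auto.
Qed.

Lemma RtoC_neq_0 (x : R) : 0 < x -> RtoC x <> RtoC 0.
Proof. intros H E. apply RtoC_inj in E. lra. Qed.

Lemma jacobi_solution_SS (a b : nat -> R) (u0 u1 z : C) (n : nat) :
  jacobi_solution a b u0 u1 z (S (S n))
  = (((z - a (S n)) * jacobi_solution a b u0 u1 z (S n)
      - b n * jacobi_solution a b u0 u1 z n) / b (S n))%C.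
Proof. reflexivity. Qed.

Lemma rsol_SS (a b : nat -> R) (u0 u1 : R) (n : nat) :
  rsol a b u0 u1 (S (S n))
  = ((0 - a (S n)) * rsol a b u0 u1 (S n) - b n * rsol a b u0 u1 n) / b (S n).
Proof. reflexivity. Qed.

Lemma jacobi_solution_real (a b : nat -> R) (u0 u1 : R) (n : nat) :
  (forall n, 0 < b n) -> jacobi_solution a b u0 u1 0 n = RtoC (rsol a b u0 u1 n).
Proof.
  intros Hb. revert n. apply pair_induction; [reflexivity|reflexivity|].
  intros n IH0 IH1. rewrite jacobi_solution_SS, rsol_SS, IH0, IH1.
  rewrite RtoC_div by (specialize (Hb (S n)); lra).
  rewrite !RtoC_minus, !RtoC_mult, !RtoC_minus. reflexivity.
Qed.

Definition real_p (a b : nat -> R) : nat -> R := rsol a b 1 ((0 - a O) / b O).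
Definition real_q (a b : nat -> R) : nat -> R := rsol a b 0 (1 / b O).

Lemma poly_p_0 (a b : nat -> R) (n : nat) :
  (forall n, 0 < b n) -> poly_p a b n 0 = RtoC (real_p a b n).
Proof.
  intros Hb. unfold poly_p, real_p. rewrite <- jacobi_solution_real by exact Hb. f_equal.
  rewrite RtoC_div by (specialize (Hb O); lra). rewrite RtoC_minus. reflexivity.
Qed.

Lemma poly_q_0 (a b : nat -> R) (n : nat) :
  (forall n, 0 < b n) -> poly_q a b n 0 = RtoC (real_q a b n).
Proof.
  intros Hb. unfold poly_q, real_q. rewrite <- jacobi_solution_real by exact Hb. f_equal.
  rewrite RtoC_div by (specialize (Hb O); lra). reflexivity.
Qed.

Lemma rsol_solves (a b : nat -> R) (u0 u1 : R) :
  (forall n, 0 < b n) -> solves b a (rsol a b u0 u1).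
Proof.
  intros Hb n. rewrite rsol_SS. pose proof (Hb (S n)). field. lra.
Qed.

Lemma wronskian_real (a b : nat -> R) :
  (forall n, 0 < b n) -> forall n, wronskian b (real_p a b) (real_q a b) n = 1.
Proof.
  intros Hb. induction n as [|n IH].
  - unfold wronskian, real_p, real_q. simpl. pose proof (Hb O). field. lra.
  - rewrite <- IH. unfold wronskian.
    pose proof (rsol_solves a b 1 ((0 - a O) / b O) Hb n) as Hp. fold (real_p a b) in Hp.
    pose proof (rsol_solves a b 0 (1 / b O) Hb n) as Hq. fold (real_q a b) in Hq.
    set (p := real_p a b) in *. set (q := real_q a b) in *.
    replace (b (S n) * (p (S n) * q (S (S n)) - q (S n) * p (S (S n))))
      with (p (S n) * (b (S n) * q (S (S n))) - q (S n) * (b (S n) * p (S (S n)))) by ring.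
    replace (b (S n) * q (S (S n))) with (- (a (S n) * q (S n) + b n * q n)) by lra.
    replace (b (S n) * p (S (S n))) with (- (a (S n) * p (S n) + b n * p n)) by lra.
    ring.
Qed.

Fixpoint canonical_product (p q : nat -> R) (z : C) (w : C * C) (n : nat) : C * C :=
  match n with
  | O => w
  | S m =>
      let v := canonical_product p q z w m in
      let s := (p m * fst v + q m * snd v)%C in
      ((fst v - z * (q m * s))%C, (snd v + z * (p m * s))%C)
  end.

Definition coef1 (p q : nat -> R) (z : C) (w : C * C) (n : nat) : C :=
  fst (canonical_product p q z w n).
Definition coef2 (p q : nat -> R) (z : C) (w : C * C) (n : nat) : C :=
  snd (canonical_product p q z w n).

Lemma canonical_product_correct (p q : nat -> R) (z : C) (w : C * C) :
  canonical p q z (coef1 p q z w) (coef2 p q z w).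
Proof. intros n. split; reflexivity. Qed.

Lemma csol_recurrence (a b p q : nat -> R) (z : C) (al be : nat -> C) (n : nat) :
  canonical p q z al be -> (forall n, 0 < b n) -> solves b a p -> solves b a q ->
  (forall n, wronskian b p q n = 1) ->
  csol p q al be (S (S n))
  = (((z - a (S n)) * csol p q al be (S n) - b n * csol p q al be n) / b (S n))%C.
Proof.
  intros Hcan Hb Hp Hq HW.
  pose proof (csol_step b p q z al be n Hcan (Hb n)) as H0.
  pose proof (csol_step b p q z al be (S n) Hcan (Hb (S n))) as H1.
  pose proof (cquasi_step b a p q z al be n Hcan Hb Hp Hq) as Hq'.
  rewrite HW in Hq'.
  assert (Hd : b (S n) * pot b a n = b (S n) + a (S n) + b n)
    by (unfold pot; pose proof (Hb (S n)); field; lra).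
  rewrite Hd, !RtoC_plus in Hq'.
  pose proof (RtoC_neq_0 _ (Hb n)) as N0. pose proof (RtoC_neq_0 _ (Hb (S n))) as N1.
  assert (HY : cquasi b p q al be n = (b n * (csol p q al be (S n) - csol p q al be n))%C).
  { rewrite H0. field. exact N0. }
  rewrite H1, Hq', HY. field. exact N1.
Qed.

(** Both sides satisfy the recurrence at [z]; the initial values fix which solution
    belongs to the coefficients [(c, d)]. *)
Lemma csol_jacobi (a b : nat -> R) (z c d : C) (n : nat) :
  (forall n, 0 < b n) ->
  csol (real_p a b) (real_q a b) (coef1 (real_p a b) (real_q a b) z (c, d))
    (coef2 (real_p a b) (real_q a b) z (c, d)) n
  = jacobi_solution a b c (((z - a O) * c + d) / b O)%C z n.
Proof.
  intros Hb. set (p := real_p a b). set (q := real_q a b). set (w := (c, d)). revert n.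
  apply pair_induction.
  - unfold csol, coef1, coef2. cbn. ring.
  - unfold csol, coef1, coef2, p, q, w, real_p, real_q. cbn.
    rewrite !RtoC_div, !RtoC_minus by (specialize (Hb O); lra).
    field. apply RtoC_neq_0, Hb.
  - intros n IH0 IH1.
    rewrite (csol_recurrence a b p q z) by
      first [apply canonical_product_correct | exact Hb | apply rsol_solves, Hb | apply wronskian_real, Hb].
    rewrite IH0, IH1. reflexivity.
Qed.

Lemma csol_poly_p (a b : nat -> R) (z : C) (n : nat) :
  (forall n, 0 < b n) ->
  csol (real_p a b) (real_q a b) (coef1 (real_p a b) (real_q a b) z (RtoC 1, RtoC 0))
    (coef2 (real_p a b) (real_q a b) z (RtoC 1, RtoC 0)) n = poly_p a b n z.
Proof.
  intros Hb. rewrite csol_jacobi by exact Hb. unfold poly_p. f_equal. field. apply RtoC_neq_0, Hb.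
Qed.

Lemma csol_poly_q (a b : nat -> R) (z : C) (n : nat) :
  (forall n, 0 < b n) ->
  csol (real_p a b) (real_q a b) (coef1 (real_p a b) (real_q a b) z (RtoC 0, RtoC 1))
    (coef2 (real_p a b) (real_q a b) z (RtoC 0, RtoC 1)) n = poly_q a b n z.
Proof.
  intros Hb. rewrite csol_jacobi by exact Hb. unfold poly_q. f_equal. field. apply RtoC_neq_0, Hb.
Qed.

(** Convergence in [C] by components, as [CSeries] is defined. *)
Definition clim (x : nat -> C) (l : C) : Prop :=
  is_lim_seq (fun n => Re (x n)) (Re l) /\ is_lim_seq (fun n => Im (x n)) (Im l).

Lemma clim_Cmod (x : nat -> C) (l : C) : clim x l -> is_lim_seq (fun n => Cmod (x n)) (Cmod l).
Proof.
  intros [H1 H2]. unfold Cmod.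
  apply (is_lim_seq_continuous sqrt (fun n => fst (x n) ^ 2 + snd (x n) ^ 2)).
  - apply continuity_pt_sqrt. apply Rplus_le_le_0_compat; apply pow2_ge_0.
  - apply is_lim_seq_plus'.
    + apply is_lim_seq_ext with (fun n => Re (x n) * Re (x n)); [intros; unfold Re; ring|].
      replace (fst l ^ 2) with (Re l * Re l) by (unfold Re; ring). apply is_lim_seq_mult'; assumption.
    + apply is_lim_seq_ext with (fun n => Im (x n) * Im (x n)); [intros; unfold Im; ring|].
      replace (snd l ^ 2) with (Im l * Im l) by (unfold Im; ring). apply is_lim_seq_mult'; assumption.
Qed.

Lemma clim_affine (c z : C) (x : nat -> C) (l : C) :
  clim x l -> clim (fun n => (c + z * x n)%C) (c + z * l)%C.
Proof.
  intros [H1 H2]. split; cbn.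
  - apply is_lim_seq_plus'; [apply is_lim_seq_const|].
    apply is_lim_seq_minus'; apply is_lim_seq_mult'; auto; apply is_lim_seq_const.
  - apply is_lim_seq_plus'; [apply is_lim_seq_const|].
    apply is_lim_seq_plus'; apply is_lim_seq_mult'; auto; apply is_lim_seq_const.
Qed.

Fixpoint csum (f : nat -> C) (n : nat) : C :=
  match n with
  | O => RtoC 0
  | S m => (csum f m + f m)%C
  end.

Lemma csum_clim (f : nat -> C) : ex_series (fun n => Cmod (f n)) -> clim (csum f) (CSeries f).
Proof.
  intros H.
  assert (Hre : ex_series (fun n => Re (f n))).
  { apply ex_series_Rabs. apply ex_series_nonneg_le with (fun n => Cmod (f n)); [|exact H].
    intros n. split; [apply Rabs_pos|apply re_le_Cmod]. }
  assert (Him : ex_series (fun n => Im (f n))).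
  { apply ex_series_Rabs. apply ex_series_nonneg_le with (fun n => Cmod (f n)); [|exact H].
    intros n. split; [apply Rabs_pos|].
    unfold Im. eapply Rle_trans; [|apply Rmax_Cmod]. apply Rmax_r. }
  split.
  - apply is_lim_seq_ext with (psum (fun n => Re (f n))); [|exact (psum_lim _ Hre)].
    induction n as [|n IH]; simpl; [reflexivity|]. rewrite IH. reflexivity.
  - apply is_lim_seq_ext with (psum (fun n => Im (f n))); [|exact (psum_lim _ Him)].
    induction n as [|n IH]; simpl; [reflexivity|]. rewrite IH. reflexivity.
Qed.

(** The system telescopes to the partial sums in the definition of the Nevanlinna
    matrix. *)
Lemma coef_csum (p q : nat -> R) (z : C) (al be : nat -> C) (n : nat) :
  canonical p q z al be ->
  al n = (al O + - z * csum (fun k => q k * csol p q al be k) n)%C /\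
  be n = (be O + z * csum (fun k => p k * csol p q al be k) n)%C.
Proof.
  intros H. induction n as [|n [IH1 IH2]].
  - simpl. split; ring.
  - destruct (H n) as [Ha Hb]. rewrite Ha, Hb. rewrite IH1 at 1. rewrite IH2 at 1.
    simpl csum. split; ring.
Qed.

Lemma coef_clim (p q g : nat -> R) (K : R) (z : C) (al be : nat -> C) :
  canonical p q z al be -> 0 <= K -> (forall n, 0 <= g n) -> ex_series g ->
  (forall n, p n ^ 2 + q n ^ 2 <= K * g n) ->
  clim al (al O + - z * CSeries (fun k => q k * csol p q al be k))%C /\
  clim be (be O + z * CSeries (fun k => p k * csol p q al be k))%C.
Proof.
  intros H HK Hg0 Hgs Hg.
  set (M := cnorm al be 0 * exp (Cmod z * (2 * K) * Series g)).
  assert (HM : forall n, cnorm al be n <= M) by exact (canonical_bounded p q g K z al be H HK Hg0 Hgs Hg).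
  assert (Hex : forall v : nat -> R, (forall n, Rabs (v n) <= Rabs (p n) + Rabs (q n)) ->
            ex_series (fun n => Cmod (v n * csol p q al be n)%C)).
  { intros v Hv. apply ex_series_nonneg_le with (fun n => 2 * K * M * g n);
      [|apply ex_series_scal_R, Hgs].
    intros n. split; [apply Cmod_ge_0|]. rewrite Cmod_RtoC_mult.
    pose proof (csol_le p q al be n) as Hs. specialize (Hv n). specialize (HM n).
    pose proof (sum_abs_sq (p n) (q n)) as Hsq. specialize (Hg n).
    abs_ge0 (v n). mod_ge0 (csol p q al be n).
    pose proof (cnorm_nonneg al be n).
    set (V := Rabs (p n) + Rabs (q n)) in *.
    apply Rle_trans with (V * (V * M)).
    - apply Rmult_le_compat; try assumption. eapply Rle_trans; [exact Hs|].
      mul_l.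
    - replace (V * (V * M)) with (V ^ 2 * M) by ring.
      replace (2 * K * M * g n) with (2 * (K * g n) * M) by ring.
      mul_r. }
  split.
  - pose proof (clim_affine (al O) (- z) _ _ (csum_clim (fun k => (q k * csol p q al be k)%C)
      (Hex q ltac:(intros n; abs_ge0 (p n); lra)))) as [H1 H2].
    split; (eapply is_lim_seq_ext; [|eassumption]); intros n; cbv beta;
      rewrite <- (proj1 (coef_csum p q z al be n H)); reflexivity.
  - pose proof (clim_affine (be O) z _ _ (csum_clim (fun k => (p k * csol p q al be k)%C)
      (Hex p ltac:(intros n; abs_ge0 (q n); lra)))) as [H1 H2].
    split; (eapply is_lim_seq_ext; [|eassumption]); intros n; cbv beta;
      rewrite <- (proj2 (coef_csum p q z al be n H)); reflexivity.
Qed.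

Lemma CSeries_ext (f g : nat -> C) : (forall n, f n = g n) -> CSeries f = CSeries g.
Proof.
  intros H. unfold CSeries. f_equal; apply Series_ext; intros n; rewrite H; reflexivity.
Qed.

Lemma nevanlinna_lim (a b g : nat -> R) (K : R) (z : C) :
  (forall n, 0 < b n) -> 0 <= K -> (forall n, 0 <= g n) -> ex_series g ->
  (forall n, real_p a b n ^ 2 + real_q a b n ^ 2 <= K * g n) ->
  let p := real_p a b in let q := real_q a b in
  let wp := (RtoC 1, RtoC 0) in let wq := (RtoC 0, RtoC 1) in
  is_lim_seq (cnorm (coef1 p q z wp) (coef2 p q z wp)) (Cmod (nev_B a b z) + Cmod (nev_D a b z)) /\
  is_lim_seq (cnorm (coef1 p q z wq) (coef2 p q z wq)) (Cmod (nev_A a b z) + Cmod (nev_C a b z)).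
Proof.
  intros Hb HK Hg0 Hgs Hg p q wp wq.
  assert (Hlim : forall w,
    let u := csol p q (coef1 p q z w) (coef2 p q z w) in
    is_lim_seq (cnorm (coef1 p q z w) (coef2 p q z w))
      (Cmod (fst w + - z * CSeries (fun k => q k * u k))%C
       + Cmod (snd w + z * CSeries (fun k => p k * u k))%C)).
  { intros w u.
    destruct (coef_clim p q g K z _ _ (canonical_product_correct p q z w) HK Hg0 Hgs Hg) as [H1 H2].
    apply is_lim_seq_plus'; apply clim_Cmod; assumption. }
  split.
  - specialize (Hlim wp). cbv zeta in Hlim.
    rewrite (CSeries_ext (fun k => (q k * csol p q (coef1 p q z wp) (coef2 p q z wp) k)%C)
      (fun k => poly_q a b k 0 * poly_p a b k z)%C) in Hlim
      by (intros n; rewrite poly_q_0 by exact Hb; rewrite <- (csol_poly_p a b z n Hb); reflexivity).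
    rewrite (CSeries_ext (fun k => (p k * csol p q (coef1 p q z wp) (coef2 p q z wp) k)%C)
      (fun k => poly_p a b k 0 * poly_p a b k z)%C) in Hlim
      by (intros n; rewrite poly_p_0 by exact Hb; rewrite <- (csol_poly_p a b z n Hb); reflexivity).
    replace (Cmod (nev_B a b z)) with (Cmod (- nev_B a b z)%C) by apply Cmod_opp.
    replace (- nev_B a b z)%C
      with (fst wp + - z * CSeries (fun k => poly_q a b k 0 * poly_p a b k z))%C
      by (unfold nev_B, wp; simpl fst; ring).
    replace (nev_D a b z)
      with (snd wp + z * CSeries (fun k => poly_p a b k 0 * poly_p a b k z))%C
      by (unfold nev_D, wp; simpl snd; ring).
    exact Hlim.
  - specialize (Hlim wq). cbv zeta in Hlim.
    rewrite (CSeries_ext (fun k => (q k * csol p q (coef1 p q z wq) (coef2 p q z wq) k)%C)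
      (fun k => poly_q a b k 0 * poly_q a b k z)%C) in Hlim
      by (intros n; rewrite poly_q_0 by exact Hb; rewrite <- (csol_poly_q a b z n Hb); reflexivity).
    rewrite (CSeries_ext (fun k => (p k * csol p q (coef1 p q z wq) (coef2 p q z wq) k)%C)
      (fun k => poly_p a b k 0 * poly_q a b k z)%C) in Hlim
      by (intros n; rewrite poly_p_0 by exact Hb; rewrite <- (csol_poly_q a b z n Hb); reflexivity).
    replace (Cmod (nev_A a b z)) with (Cmod (- nev_A a b z)%C) by apply Cmod_opp.
    replace (- nev_A a b z)%C
      with (fst wq + - z * CSeries (fun k => poly_q a b k 0 * poly_q a b k z))%C
      by (unfold nev_A, wq; simpl fst; ring).
    replace (nev_C a b z)
      with (snd wq + z * CSeries (fun k => poly_p a b k 0 * poly_q a b k z))%C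
      by (unfold nev_C, wq; simpl snd; ring).
    exact Hlim.
Qed.

(** * Limit circle case *)

Lemma Cmod_csum (f : nat -> C) (n : nat) : Cmod (csum f n) <= psum (fun k => Cmod (f k)) n.
Proof.
  induction n as [|n IH]; simpl.
  - rewrite Cmod_0. lra.
  - bound_by Cmod_triangle. lra.
Qed.

Lemma clim_minus (x y : nat -> C) (l m : C) :
  clim x l -> clim y m -> clim (fun n => (x n - y n)%C) (l - m)%C.
Proof. intros [H1 H2] [H3 H4]. split; cbn; apply is_lim_seq_minus'; assumption. Qed.

Lemma clim_unique (x : nat -> C) (l m : C) : clim x l -> clim x m -> l = m.
Proof.
  intros [H1 H2] [H3 H4].
  apply is_lim_seq_unique in H1, H2, H3, H4. rewrite H1 in H3. rewrite H2 in H4.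
  injection H3 as E1. injection H4 as E2. destruct l, m. unfold Re, Im in *. simpl in *. congruence.
Qed.

Lemma csum_minus (f g : nat -> C) (n : nat) :
  (csum f n - csum g n)%C = csum (fun k => (f k - g k)%C) n.
Proof. induction n as [|n IH]; simpl; [ring|]. rewrite <- IH. ring. Qed.

Lemma ex_series_eventually_0 (f : nat -> R) (N : nat) :
  (forall n, (N <= n)%nat -> f n = 0) -> ex_series f.
Proof.
  intros H. apply (proj2 (ex_series_shift f N)).
  apply ex_series_nonneg_le with (fun _ => 0).
  - intros n. rewrite H by lia. lra.
  - apply (ex_series_of_psum_bounded _ 0); [intros; lra|].
    intros n. rewrite psum_const. lra.
Qed.

Lemma CSeries_finite (f : nat -> C) (N : nat) :
  (forall n, (N <= n)%nat -> f n = RtoC 0) -> CSeries f = csum f N.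
Proof.
  intros H.
  assert (Hc : forall m, csum f (N + m) = csum f N).
  { induction m as [|m IH]; [rewrite Nat.add_0_r; reflexivity|].
    rewrite Nat.add_succ_r. simpl. rewrite IH, H by lia. ring. }
  assert (Hex : ex_series (fun n => Cmod (f n))).
  { apply (ex_series_eventually_0 _ N). intros n Hn. rewrite H by exact Hn. apply Cmod_0. }
  destruct (csum_clim f Hex) as [H1 H2].
  apply (clim_unique (fun m => csum f (m + N))).
  - split; [apply (is_lim_seq_incr_n (fun n => Re (csum f n)) N)
           |apply (is_lim_seq_incr_n (fun n => Im (csum f n)) N)]; assumption.
  - split; (eapply is_lim_seq_ext; [|apply is_lim_seq_const]); intros m; cbv beta;
      rewrite Nat.add_comm, Hc; reflexivity.
Qed.

Lemma l2_mult (u v : nat -> C) :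
  l2 u -> l2 v -> ex_series (fun n => Cmod (u n * Cconj (v n))%C).
Proof.
  intros Hu Hv.
  apply ex_series_nonneg_le with (fun n => Cmod (u n) ^ 2 + Cmod (v n) ^ 2).
  - intros n. split; [apply Cmod_ge_0|]. rewrite Cmod_mult, Cmod_conj.
 nra.
  - apply ex_series_plus_R; assumption.
Qed.

Lemma l2_minus (u v : nat -> C) : l2 u -> l2 v -> l2 (fun n => (u n - v n)%C).
Proof.
  intros Hu Hv. unfold l2 in *.
  apply ex_series_nonneg_le with (fun n => 2 * (Cmod (u n) ^ 2 + Cmod (v n) ^ 2)).
  - intros n. split; [apply pow2_ge_0|].
    assert (H : Cmod (u n - v n)%C <= Cmod (u n) + Cmod (v n)).
    { unfold Cminus. rewrite <- (Cmod_opp (v n)). apply Cmod_triangle. }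
    mod_ge0 (u n - v n)%C.
    sq_ge0 (Cmod (u n) - Cmod (v n)). nra.
  - apply ex_series_scal_R, ex_series_plus_R; assumption.
Qed.

Lemma l2_finite (u : nat -> C) : finitely_supported u -> l2 u.
Proof.
  intros [N H]. apply (ex_series_eventually_0 _ N).
  intros n Hn. rewrite H by exact Hn. rewrite Cmod_0. ring.
Qed.

Lemma l2_RtoC (u : nat -> R) : ex_series (fun n => u n ^ 2) -> l2 (fun n => RtoC (u n)).
Proof.
  intros H. eapply ex_series_ext; [|exact H]. intros n. cbv beta.
  rewrite Cmod_R. symmetry. apply pow2_abs.
Qed.

(** The inequality [s * t <= s ^ 2 / eps + eps * t ^ 2] replaces Cauchy-Schwarz. *)
Lemma l2inner_close (y y' v : nat -> C) (eps : R) :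
  l2 y -> l2 y' -> l2 v -> 0 < eps -> l2norm (fun n => (y n - y' n)%C) < eps ->
  Cmod (l2inner y v - l2inner y' v)%C <= eps * (1 + Series (fun n => Cmod (v n) ^ 2)).
Proof.
  intros Hy Hy' Hv He Hd.
  pose proof (clim_minus _ _ _ _ (csum_clim _ (l2_mult y v Hy Hv)) (csum_clim _ (l2_mult y' v Hy' Hv))) as Hl.
  apply clim_Cmod in Hl.
  pose proof (l2_minus y y' Hy Hy') as Hdl. unfold l2 in Hdl, Hv.
  set (D := fun n => Cmod (y n - y' n)%C ^ 2) in *. set (W := fun n => Cmod (v n) ^ 2) in *.
  assert (HD0 : forall n, 0 <= D n) by (intros; apply pow2_ge_0).
  assert (HW0 : forall n, 0 <= W n) by (intros; apply pow2_ge_0).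
  assert (HSD : Series D <= eps ^ 2).
  { unfold l2norm in Hd. fold D in Hd.
    pose proof (psum_le_Series D 0 HD0 Hdl) as H0. simpl in H0.
    pose proof (sqrt_pos (Series D)). pose proof (sqrt_sqrt (Series D) H0). nra. }
  apply (is_lim_seq_le (fun n => Cmod (csum (fun n => (y n * Cconj (v n))%C) n
                                      - csum (fun n => (y' n * Cconj (v n))%C) n)%C)
          (fun _ => eps * (1 + Series W))
          (Cmod (l2inner y v - l2inner y' v)%C) (eps * (1 + Series W))).
  - intros n. rewrite csum_minus. bound_by Cmod_csum.
    apply Rle_trans with (psum (fun k => / eps * D k + eps * W k) n).
    + apply psum_le. intros k _.
      replace (y k * Cconj (v k) - y' k * Cconj (v k))%C with ((y k - y' k) * Cconj (v k))%C by ring.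
      rewrite Cmod_mult, Cmod_conj. unfold D, W.
      set (s := Cmod (y k - y' k)%C). set (t := Cmod (v k)).
      apply Rmult_le_reg_l with eps; [exact He|].
      replace (eps * (/ eps * s ^ 2 + eps * t ^ 2)) with (s ^ 2 + (eps * t) ^ 2) by (field; lra).
 nra.
    + rewrite psum_plus, !psum_scal.
      pose proof (psum_le_Series D n HD0 Hdl). pose proof (psum_le_Series W n HW0 Hv).
      assert (/ eps * psum D n <= / eps * eps ^ 2).
      { apply Rmult_le_compat_l; [left; apply Rinv_0_lt_compat; lra|lra]. }
      assert (/ eps * eps ^ 2 = eps) by (field; lra).
      assert (eps * psum W n <= eps * Series W) by (mul_l). lra.
  - exact Hl.
  - apply is_lim_seq_const.
Qed.

(** The image under the Jacobi matrix of a solution at [0]: only the first row of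
    the product can be nonzero. *)
Definition first_row (a b u : nat -> R) (n : nat) : R :=
  match n with O => a O * u O + b O * u 1%nat | S _ => 0 end.

(** Green's formula; its boundary term at [N] vanishes for finitely supported [x]
    and large [N]. *)
Lemma jacobi_summation (a b u : nat -> R) (x : nat -> C) (N : nat) :
  solves b a u ->
  csum (fun n => (jacobi_apply a b x n * u n)%C) (S N)
  = (x O * first_row a b u 0 + b N * (x (S N) * u N - x N * u (S N)))%C.
Proof.
  intros Hu. induction N as [|N IH].
  - simpl. rewrite RtoC_plus, !RtoC_mult. ring.
  - change (csum (fun n => (jacobi_apply a b x n * u n)%C) (S (S N)))
      with (csum (fun n => (jacobi_apply a b x n * u n)%C) (S N) + jacobi_apply a b x (S N) * u (S N))%C.
    rewrite IH. simpl (jacobi_apply a b x (S N)).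
    assert (E : (b (S N) * u (S (S N)) + a (S N) * u (S N) + b N * u N = 0)%C).
    { rewrite <- !RtoC_mult, <- !RtoC_plus, (Hu N). reflexivity. }
    set (F := first_row a b u 0).
    transitivity (x O * F + b (S N) * (x (S (S N)) * u (S N) - x (S N) * u (S (S N)))
                  + x (S N) * (b (S N) * u (S (S N)) + a (S N) * u (S N) + b N * u N))%C.
    + ring.
    + rewrite E. ring.
Qed.

Lemma jacobi_apply_finite (a b : nat -> R) (x : nat -> C) :
  finitely_supported x -> finitely_supported (jacobi_apply a b x).
Proof.
  intros [N H]. exists (S N). intros [|n] Hn; [lia|]. simpl.
  rewrite (H n), (H (S n)), (H (S (S n))) by lia. ring.
Qed.

Lemma adjoint_of_solution (a b u : nat -> R) :
  solves b a u -> ex_series (fun n => u n ^ 2) ->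
  adjoint (minimal_operator a b) (fun n => RtoC (u n)) (fun n => RtoC (first_row a b u n)).
Proof.
  intros Hu Hs. set (uc := fun n => RtoC (u n)). set (v := fun n => RtoC (first_row a b u n)).
  assert (Lu : l2 uc) by (apply l2_RtoC, Hs).
  assert (Lv : l2 v).
  { apply l2_finite. exists 1%nat. intros [|n] Hn; [lia|]. reflexivity. }
  split; [exact Lu|]. split; [exact Lv|]. intros x y [Lx [Ly HT]].
  set (M := (1 + Series (fun n => Cmod (uc n) ^ 2)) + (1 + Series (fun n => Cmod (v n) ^ 2))).
  assert (HM : 0 < M).
  { pose proof (psum_le_Series _ 0 (fun n => pow2_ge_0 (Cmod (uc n))) Lu).
    pose proof (psum_le_Series _ 0 (fun n => pow2_ge_0 (Cmod (v n))) Lv). simpl in *. unfold M. lra. }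
  assert (Hsmall : forall eps, 0 < eps -> Cmod (l2inner y uc - l2inner x v)%C <= eps * M).
  { intros eps He. destruct (HT eps He) as [x' [Fx' [H1 H2]]].
    pose proof (l2_finite x' Fx') as Lx'.
    pose proof (jacobi_apply_finite a b x' Fx') as FJ. pose proof (l2_finite _ FJ) as LJ.
    pose proof (l2inner_close x x' v eps Lx Lx' Lv He H1) as C1.
    pose proof (l2inner_close y _ uc eps Ly LJ Lu He H2) as C2.
    assert (E : l2inner (jacobi_apply a b x') uc = l2inner x' v).
    { destruct Fx' as [N HN]. unfold l2inner.
      rewrite (CSeries_finite _ (S (S N))).
      - rewrite (CSeries_ext _ (fun n => (x' n * v n)%C)).
        + rewrite (CSeries_finite _ 1).
          * assert (Ecs : forall n, csum (fun n => (jacobi_apply a b x' n * Cconj (uc n))%C) n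
                    = csum (fun n => (jacobi_apply a b x' n * u n)%C) n).
            { induction n as [|n IH]; simpl; [reflexivity|]. rewrite IH. unfold uc.
              f_equal. f_equal. unfold Cconj, RtoC. simpl. f_equal. ring. }
            rewrite Ecs, jacobi_summation by exact Hu.
            rewrite (HN (S N)), (HN (S (S N))) by lia. unfold v. cbn [csum]. ring.
          * intros [|n] Hn; [lia|]. unfold v. simpl. ring.
        + intros n. unfold v. f_equal. unfold Cconj, RtoC. simpl. f_equal. ring.
      - intros [|n] Hn; [lia|]. simpl.
        rewrite (HN n), (HN (S n)), (HN (S (S n))) by lia. ring. }
    replace (l2inner y uc - l2inner x v)%C
      with ((l2inner y uc - l2inner (jacobi_apply a b x') uc)
            + - (l2inner x v - l2inner x' v))%C by (rewrite E; ring).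
    bound_by Cmod_triangle. rewrite Cmod_opp. unfold M.
    rewrite Rmult_plus_distr_l. lra. }
  assert (Hz : Cmod (l2inner y uc - l2inner x v)%C = 0).
  { apply Rle_antisym; [|apply Cmod_ge_0]. apply Rnot_lt_le. intros Hpos.
    set (c := Cmod (l2inner y uc - l2inner x v)%C) in *.
    specialize (Hsmall (c / (2 * M)) ltac:(apply Rdiv_lt_0_compat; lra)).
    replace (c / (2 * M) * M) with (c / 2) in Hsmall by (field; lra). lra. }
  apply Cmod_eq_0 in Hz.
  replace (l2inner y uc) with ((l2inner y uc - l2inner x v) + l2inner x v)%C by ring.
  rewrite Hz. ring.
Qed.

(** When both solutions at [0] are square summable they lie in the domain of the
    adjoint, and the adjoint is not symmetric on them: its boundary form there is
    their Wronskian. *)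
Lemma limit_circle_of_l2 (a b : nat -> R) :
  (forall n, 0 < b n) ->
  ex_series (fun n => real_p a b n ^ 2) -> ex_series (fun n => real_q a b n ^ 2) ->
  limit_circle a b.
Proof.
  intros Hb Hp Hq Hself.
  pose proof (adjoint_of_solution a b (real_p a b) (rsol_solves a b _ _ Hb) Hp) as Ap.
  pose proof (adjoint_of_solution a b (real_q a b) (rsol_solves a b _ _ Hb) Hq) as Aq.
  apply Hself in Aq. destruct Ap as [_ [_ Ap]]. specialize (Ap _ _ Aq).
  pose proof (Hb O) as Hb0.
  assert (Ep : first_row a b (real_p a b) 0 = 0) by (unfold real_p; simpl; field; lra).
  assert (Eq : first_row a b (real_q a b) 0 = 1) by (unfold real_q; simpl; field; lra).
  unfold l2inner in Ap.
  rewrite !(CSeries_finite _ 1) in Ap.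
  - cbn [csum] in Ap. rewrite Ep, Eq in Ap. unfold real_p, real_q in Ap. simpl in Ap.
    apply (f_equal fst) in Ap. simpl in Ap. lra.
  - intros [|n] Hn; [lia|]. apply injective_projections; simpl; ring.
  - intros [|n] Hn; [lia|]. apply injective_projections; simpl; ring.
Qed.

(** * Norms of the Nevanlinna matrix *)

Lemma lub_bounds (E : R -> Prop) (x m : R) :
  E x -> (forall t, E t -> t <= m) -> x <= real (Lub_Rbar E) <= m.
Proof.
  intros Hx Hm. destruct (Lub_Rbar_correct E) as [Hub Hlub].
  assert (H1 : Rbar_le x (Lub_Rbar E)) by (apply Hub, Hx).
  assert (H2 : Rbar_le (Lub_Rbar E) m) by (apply Hlub; intros t Ht; exact (Hm t Ht)).
  destruct (Lub_Rbar E); simpl in *; tauto.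
Qed.

Lemma euclid2_le (u v : C) : euclid2 u v <= Cmod u + Cmod v.
Proof.
  unfold euclid2. mod_ge0 u. mod_ge0 v.
  rewrite <- (sqrt_pow2 (Cmod u + Cmod v)) by lra. apply sqrt_le_1_alt. nra.
Qed.

Lemma euclid2_ge (u v : C) : Cmod u <= euclid2 u v /\ Cmod v <= euclid2 u v.
Proof.
  unfold euclid2. mod_ge0 u. mod_ge0 v.
  split.
  - rewrite <- (sqrt_pow2 (Cmod u)) at 1 by lra. apply sqrt_le_1_alt. nra.
  - rewrite <- (sqrt_pow2 (Cmod v)) at 1 by lra. apply sqrt_le_1_alt. nra.
Qed.

Lemma mat_norm_bounds (m11 m12 m21 m22 : C) :
  let M := ((m11, m12), (m21, m22)) in
  Cmod m21 <= mat_norm M /\ Cmod m22 <= mat_norm M /\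
  mat_norm M <= Cmod m11 + Cmod m12 + Cmod m21 + Cmod m22.
Proof.
  intros M. cbv beta iota delta [mat_norm M].
  set (E := fun t => exists x y : C, euclid2 x y = 1 /\
     t = euclid2 (m11 * x + m12 * y)%C (m21 * x + m22 * y)%C).
  assert (Hub : forall t, E t -> t <= Cmod m11 + Cmod m12 + Cmod m21 + Cmod m22).
  { intros t [x [y [H1 ->]]]. destruct (euclid2_ge x y) as [Hx Hy]. rewrite H1 in Hx, Hy.
    mod_ge0 x. mod_ge0 y.
    bound_by euclid2_le.
    pose proof (Cmod_triangle (m11 * x)%C (m12 * y)%C) as T1.
    pose proof (Cmod_triangle (m21 * x)%C (m22 * y)%C) as T2.
    rewrite !Cmod_mult in T1, T2.
    assert (Hm : forall c w, 0 <= Cmod w <= 1 -> Cmod c * Cmod w <= Cmod c).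
    { intros c w Hw. mod_ge0 c. nra. }
    pose proof (Hm m11 x ltac:(lra)). pose proof (Hm m12 y ltac:(lra)).
    pose proof (Hm m21 x ltac:(lra)). pose proof (Hm m22 y ltac:(lra)). lra. }
  assert (E10 : E (euclid2 m11 m21)).
  { exists (RtoC 1), (RtoC 0). split.
    - unfold euclid2. rewrite Cmod_1, Cmod_0. replace (1 ^ 2 + 0 ^ 2) with 1 by ring. apply sqrt_1.
    - f_equal; ring. }
  assert (E01 : E (euclid2 m12 m22)).
  { exists (RtoC 0), (RtoC 1). split.
    - unfold euclid2. rewrite Cmod_1, Cmod_0. replace (0 ^ 2 + 1 ^ 2) with 1 by ring. apply sqrt_1.
    - f_equal; ring. }
  pose proof (lub_bounds E _ _ E10 Hub) as B1. pose proof (lub_bounds E _ _ E01 Hub) as B2.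
  destruct (euclid2_ge m11 m21) as [_ G1]. destruct (euclid2_ge m12 m22) as [_ G2].
  repeat split; lra.
Qed.

Lemma ln_le_exponent (x m : R) : 0 <= m -> x <= exp m -> ln x <= m.
Proof.
  intros Hm Hx. destruct (Rlt_le_dec 0 x) as [H|H].
  - rewrite <- (ln_exp m). apply ln_le; assumption.
  - unfold ln. destruct (Rlt_dec 0 x); [exfalso; lra|exact Hm].
Qed.

Lemma solves_flip (sg : R) (b a u : nat -> R) :
  sg = 1 \/ sg = -1 -> solves b a u ->
  solves b (fun n => sg * a n) (fun n => sg ^ n * u n).
Proof.
  intros Hsg H n. specialize (H n). simpl.
  assert (E : sg * sg = 1) by (destruct Hsg; subst; ring).
  transitivity ((sg * sg) * sg ^ n * (b (S n) * u (S (S n)) + a (S n) * u (S n))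
                + sg ^ n * (b n * u n)); [ring|].
  rewrite E. transitivity (sg ^ n * (b (S n) * u (S (S n)) + a (S n) * u (S n) + b n * u n)); [ring|].
  rewrite H. ring.
Qed.

Lemma log_norm_upper (a b g : nat -> R) (K X : R) (m : nat) (z : C) :
  (forall n, 0 < b n) -> 0 <= K -> (forall n, 0 <= g n) -> ex_series g ->
  (forall n, real_p a b n ^ 2 + real_q a b n ^ 2 <= K * g n) -> 1 <= X ->
  (forall w, Cmod (fst w) + Cmod (snd w) <= 1 -> forall n,
    cnorm (coef1 (real_p a b) (real_q a b) z w) (coef2 (real_p a b) (real_q a b) z w) (m + n)
    <= exp X) ->
  ln (mat_norm (nevanlinna a b z)) <= 2 * X.
Proof.
  intros Hb HK Hg0 Hgs Hg HX Hub.
  destruct (nevanlinna_lim a b g K z Hb HK Hg0 Hgs Hg) as [L1 L2].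
  assert (Hc : forall w l, Cmod (fst w) + Cmod (snd w) <= 1 ->
     is_lim_seq (cnorm (coef1 (real_p a b) (real_q a b) z w) (coef2 (real_p a b) (real_q a b) z w)) l ->
     Rbar_le l (exp X)).
  { intros w l Hw Hl. apply (is_lim_seq_incr_n _ m) in Hl.
    refine (is_lim_seq_le _ (fun _ => exp X) l (exp X) _ Hl (is_lim_seq_const _)).
    intros n. cbv beta. rewrite Nat.add_comm. apply Hub, Hw. }
  assert (B1 := Hc (RtoC 1, RtoC 0) _ ltac:(cbn [fst snd]; rewrite Cmod_1, Cmod_0; lra) L1).
  assert (B2 := Hc (RtoC 0, RtoC 1) _ ltac:(cbn [fst snd]; rewrite Cmod_1, Cmod_0; lra) L2). simpl in B1, B2.
  destruct (mat_norm_bounds (nev_A a b z) (nev_C a b z) (nev_B a b z) (nev_D a b z)) as [_ [_ B3]].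
  fold (nevanlinna a b z) in B3.
  apply ln_le_exponent; [lra|]. apply Rle_trans with (2 * exp X); [lra|].
  replace (2 * X) with (X + X) by ring. rewrite exp_plus.
  pose proof (exp_ge_1p X). apply Rmult_le_compat_r; [left; apply exp_pos|lra].
Qed.

Lemma log_norm_lower (a b g : nat -> R) (K r c : R) (m : nat) (z : C) :
  (forall n, 0 < b n) -> 0 <= K -> (forall n, 0 <= g n) -> ex_series g ->
  (forall n, real_p a b n ^ 2 + real_q a b n ^ 2 <= K * g n) -> 20 <= r ->
  (forall n, r * exp (c * psum (fun k => r * g (m + k)%nat) n)
     <= 5 * cnorm (coef1 (real_p a b) (real_q a b) z (RtoC 1, RtoC 0))
                  (coef2 (real_p a b) (real_q a b) z (RtoC 1, RtoC 0)) (m + n) ^ 2) ->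
  c * (r * tail_sum g m) <= 2 * ln (mat_norm (nevanlinna a b z)).
Proof.
  intros Hb HK Hg0 Hgs Hg Hr Hlow.
  destruct (nevanlinna_lim a b g K z Hb HK Hg0 Hgs Hg) as [L1 _].
  destruct (mat_norm_bounds (nev_A a b z) (nev_C a b z) (nev_B a b z) (nev_D a b z)) as [B1 [B2 _]].
  fold (nevanlinna a b z) in B1, B2. set (M := mat_norm (nevanlinna a b z)) in *.
  set (Y := r * tail_sum g m).
  set (l := Cmod (nev_B a b z) + Cmod (nev_D a b z)) in *.
  pose proof (Cmod_ge_0 (nev_B a b z)) as P1. pose proof (Cmod_ge_0 (nev_D a b z)) as P2.
  assert (Hlim : r * exp (c * Y) <= 5 * l ^ 2).
  { eapply (is_lim_seq_le _ _ (r * exp (c * Y)) (5 * l ^ 2) Hlow).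
    - apply is_lim_seq_mult'; [apply is_lim_seq_const|].
      apply (is_lim_seq_continuous exp _ (c * Y)); [apply derivable_continuous_pt, derivable_pt_exp|].
      apply is_lim_seq_mult'; [apply is_lim_seq_const|].
      apply is_lim_seq_ext with (fun n => r * psum (fun k => g (m + k)%nat) n);
        [intros n; rewrite psum_scal; reflexivity|].
      apply is_lim_seq_mult'; [apply is_lim_seq_const|]. apply psum_lim.
      apply (proj1 (ex_series_shift g m)), Hgs.
    - apply (is_lim_seq_incr_n _ m) in L1. fold l in L1.
      apply is_lim_seq_mult'; [apply is_lim_seq_const|].
      replace (l ^ 2) with (l * l) by ring.
      eapply is_lim_seq_ext; [|exact (is_lim_seq_mult' _ _ _ _ L1 L1)].
      intros n. cbv beta. rewrite (Nat.add_comm n). ring. }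
  (* [20 <= r] absorbs the factor [5] and the square of [l <= 2 * M]. *)
  assert (Hm2 : exp (c * Y) <= M ^ 2).
  { assert (l ^ 2 <= (2 * M) ^ 2) by (apply pow_incr; unfold l; lra).
    assert (20 * exp (c * Y) <= r * exp (c * Y))
      by (apply Rmult_le_compat_r; [left; apply exp_pos|lra]). lra. }
  pose proof (exp_pos (c * Y)) as Hexp. assert (Hmpos : 0 < M) by nra.
  rewrite <- (ln_exp (c * Y)). replace (2 * ln M) with (ln (M ^ 2)).
  - apply ln_le; [apply exp_pos|exact Hm2].
  - rewrite ln_pow by exact Hmpos. simpl. ring.
Qed.

Lemma energy_le_weaken (gamma b u : nat -> R) (k K : R) :
  (forall n, 0 < rate gamma b n) -> k <= K -> energy_le gamma b u k -> energy_le gamma b u K.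
Proof.
  intros Hg Hk Hu n. bound_by Hu. apply Rmult_le_compat_r; [left; apply Hg|exact Hk].
Qed.

Lemma energy_le_sq (gamma b u : nat -> R) (K : R) (n : nat) :
  (forall n, 0 < gamma n) -> energy_le gamma b u K -> u (S n) ^ 2 <= K * rate gamma b (S n).
Proof.
  intros Hg Hu. eapply Rle_trans; [|apply Hu].
  assert (0 <= gamma (S n) * (u (S n) - u n) ^ 2)
    by (apply Rmult_le_pos; [left; apply Hg|apply pow2_ge_0]). lra.
Qed.

(** The lower bound starts at [h + 1], the comparison function at [h]. *)
Lemma tail_sum_next (gamma b ap : nat -> R) (K : R) (e : nat -> R) :
  tame gamma b ap K e -> ex_series (rate gamma b) ->
  exists G, 0 < G /\ forall n, tail_sum (rate gamma b) n <= G * tail_sum (rate gamma b) (S n).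
Proof.
  intros [HK Hg Hb Hbup _ HSlow HSstep _ _ _ _ _] Hsum.
  set (G0 := (1 + K ^ 2) * K). assert (HG0 : 0 < G0) by (apply Rmult_lt_0_compat; nra).
  exists (1 + G0). split; [lra|]. intros n.
  assert (Hg0 : forall n, 0 <= rate gamma b n).
  { intros k. left. apply Rdiv_lt_0_compat; [apply sqrt_lt_R0|]; auto. }
  assert (Hstep : rate gamma b n <= G0 * rate gamma b (S n)).
  { pose proof (sqrt_lt_R0 _ (Hg n)).
    pose proof (Hb n). pose proof (Hb (S n)).
    specialize (Hbup n). specialize (HSlow (S n)). specialize (HSstep n).
    apply Rabs_le_between in HSstep. unfold rate, Rdiv, G0.
    assert (H3 : sqrt (gamma n) <= (1 + K ^ 2) * sqrt (gamma (S n))) by nra.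
    assert (H4 : / b n <= K * / b (S n)).
    { apply (Rle_div_r (/ b n) K (b (S n))); [lra|].
      rewrite Rmult_comm. apply (Rle_div_l (b (S n)) K (b n)); lra. }
    replace ((1 + K ^ 2) * K * (sqrt (gamma (S n)) * / b (S n)))
      with ((1 + K ^ 2) * sqrt (gamma (S n)) * (K * / b (S n))) by ring.
    assert (0 < / b n) by (apply Rinv_0_lt_compat; lra).
    apply Rmult_le_compat; lra. }
  rewrite (tail_sum_step _ n Hsum).
  pose proof (psum_le_tail_sum _ (S n) 1 Hg0 Hsum) as H1.
  simpl in H1. rewrite Nat.add_0_r in H1.
  assert (G0 * rate gamma b (S n) <= G0 * tail_sum (rate gamma b) (S n)).
  { mul_l. }
  lra.
Qed.

Theorem theorem3p2 :
  forall (gamma ta tb : nat -> R)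
    (gamma_pos : forall n, 0 < gamma n)
    (gamma_lim : is_lim_seq gamma p_infty)
    (gamma_step : is_lim_seq (fun n => sqrt (gamma (S n)) - sqrt (gamma n)) 0)
    (tb_pos : forall n, 0 < tb n)
    (Htempered : tempered gamma ta tb)
    (a b chi mu : nat -> R)
    (b_pos : forall n, 0 < b n)
    (Hb : forall n, b n = tb n * (1 + chi n))
    (Ha : forall n, a n = ta n * (1 + mu n))
    (Hpert : ex_series (fun n => sqrt (gamma n) * (Rabs (chi n) + Rabs (mu n)))),
  ex_finite_lim_seq (tau_seq gamma ta tb) /\
  (tau0 gamma ta tb < 0 ->
   ex_series (fun n => sqrt (gamma n) / b n) ->
   (exists alpha : R, 0 < alpha < 2 /\ regularly_varying b alpha) ->
   (exists beta : R, 0 < beta < 2 /\ regularly_varying gamma beta) ->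
   limit_circle a b /\
   asymp_infty
     (max_log_norm (nevanlinna a b))
     (fun r => r * tail_sum (fun n => sqrt (gamma n) / b n) (h_index gamma b r))).
Proof.
  intros.
  assert (Hpt : perturbed gamma ta tb a b chi mu) by (constructor; assumption).
  destruct (tempered_normalized gamma ta tb tb_pos Htempered) as [sg [s0 [D0 Hnf]]].
  pose proof (normalized_tau_lim gamma ta tb sg s0 D0 gamma_pos tb_pos gamma_lim Hnf) as Ltau.
  split; [exists (s0 ^ 2 - 4 * D0); exact Ltau|].
  intros Htau Hsum [alpha [Halpha Hrvb]] [beta [Hbeta Hrvg]].
  assert (Hdisc : s0 ^ 2 < 4 * D0).
  { unfold tau0 in Htau. rewrite (is_lim_seq_unique _ _ Ltau) in Htau. simpl in Htau. lra. }
  destruct (tame_of_perturbed gamma ta tb a b chi mu sg s0 D0 Hpt Hnf Hdisc) as [K [e Htame]].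
  pose proof (nf_sign _ _ _ _ _ _ Hnf) as Hsg.
  change (ex_series (rate gamma b)) in Hsum.
  change (fun n => sqrt (gamma n) / b n) with (rate gamma b).
  set (g := rate gamma b) in *.
  assert (Hg0 : forall n, 0 < g n).
  { intros n. apply Rdiv_lt_0_compat; [apply sqrt_lt_R0|]; auto. }
  assert (Hg0' : forall n, 0 <= g n) by (intros n; left; apply Hg0).
  set (p := real_p a b). set (q := real_q a b).
  set (p' := fun n => sg ^ n * p n). set (q' := fun n => sg ^ n * q n).
  assert (Sp : solves b (fun n => sg * a n) p').
  { apply solves_flip; [exact Hsg|]. apply rsol_solves, b_pos. }
  assert (Sq : solves b (fun n => sg * a n) q').
  { apply solves_flip; [exact Hsg|]. apply rsol_solves, b_pos. }
  assert (HW : forall n, wronskian b p' q' n ^ 2 = 1).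
  { intros n. replace (wronskian b p' q' n) with (sg * (sg ^ n * sg ^ n) * wronskian b p q n)
      by (unfold wronskian, p', q'; simpl; ring).
    rewrite (pow_sign sg n Hsg). unfold p, q. rewrite wronskian_real by exact b_pos.
    destruct Hsg; subst; ring. }
  destruct (tame_solution _ _ _ _ _ Htame p' Sp) as [Kp [HKp HEp]].
  destruct (tame_solution _ _ _ _ _ Htame q' Sq) as [Kq [HKq HEq]].
  set (K1 := Kp + Kq). assert (HK1 : 0 < K1) by (unfold K1; lra).
  apply (energy_le_weaken gamma b p' Kp K1 Hg0) in HEp; [|unfold K1; lra].
  apply (energy_le_weaken gamma b q' Kq K1 Hg0) in HEq; [|unfold K1; lra].
  destruct (eventually_all_le (fun n => p' n ^ 2 + q' n ^ 2) g (2 * K1) 1 Hg0) as [K0 [HK0 Hpq']].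
  { intros [|n] Hn; [lia|].
    pose proof (energy_le_sq gamma b p' K1 n gamma_pos HEp).
    pose proof (energy_le_sq gamma b q' K1 n gamma_pos HEq). unfold g. lra. }
  assert (Hsq : forall u n, (sg ^ n * u) ^ 2 = u ^ 2).
  { intros u n. replace ((sg ^ n * u) ^ 2) with ((sg ^ n * sg ^ n) * u ^ 2) by ring.
    rewrite (pow_sign sg n Hsg). ring. }
  assert (Hpq : forall n, p n ^ 2 + q n ^ 2 <= K0 * g n).
  { intros n. specialize (Hpq' n). unfold p', q' in Hpq'. rewrite !Hsq in Hpq'. exact Hpq'. }
  split.
  { assert (Hg2 : ex_series (fun n => K0 * g n)) by (apply ex_series_scal_R, Hsum).
    apply limit_circle_of_l2; [exact b_pos| |]; (eapply ex_series_nonneg_le; [|exact Hg2]);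
      intros n; cbv beta; specialize (Hpq n); fold p q;
      sq_ge0 (p n); sq_ge0 (q n); lra. }
  destruct (comparison_holds gamma b alpha beta gamma_pos b_pos Hsum ltac:(lra) Hrvb ltac:(lra) Hrvg)
    as [Hratio_inf [C [N1 Hcmp]]].
  destruct (growth_upper gamma b (fun n => sg * a n) K e p' q' K0 C N1 Htame Sp Sq HW Hcmp Hsum HK0 Hpq')
    as [M [HM Hupper]].
  destruct (growth_lower gamma b (fun n => sg * a n) K e p' q' K1 Htame gamma_lim Sp Sq HW HK1 HEp HEq)
    as [c1 [N2 [Hc1 Hlower]]].
  destruct (h_index_spec gamma b Hratio_inf (Nat.max N1 N2)) as [r0 Hh].
  destruct (tail_sum_next gamma b _ K e Htame Hsum) as [G [HG Htail]].
  exists (c1 / (2 * G)), (2 * M), (Rmax r0 20).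
  pose proof (Rmax_l r0 20) as Hm1. pose proof (Rmax_r r0 20) as Hm2.
  split; [apply Rdiv_lt_0_compat; lra|]. split; [lra|]. split; [lra|].
  intros r Hr0. destruct (Hh r ltac:(lra)) as [HNh [Hbh Hafter]].
  set (h := h_index gamma b r) in *.
  destruct (Hupper h r ltac:(lia) ltac:(lra) Hbh Hafter) as [HX1 Hub].
  fold g in HX1, Hub, Htail. set (X := r * tail_sum g h) in *.
  assert (Hcan : forall z w, canonical p' q' z (coef1 p q z w) (coef2 p q z w)).
  { intros z w. apply canonical_flip; [exact Hsg|]. apply canonical_product_correct. }
  assert (HubN : forall z, Cmod z = r -> ln (mat_norm (nevanlinna a b z)) <= 2 * M * X).
  { intros z Hz. rewrite Rmult_assoc.
    apply (log_norm_upper a b g K0 (M * X) (S h) z b_pos ltac:(lra) Hg0' Hsum Hpq HX1).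
    intros w Hw. apply (Hub z); [exact Hz|apply Hcan|exact Hw]. }
  assert (HlbN : c1 / (2 * G) * X <= ln (mat_norm (nevanlinna a b (0, r)))).
  { set (z := (0, r)). set (w := (RtoC 1, RtoC 0)).
    assert (HF := form_lower p q r (coef1 p q z w) (coef2 p q z w)
      (canonical_product_correct p q z w) ltac:(lra) eq_refl eq_refl eq_refl eq_refl h).
    pose proof (log_norm_lower a b g K0 r c1 (S h) z b_pos ltac:(lra) Hg0' Hsum Hpq ltac:(lra)) as Hln.
    assert (HXG : c1 / (2 * G) * X <= c1 / (2 * G) * (r * (G * tail_sum g (S h)))).
    { apply Rmult_le_compat_l; [apply Rdiv_le_0_compat; lra|].
      mul_l; apply Htail. }
    replace (c1 / (2 * G) * (r * (G * tail_sum g (S h)))) with (c1 * (r * tail_sum g (S h)) / 2)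
      in HXG by (field; lra).
    enough (c1 * (r * tail_sum g (S h)) <= 2 * ln (mat_norm (nevanlinna a b z))) by lra.
    apply Hln. intros n.
    eapply Rle_trans; [|apply (Hlower h r _ _ ltac:(lia) ltac:(lra) Hafter (Hcan z w)); lra].
    apply Rmult_le_compat_r; [left; apply exp_pos|exact HF]. }
  destruct (lub_bounds (fun t => exists z : Complex.C, Cmod z = r /\ t = ln (mat_norm (nevanlinna a b z)))
    (ln (mat_norm (nevanlinna a b (0, r)))) (2 * M * X)) as [Hl1 Hl2].
  - exists (0, r). split; [|reflexivity]. unfold Cmod. simpl.
    replace (0 * (0 * 1) + r * (r * 1)) with (r ^ 2) by ring. apply sqrt_pow2. lra.
  - intros t [z [Hz ->]]. apply HubN, Hz.
  - fold (max_log_norm (nevanlinna a b) r) in Hl1, Hl2. lra.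
Qed.
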